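(* Let $T>\pi$ and let $\mathcal{G}_{\mathrm{Burg}}$ and $\mu$ be as in the context. There exists a constant $C>0$ such that for any $\epsilon\in(0,\tfrac12]$ and any grid size $N\ge3$ there exists a (ReLU) FNO $\mathcal{N}^{\mathrm{FNO}}_\epsilon$ with \[ \mathbb{E}_{\bar u\sim\mu}\big[\|\mathcal{G}_{\mathrm{Burg}}(\bar u)-\mathcal{N}^{\mathrm{FNO}}_\epsilon(\bar u)\|_{L^1(\mathbb{T})}\big]\le\epsilon, \] Fourier cut-off $k_{\max}=1$, lifting dimension $d_v\le C$, $\mathrm{depth}(\mathcal{N}^{\mathrm{FNO}}_\epsilon)\le C\log(\epsilon^{-1})^2$ and $\mathrm{size}(\mathcal{N}^{\mathrm{FNO}}_\epsilon)\le C\log(\epsilon^{-1})^2$.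
   Context: $\mathbb{T}=\mathbb{R}/2\pi\mathbb{Z}$. $\mu$ is the law of $\bar u(x)=-\sin(x-\xi)$, $\xi\sim\mathrm{Unif}[0,2\pi]$; $\mathcal{G}_{\mathrm{Burg}}(\bar u)=u(\cdot,T)$ with $u$ the entropy solution of $\partial_tu+\partial_x(u^2/2)=0$ on $\mathbb{T}$, $u(\cdot,0)=\bar u$. FNO with grid size $N$: $x_j=2\pi j/N$, $\mathcal{F}_Nv(k)=\frac1N\sum_{j=1}^Nv(x_j)e^{-ikx_j}$. An FNO with lifting dimension $d_v$, cut-off $k_{\max}$, depth $L$, ReLU activation $\sigma$ is $\mathcal{N}=Q\circ\mathcal{L}_L\circ\dots\circ\mathcal{L}_1\circ R$, $(R\bar u)(x)=R(\bar u(x),x)$ with $R$ a shallow ReLU network into $\mathbb{R}^{d_v}$, $(\mathcal{L}_\ell v)(x)=\sigma(W_\ell v(x)+b_\ell(x)+(K_\ell v)(x))$, $W_\ell\in\mathbb{R}^{d_v\times d_v}$, $(K_\ell v)(x)=\sum_{|k|\le k_{\max}}P_\ell(k)\mathcal{F}_Nv(k)e^{ikx}$, $P_\ell(k)\in\mathbb{C}^{d_v\times d_v}$, real bias $b_\ell(x)=\sum_{|k|\le k_{\max}}\hat b_\ell(k)e^{ikx}$, $Q$ linear pointwise. Outputs are defined for all $x\in\mathbb{T}$. Depth $=L$; size = total number of tunable parameters. *)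

(* Defs.v *)
From HB Require Import structures.
From mathcomp Require Import all_boot all_order all_algebra.
From mathcomp Require Import all_classical all_reals all_analysis.
Set Implicit Arguments. Unset Strict Implicit. Unset Printing Implicit Defensive.
Import Order.TTheory GRing.Theory Num.Theory.
Import numFieldNormedType.Exports.
Local Open Scope classical_set_scope.
Local Open Scope ring_scope.

Definition test_fun (R : realType) (phi phit phix : R -> R -> R) : Prop :=
  (forall t x, 0 <= phi t x) /\
  (forall t x : R, is_derive t (1:R) (fun s => phi s x) (phit t x)) /\
  (forall t x : R, is_derive x (1:R) (fun y => phi t y) (phix t x)) /\
  continuous (fun p : R * R => phit p.1 p.2) /\
  continuous (fun p : R * R => phix p.1 p.2) /\
  (exists a b c : R, 0 < a /\
     forall t x, phi t x != 0 -> a <= t <= b /\ `|x| <= c).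

Definition per_dom (R : realType) : set R := `[0, 2 * pi].

Definition burgers_flux (R : realType) (v : R) : R := v ^+ 2 / 2.

Definition entropy_solution (R : realType) (u : R -> R -> R) (u0 : R -> R)
  : Prop :=
  (forall x t, u (x + 2 * pi) t = u x t) /\
  (exists M : R, forall x t, 0 <= t -> `|u x t| <= M) /\
  measurable_fun setT (fun p : R * R => u p.2 p.1) /\
  (forall (k : R) (phi phit phix : R -> R -> R), test_fun phi phit phix ->
     (0 <= \int[(@lebesgue_measure R) \x (@lebesgue_measure R)]_(p in setT)
        ((`|u p.2 p.1 - k| * phit p.1 p.2
          + Num.sg (u p.2 p.1 - k)
            * (burgers_flux (u p.2 p.1) - burgers_flux k) * phix p.1 p.2)%:E))%E) /\
  (forall t0 : R, 0 <= t0 -> forall e : R, 0 < e -> exists d : R, 0 < d /\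
     forall t : R, 0 <= t -> `|t - t0| < d ->
       (\int[@lebesgue_measure R]_(x in @per_dom R) (`|u x t - u x t0|)%:E
          <= e%:E)%E) /\
  (forall x, u x 0 = u0 x).

Definition ubar (R : realType) (xi : R) : R -> R := fun x => - sin (x - xi).

Unset Implicit Arguments.
Record FNO (R : realType) := MkFNO {
  fno_dv : nat;
  fno_kmax : nat;
  fno_width : nat;
  fno_depth : nat;
  fno_A1 : 'M[R]_(fno_width, 2);
  fno_c1 : 'cV[R]_fno_width;
  fno_A2 : 'M[R]_(fno_dv, fno_width);
  fno_c2 : 'cV[R]_fno_dv;
  (* layer weights: W_l, P_l(k) = PA_l(k) + i PB_l(k), and bias
     coefficients bhat_l(k) = bA_l(k) + i bB_l(k), k = -kmax..kmax
     (index i : 'I_(2 kmax + 1) stands for k = i - kmax) *)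
  fno_W : 'I_fno_depth -> 'M[R]_fno_dv;
  fno_PA : 'I_fno_depth -> 'I_(2 * fno_kmax + 1) -> 'M[R]_fno_dv;
  fno_PB : 'I_fno_depth -> 'I_(2 * fno_kmax + 1) -> 'M[R]_fno_dv;
  fno_bA : 'I_fno_depth -> 'I_(2 * fno_kmax + 1) -> 'cV[R]_fno_dv;
  fno_bB : 'I_fno_depth -> 'I_(2 * fno_kmax + 1) -> 'cV[R]_fno_dv;
  fno_Q : 'rV[R]_fno_dv }.
Arguments MkFNO {R}.
Arguments fno_dv {R}.
Arguments fno_kmax {R}.
Arguments fno_width {R}.
Arguments fno_depth {R}.
Arguments fno_A1 {R}.
Arguments fno_c1 {R}.
Arguments fno_A2 {R}.
Arguments fno_c2 {R}.
Arguments fno_W {R}.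
Arguments fno_PA {R}.
Arguments fno_PB {R}.
Arguments fno_bA {R}.
Arguments fno_bB {R}.
Arguments fno_Q {R}.
Set Implicit Arguments.

Section FNOdefs.
Variable R : realType.

Definition relu_mx m n (A : 'M[R]_(m, n)) : 'M[R]_(m, n) :=
  map_mx (fun a => Num.max a 0) A.

Definition trep (x : R) : R := x - 2 * pi * (Num.floor (x / (2 * pi)))%:~R.

Definition grid (N : nat) (j : 'I_N) : R := 2 * pi * (j.+1)%:R / N%:R.

Variable net : FNO R.

Local Notation dv := (fno_dv net).
Local Notation kmax := (fno_kmax net).

Definition wnum (i : 'I_(2 * kmax + 1)) : R := i%:R - kmax%:R.

Definition fno_lift (a x : R) : 'cV[R]_dv :=
  fno_A2 net *m relu_mx (fno_A1 net *m (\col_(i < 2) (if i == ord0 then a else trep x))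
                         + fno_c1 net) + fno_c2 net.

(* Real part of  sum_{|k|<=kmax} bhat(k) e^{ikx} *)
Definition fno_bias (l : 'I_(fno_depth net)) (x : R) : 'cV[R]_dv :=
  \sum_(i < 2 * kmax + 1)
    (cos (wnum i * x) *: fno_bA net l i - sin (wnum i * x) *: fno_bB net l i).

(* Real part of  sum_{|k|<=kmax} P(k) F_N v(k) e^{ikx},  with
   F_N v(k) = 1/N sum_j v(x_j) e^{-ikx_j}: writing P = PA + i PB,
   Re[P(k) F_N v(k) e^{ikx}] = PA alpha_k(x) - PB beta_k(x) where
   alpha_k(x) = 1/N sum_j cos(k (x - x_j)) v(x_j),
   beta_k(x)  = 1/N sum_j sin(k (x - x_j)) v(x_j). *)
Definition fno_K (N : nat) (l : 'I_(fno_depth net)) (v : R -> 'cV[R]_dv) (x : R)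
  : 'cV[R]_dv :=
  \sum_(i < 2 * kmax + 1)
    (fno_PA net l i *m ((N%:R)^-1 *:
        \sum_(j < N) (cos (wnum i * (x - grid j)) *: v (grid j)))
     - fno_PB net l i *m ((N%:R)^-1 *:
        \sum_(j < N) (sin (wnum i * (x - grid j)) *: v (grid j)))).

Definition fno_layer (N : nat) (l : 'I_(fno_depth net)) (v : R -> 'cV[R]_dv)
  : R -> 'cV[R]_dv :=
  fun x => relu_mx (fno_W net l *m v x + fno_bias l x + fno_K N l v x).

Definition fno_eval (N : nat) (u : R -> R) : R -> R :=
  let v0 := fun x => fno_lift (u x) x in
  let vL := foldl (fun v l => fno_layer N l v) v0 (enum 'I_(fno_depth net)) in
  fun x => (fno_Q net *m vL x) ord0 ord0.

(* total number of real tunable parameters (complex entries count twice) *)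
Definition fno_size : nat :=
  (fno_width net * 2 + fno_width net + dv * fno_width net + dv)
  + fno_depth net * (dv * dv + (2 * kmax + 1) * (2 * (dv * dv))
                     + (2 * kmax + 1) * (2 * dv))
  + dv.

End FNOdefs.

(* Main.v *)
Require Import Defs.
From HB Require Import structures.
From mathcomp Require Import all_boot all_order all_algebra.
From mathcomp Require Import all_classical all_reals all_analysis.
From mathcomp Require Import measurable_realfun.
From mathcomp Require Import ring lra zify.
Import Order.TTheory GRing.Theory Num.Theory.
Import numFieldNormedType.Exports.
Local Open Scope classical_set_scope.
Local Open Scope ring_scope.
Set Implicit Arguments.
Unset Strict Implicit.
Unset Printing Implicit Defensive.

(* Follow the characteristics of the datum [- sin x] (the case [xi = 0] up to
   translation): a stationary shock forms at [x = 0], and for [T > pi] the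
   profile at time [T] is smooth and 1-Lipschitz off the shock, being given on
   [0 < x <= 2 pi] by [sin y], where [y + T sin y = x - pi] and [|y| <= pi / 2].

   That every entropy solution has this profile is a doubling-free Kruzhkov
   argument.  Sample the datum at mesh points; the characteristics issued from
   them, stopped smoothly at the shock, are fronts that cut the strip into thin
   layers.  On each layer use the entropy inequality with the constant datum
   value carried by the layer and a test function supported there.  In the sum
   the flux terms at a front cancel up to the product of the jump and the
   mismatch between the front speed and the characteristic speed; the shock
   contributes with the good sign.  The errors vanish as the mesh is refined.

   A network obtains [cos] and [sin] of the angle [x - xi -+ pi] from one Fourier
   multiplier with wave number 1.  CORDIC rotations by [pi / 2 ^ k], each chosen
   by a steep ReLU approximation of a sign, then recover the angle up to
   [pi / 2 ^ n], and a second bisection solves [y + T sin y = angle].  Both take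
   [n ~ log (1 / eps)] steps of fixed width.  The sign approximations fail only
   for angles near the grid [(pi / 2 ^ n) Z]; their slopes are not constrained,
   so that this bad set is as small as desired. *)

(** The comparison state is constant on each layer, so the entropy inequality with a constant
    applies to it directly; this replaces the doubling of variables. The price is one flux error per
    front. A jump of size [mesh] times a speed mismatch of size [mesh] is summed over
    [m = pi / mesh] pairs of fronts and vanishes with the mesh. While a characteristic is being
    stopped the mismatch is only bounded by 1, so this must not last longer than a multiple of
    [mesh]; the width [mesh * sin mesh] of the stopping zone ensures it.

    The two bisections get their margins differently. The first reads a continuous angle and has to
    exclude a set of inputs, but it returns an exact grid angle. The second therefore evaluates its
    test at finitely many points only, and a positive margin exists by finiteness. The jump of the
    target at the shock costs nothing extra: there the angle is [pi] or [- pi], a grid point, so the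
    shock lies in the excluded set. *)

Section Profiles.
Context {R : realType}.
Implicit Types x y z t u k s h : R.

Definition pos z : R := Num.max z 0.

Variant pos_spec z : R -> Prop :=
  | PosLe of z <= 0 : pos_spec z 0
  | PosGe of 0 <= z : pos_spec z z.

Lemma posP z : pos_spec z (pos z).
Proof.
rewrite /pos; case: (leP z 0) => z0.
  by constructor.
by constructor; exact: ltW.
Qed.

(** A quadratic remainder gives differentiability without one-sided limits at the points where [pos]
    changes formula. *)
Lemma quadratic_is_derive (f : R -> R) (d C z : R) :
  (forall y, `|f y - f z - d * (y - z)| <= C * (y - z) ^+ 2) ->
  is_derive z (1 : R) f d.
Proof.
move=> fd.
have C0 : 0 <= C.
  have := fd (z + 1); rewrite (addrC z) addrK expr1n !mulr1.
  by move/(le_trans (normr_ge0 _)).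
have lim : (h^-1 *: ((f \o shift z) h%:A - f z)) @[h --> 0^'] --> d.
  apply/cvgrPdist_le => /= e e0.
  near=> h.
  have h0 : h != 0 by near: h; exact: nbhs_dnbhs_neq.
  have := fd (h + z); rewrite addrK => H.
  rewrite /shift /= -[h%:A]/(h * 1) mulr1 -[_ *: _]/(h^-1 * _).
  have -> : d - h^-1 * (f (h + z) - f z) = - h^-1 * (f (h + z) - f z - d * h).
    by field.
  rewrite normrM normrN normfV.
  rewrite ler_pdivrMl ?normr_gt0//.
  apply: (le_trans H).
  rewrite -[h ^+ 2]real_normK ?num_real// expr2 mulrA [leRHS]mulrC.
  apply: ler_wpM2r => //.
  have : `|h| <= e / (C + 1).
    near: h; apply: dnbhs0_le; apply: divr_gt0 => //; lra.
  rewrite ler_pdivlMr; last lra.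
  move=> H2; apply: le_trans H2; rewrite mulrC ler_wpM2l//; lra.
apply: DeriveDef.
  by apply/cvg_ex; exists d.
by apply/cvg_lim.
Unshelve. all: by end_near.
Qed.

Definition qpos z : R := pos z ^+ 2 / 2.

Lemma qpos_quadratic a b :
  - ((a - b) ^+ 2 / 2) <= pos a ^+ 2 / 2 - pos b ^+ 2 / 2 - pos b * (a - b)
    <= (a - b) ^+ 2 / 2.
Proof.
have ? := sqr_ge0 (a - b).
by case: (posP a); case: (posP b) => ? ?; apply/andP; split; nra.
Qed.

(** A tent on [[0, 1]] of height 2 and mass 1. Its primitive [ramp] is a step from 0 to 1 with the
    continuous derivative that test functions must have. *)
Definition hat z : R := 4 * (pos z - 2 * pos (z - 1 / 2) + pos (z - 1)).
Definition ramp z : R := 4 * (qpos z - 2 * qpos (z - 1 / 2) + qpos (z - 1)).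

Lemma hat_ge0 z : 0 <= hat z.
Proof. by rewrite /hat; case: posP; case: posP; case: posP => *; lra. Qed.

Lemma hat_le2 z : hat z <= 2.
Proof. by rewrite /hat; case: posP; case: posP; case: posP => *; lra. Qed.

Lemma hat_eq0 z : z <= 0 \/ 1 <= z -> hat z = 0.
Proof. by move=> []; rewrite /hat; case: posP; case: posP; case: posP => *; lra. Qed.

Lemma ramp_eq0 z : z <= 0 -> ramp z = 0.
Proof. by rewrite /ramp /qpos; case: posP; case: posP; case: posP => *; nra. Qed.

Lemma ramp_eq1 z : 1 <= z -> ramp z = 1.
Proof. by rewrite /ramp /qpos; case: posP; case: posP; case: posP => *; nra. Qed.

Lemma ramp_mono y z : y <= z -> ramp y <= ramp z.
Proof.
rewrite /ramp /qpos.
case: (posP y); case: (posP z); try lra;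
case: (posP (y - 1/2)); case: (posP (z - 1/2)); try lra;
case: (posP (y - 1)); case: (posP (z - 1)); try lra => *; nra.
Qed.

Lemma ramp_ge0 z : 0 <= ramp z.
Proof.
case: (lerP z 0) => z0; first by rewrite ramp_eq0.
by rewrite -(ramp_eq0 (lexx 0)); apply: ramp_mono; exact: ltW.
Qed.

Lemma ramp_le1 z : ramp z <= 1.
Proof.
case: (lerP 1 z) => z0; first by rewrite ramp_eq1.
by rewrite -(ramp_eq1 (lexx 1)); apply: ramp_mono; exact: ltW.
Qed.

(** The derivative [dsoft e] grows linearly from 0 to 1 on [[0, 2 * e]]; beyond that, [soft e z] is
    [z - e] and not [z]. *)
Definition soft e z : R := (qpos z - qpos (z - 2 * e)) / (2 * e).
Definition dsoft e z : R := (pos z - pos (z - 2 * e)) / (2 * e).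

Lemma soft_eq0 e z : 0 < e -> z <= 0 -> soft e z = 0.
Proof.
move=> e0 z0; rewrite /soft (_ : qpos z - _ = 0) ?mul0r// /qpos.
by case: posP; case: posP => *; nra.
Qed.

Lemma dsoft_eq0 e z : 0 < e -> z <= 0 -> dsoft e z = 0.
Proof.
move=> e0 z0; rewrite /dsoft (_ : pos z - _ = 0) ?mul0r//.
by case: posP; case: posP => *; lra.
Qed.

Lemma dsoft_eq1 e z : 0 < e -> 2 * e <= z -> dsoft e z = 1.
Proof.
move=> e0 ez; rewrite /dsoft (_ : pos z - _ = 2 * e) ?divff//; last first.
  by case: posP; case: posP => *; lra.
by lra.
Qed.

Lemma dsoft_ge0 e z : 0 < e -> 0 <= dsoft e z.
Proof.
rewrite /dsoft => e0; rewrite divr_ge0//; last lra.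
by case: posP; case: posP => *; lra.
Qed.

Lemma dsoft_le1 e z : 0 < e -> dsoft e z <= 1.
Proof.
rewrite /dsoft => e0; rewrite ler_pdivrMr ; last lra.
by case: posP; case: posP => *; lra.
Qed.

Lemma soft_ge e z : 0 < e -> z - e <= soft e z.
Proof.
rewrite /soft /qpos => e0; rewrite ler_pdivlMr ; last lra.
by case: posP; case: posP => *; nra.
Qed.

Lemma soft_le e z : 0 < e -> soft e z <= pos z.
Proof.
rewrite /soft /qpos => e0; rewrite ler_pdivrMr ; last lra.
by case: posP; case: posP => *; nra.
Qed.

Lemma soft_large e z : 0 < e -> 2 * e <= z -> soft e z = z - e.
Proof.
move=> e0 ez; apply: (@mulIf _ (2 * e)); first by rewrite mulf_neq0; lra.
rewrite /soft -mulrA mulVf ?mulr1; last lra.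
rewrite /qpos.
by case: posP; case: posP => *; nra.
Qed.

Lemma soft_ge0 e z : 0 < e -> 0 <= soft e z.
Proof.
rewrite /soft /qpos => e0; rewrite ler_pdivlMr ; last lra.
by case: posP; case: posP => *; nra.
Qed.

Lemma soft_mono e y z : 0 < e -> y <= z -> soft e y <= soft e z.
Proof.
rewrite /soft /qpos => e0 yz; rewrite ler_pM2r ?invr_gt0; last lra.
case: (posP y); case: (posP z); case: (posP (y - 2 * e)); case: (posP (z - 2 * e)) => *; nra.
Qed.

Lemma is_derive_ramp z : is_derive z (1 : R) ramp (hat z).
Proof.
apply: (@quadratic_is_derive _ _ 8) => y; rewrite /ramp /hat /qpos ler_norml.
have /andP[] := qpos_quadratic y z; have /andP[] := qpos_quadratic (y-1/2) (z-1/2); have /andP[] := qpos_quadratic (y-1) (z-1).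
have -> : y - 1 - (z - 1) = y - z by ring.
have -> : y - 1/2 - (z - 1/2) = y - z by ring.
have := sqr_ge0 (y - z).
set p := (y - z) ^+ 2 => p0 *.
by apply/andP; split; lra.
Qed.

Lemma is_derive_soft e z : 0 < e -> is_derive z (1 : R) (soft e) (dsoft e z).
Proof.
move=> e0; apply: (@quadratic_is_derive _ _ (1 / (2 * e))) => y; rewrite /soft /dsoft /qpos.
have /andP[] := qpos_quadratic y z; have /andP[] := qpos_quadratic (y-2 * e) (z-2*e).
have -> : y - 2 * e - (z - 2 * e) = y - z by ring.
set p := (y - z) ^+ 2 => *.
rewrite [X in `|X|](_ : _ = (pos y ^+ 2 / 2 - pos z ^+ 2 / 2 - pos z * (y - z) - (pos (y - 2 * e) ^+ 2 / 2 -
       pos (z - 2 * e) ^+ 2 / 2 - pos (z - 2 * e) * (y - z))) * (1/ (2 * e))); last by field; lra.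
rewrite normrM [`|1 / _|]ger0_norm; last by rewrite divr_ge0 //; lra.
rewrite [leRHS]mulrC ler_wpM2r//; first by rewrite divr_ge0 //; lra.
by rewrite ler_norml; apply/andP; split; lra.
Qed.

(* Kruzhkov entropy flux minus [s] times the entropy: the flux through a front of speed [s] *)
Definition relflux s u k : R := `|u - k| * ((u + k) / 2 - s).

(** On either side of [u] the derivative in [k] is [s - k] up to sign, hence at most [b + e] between
    [k1] and [k2]. A front that moves at its characteristic speed thus contributes to second order
    only. *)
Lemma relflux_diff s u k1 k2 (e b : R) : `|k1 - k2| <= e -> `|s - k1| <= b ->
  relflux s u k1 - relflux s u k2 <= e * (b + e).
Proof.
rewrite /relflux !ler_norml => /andP[? ?] /andP[? ?].
have ? : 0 <= e by lra. have ? : 0 <= b by lra.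
by case: (ger0P (u - k1)) => ?; case: (ger0P (u - k2)) => ?; nra.
Qed.

(** The entropy condition of a stationary shock with left value [s] and right value [- s]: the
    difference is [u ^+ 2 - s ^+ 2] for [u] between these values and 0 otherwise. *)
Lemma relflux_shock u s : 0 <= s -> relflux 0 u (- s) - relflux 0 u s <= 0.
Proof.
rewrite /relflux => s0.
by case: (ger0P (u - s)) => ?; case: (ger0P (u - - s)) => ?; nra.
Qed.

End Profiles.

(** * Monotonicity and comparison estimates for the sine *)

Section Trig.
Context {R : realType}.
Implicit Types a b x y z : R.

Lemma is_derive_MVT (f df : R -> R) a b : (forall x, is_derive x (1 : R) f (df x)) ->
  a <= b -> exists2 c, a <= c <= b & f b - f a = df c * (b - a).
Proof.
move=> dfx ab.
have [|c] := @MVT_segment R f df a b ab (fun x _ => dfx x).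
  apply: derivable_within_continuous => x _; exact: (@ex_derive _ _ _ _ _ _ _ (dfx x)).
by rewrite in_itv/= => cab ->; exists c.
Qed.

Lemma sin_lipschitz x y : `|sin x - sin y| <= `|x - y|.
Proof.
wlog yx : x y / y <= x.
  move=> H; case: (leP y x) => [/H//|/ltW/H].
  by rewrite distrC [leRHS]distrC.
have [c _ ->] := is_derive_MVT (@is_derive_sin R) yx.
by rewrite normrM ler_piMl//; exact: cos_max.
Qed.

(** The quotient [sin x / x] decreases up to [pi]. Characteristics issued nearer to the shock
    therefore reach it first, which keeps the fronts ordered. *)
Lemma sin_ratio a b : 0 <= a -> a <= b -> b <= pi -> a * sin b <= b * sin a.
Proof.
move=> a0 ab bpi.
(* Up to sign, this is the numerator of the derivative of [sin x / x]. *)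
have H1 : 0 <= sin a - a * cos a.
  have D x : is_derive x (1 : R) (fun x => sin x - x * cos x) (x * sin x).
    by apply: is_derive_eq; rewrite /GRing.scale /=; ring.
  have [c /andP[c0 ca]] := is_derive_MVT D a0.
  rewrite sin0 mul0r !subr0 => ->.
  apply: mulr_ge0 => //; apply: mulr_ge0 => //; apply: sin_ge0_pi.
  by rewrite c0; apply: le_trans bpi; exact: le_trans ab.
have D x : is_derive x (1 : R) (fun x => x * sin a - a * sin x) (sin a - a * cos x).
  apply: is_derive_eq; rewrite /GRing.scale /=; ring.
have [c /andP[ac cb]] := is_derive_MVT D ab.
rewrite -subr_ge0 => E.
suff : 0 <= (sin a - a * cos c) * (b - a) by rewrite -E; lra.
rewrite mulr_ge0 ?subr_ge0//; apply: (@le_trans _ _ (a * cos a)); last by rewrite -subr_ge0.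
apply: ler_wpM2l => //.
rewrite leNgt ltr_cos ?in_itv/= -?leNgt//; apply/andP; split; lra.
Qed.

Lemma sin_lower a : 0 <= a -> a <= pi / 2 -> a <= pi / 2 * sin a.
Proof.
move=> a0 ah; have := @sin_ratio a (pi / 2) a0 ah; rewrite sin_pihalf mulr1; apply.
have ? := @pi_gt0 R; lra.
Qed.

Lemma sin_subpi a : sin (a - pi) = - sin a.
Proof. by rewrite sinB cospi sinpi; ring. Qed.

Lemma le_sin_half x y : - (pi / 2) <= x -> x <= y -> y <= pi / 2 -> sin x <= sin y.
Proof.
move=> x0 xy y0.
rewrite leNgt ltr_sin ?in_itv/= -?leNgt//; apply/andP; split; lra.
Qed.

End Trig.

(** * The profile at time T *)

Section Branch.
Context {R : realType}.
Variable T : R.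
Implicit Types p w y z a : R.

(* The value [w = - sin a] starts at [a] and reaches [z = a - T sin a] at time [T];
   in terms of [y = a - pi] and [p = z - pi] this reads as below. *)
Definition branch p w : Prop :=
  exists y, [/\ - (pi / 2) <= y, y <= pi / 2, w = sin y & y + T * sin y = p].

(** Both [y] and [T * sin y] increase for [|y| <= pi / 2], so the increment of the second is at most
    the total. With [p = q] this is uniqueness of [w]. *)
Lemma branch_lipschitz p q w v : 0 < T -> branch p w -> branch q v ->
  T * `|w - v| <= `|p - q|.
Proof.
move=> T0 [y [y1 y2 -> <-]] [z [z1 z2 -> <-]].
wlog yz : y z y1 y2 z1 z2 / z <= y.
  move=> H; case: (leP z y) => [|/ltW zy]; first exact: H.
  by rewrite distrC [leRHS]distrC; apply: H.
have szy := le_sin_half z1 yz y2.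
rewrite !ger0_norm ?subr_ge0//; first lra.
by have := ler_wpM2l (ltW T0) szy; lra.
Qed.

Lemma branch_exists p : 0 < T -> `|p| <= T + pi / 2 -> exists w, branch p w.
Proof.
move=> T0; rewrite ler_norml => /andP[p1 p2].
have pi0 := @pi_gt0 R.
have h : - (pi / 2) <= pi / 2 :> R by lra.
have [||c] := @IVT R (fun y => y + T * sin y) (- (pi / 2)) (pi / 2) p h.
- apply: derivable_within_continuous => x _.
  have D : is_derive x (1 : R) (fun y => y + T * sin y) (1 + T * cos x).
    by apply: is_derive_eq; rewrite /GRing.scale /=; ring.
  exact: (@ex_derive _ _ _ _ _ _ _ D).
- rewrite sinN sin_pihalf mulrN !mulr1.
  rewrite ge_min le_max; apply/andP; split; apply/orP; [left|right]; lra.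
- by rewrite in_itv/= => /andP[c1 c2] <-; exists (sin c), c; split.
Qed.

Lemma branchN p w : branch p w -> branch (- p) (- w).
Proof.
by move=> [y [? ? -> <-]]; exists (- y); split; rewrite ?sinN; lra.
Qed.

Lemma branch_node a : pi / 2 <= a -> a <= pi -> branch (a - T * sin a - pi) (- sin a).
Proof.
have pi0 := @pi_gt0 R.
by move=> a1 a2; exists (a - pi); split; rewrite ?sin_subpi; lra.
Qed.

(* The clipping makes [profile] globally Lipschitz. *)
Definition clippi p : R := Num.max (- pi) (Num.min pi p).
Definition profile p : R := xget 0 [set w | branch (clippi p) w].

Lemma clippi_id p : `|p| <= pi -> clippi p = p.
Proof.
rewrite ler_norml /clippi => /andP[p1 p2].
by rewrite min_r// max_r.
Qed.

Lemma clippiP p : [\/ p <= - pi /\ clippi p = - pi, pi <= p /\ clippi p = pi |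
  - pi <= p <= pi /\ clippi p = p].
Proof.
have pi0 := @pi_gt0 R.
case: (leP p (- pi)) => p1.
  by apply: Or31; split=> //; rewrite /clippi min_r ?max_l//; lra.
case: (leP pi p) => p2.
  by apply: Or32; split=> //; rewrite /clippi min_l ?max_r//; lra.
apply: Or33; split; first lra.
by rewrite clippi_id// ler_norml; lra.
Qed.

Lemma clippi_bound p : `|clippi p| <= pi.
Proof.
have := @pi_gt0 R; rewrite ler_norml => pi0.
by have [[? ->]|[? ->]|[? ->]] := clippiP p; lra.
Qed.

Lemma clippi_lipschitz p q : `|clippi p - clippi q| <= `|p - q|.
Proof.
have := @pi_gt0 R; rewrite ler_norml => pi0.
by have [[? ->]|[? ->]|[? ->]] := clippiP p; have [[? ->]|[? ->]|[? ->]] := clippiP q;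
  case: (ger0P (p - q)) => ?; lra.
Qed.

Hypothesis hT : pi < T.
Let T0 : 0 < T. Proof. exact: lt_trans (pi_gt0 R) hT. Qed.

Lemma profile_clip p : branch (clippi p) (profile p).
Proof.
rewrite /profile; case: xgetP => [w -> //|].
have [|w bw] := @branch_exists (clippi p) T0; last by move=> /(_ w).
apply: (le_trans (clippi_bound p)); have ? := pi_gt0 R; have := hT; lra.
Qed.

Lemma profileP p : `|p| <= pi -> branch p (profile p).
Proof. by move=> pp; have := profile_clip p; rewrite clippi_id. Qed.

Lemma profile_uniq p w : `|p| <= pi -> branch p w -> profile p = w.
Proof.
move=> /profileP bp bw; apply/eqP; rewrite -subr_eq0 -normr_le0.
by have := branch_lipschitz T0 bp bw; rewrite subrr normr0 pmulr_rle0.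
Qed.

Lemma profileN p : `|p| <= pi -> profile (- p) = - profile p.
Proof. by move=> pp; apply: profile_uniq; rewrite ?normrN//; exact/branchN/profileP. Qed.

Lemma profile_lipschitz p q : `|profile p - profile q| <= `|p - q|.
Proof.
have := branch_lipschitz T0 (profile_clip p) (profile_clip q).
have := clippi_lipschitz p q; have := @pi_ge2 R; have := hT.
move=> T1 pi2 H1 H2; apply: le_trans H1; apply: (le_trans _ H2).
by rewrite ler_peMl//; lra.
Qed.

Lemma profile_le1 p : `|profile p| <= 1.
Proof. by have [y [_ _ -> _]] := profile_clip p; exact: sin_max. Qed.

Lemma continuous_profile : continuous profile.
Proof.
move=> x; apply/cvgrPdist_le => e e0; near=> y.
rewrite distrC; apply: (le_trans (profile_lipschitz _ _)); rewrite distrC.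
near: y; apply: cvgr_dist_le => //; exact: cvg_id.
Unshelve. all: by end_near.
Qed.

(** The two arcs are separated by the shock at 0. The value at 0 itself is an arbitrary choice, as
    the solution is identified only almost everywhere. *)
Definition shock_profile z : R := if 0 < z then profile (z - pi) else profile (z + pi).

Lemma shock_profile_le1 z : `|shock_profile z| <= 1.
Proof. by rewrite /shock_profile; case: ifP => _; exact: profile_le1. Qed.

Lemma measurable_shock_profile : measurable_fun [set: R] shock_profile.
Proof.
apply: measurable_fun_ifT.
- by apply: measurable_fun_ltr; [exact: measurable_cst|exact: measurable_id].
- apply: continuous_measurable_fun => x; apply: continuous_comp; last exact: continuous_profile.
  apply: cvgB; [exact: cvg_id|exact: cvg_cst].
- apply: continuous_measurable_fun => x; apply: continuous_comp; last exact: continuous_profile.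
  apply: cvgD; [exact: cvg_id|exact: cvg_cst].
Qed.

End Branch.

(** * Fronts made of characteristics *)

Section Fronts.
Context {R : realType}.
Variables (m : nat) (eta : R).
Hypothesis m0 : (0 < m)%N.
Implicit Types (t x z u : R) (i j : nat).

(* Positions are relative to the shock at [xi].  The front [i <= m] lies to the left
   of the shock, [i > m] to the right of it; between the fronts [i] and [i.+1] the
   solution is compared with the constant [kval i].  [soft eta] is a C^1 version
   of the positive part, which stops a characteristic at the shock. *)
Definition mesh : R := pi / m%:R.
Definition node j : R := j%:R * mesh.
Definition level j : R := sin (node j).
Definition charac t j : R := node j - t * level j.
Definition pfront j t : R := soft eta (charac t j).
Definition dpfront j t : R := dsoft eta (charac t j) * - level j.

(** Front [m] is [- pfront 1] and front [m.+1] is [pfront 1]. Since [pfront m] is [pi - eta], the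
    ends of the period need two fronts of their own, which makes [m.*2.+2] in all. *)
Definition front i t : R :=
  if i == 0%N then - pi else if (i <= m)%N then - pfront (m.+1 - i) t
  else if (i <= m.*2)%N then pfront (i - m) t else pi.
Definition dfront i t : R :=
  if i == 0%N then 0 else if (i <= m)%N then - dpfront (m.+1 - i) t
  else if (i <= m.*2)%N then dpfront (i - m) t else 0.
Definition kval i : R := - sin ((i%:R - m%:R) * mesh).

Lemma mesh_gt0 : 0 < mesh. Proof. by rewrite divr_gt0 ?pi_gt0 ?ltr0n. Qed.

Lemma node0 : node 0 = 0. Proof. by rewrite /node mul0r. Qed.
Lemma nodem : node m = pi. Proof. by rewrite /node /mesh mulrC divfK// gt_eqF ?ltr0n. Qed.
Lemma nodeS j : node j.+1 = node j + mesh.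
Proof. by rewrite /node -natr1 mulrDl mul1r. Qed.
Lemma node_ge0 j : 0 <= node j. Proof. by rewrite mulr_ge0// ltW// mesh_gt0. Qed.
Lemma node_le i j : (i <= j)%N -> node i <= node j.
Proof. by move=> ij; rewrite ler_wpM2r ?ler_nat// ltW// mesh_gt0. Qed.
Lemma node_lepi j : (j <= m)%N -> node j <= pi.
Proof. by move=> jm; rewrite -nodem; exact: node_le. Qed.

Lemma level0 : level 0 = 0. Proof. by rewrite /level node0 sin0. Qed.
Lemma levelm : level m = 0. Proof. by rewrite /level nodem sinpi. Qed.
Lemma level_ge0 j : (j <= m)%N -> 0 <= level j.
Proof. by move=> jm; rewrite sin_ge0_pi// node_ge0 node_lepi. Qed.
Lemma level_le1 j : level j <= 1. Proof. exact: sin_le1. Qed.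
Lemma levelS j : `|level j.+1 - level j| <= mesh.
Proof.
apply: (le_trans (sin_lipschitz _ _)); rewrite nodeS addrAC subrr add0r.
by rewrite ger0_norm// ltW// mesh_gt0.
Qed.

Lemma kval_right j : kval (m + j) = - level j.
Proof. by rewrite /kval natrD addrAC subrr add0r. Qed.
Lemma kval_left j : (j <= m)%N -> kval (m - j) = level j.
Proof.
by move=> jm; rewrite /kval natrB// addrAC subrr add0r mulNr sinN opprK.
Qed.
Lemma characE t j : charac t j = node j - t * level j. Proof. by []. Qed.
Lemma charac0 t : charac t 0 = 0. Proof. by rewrite /charac node0 level0 mulr0 subr0. Qed.
Lemma characm t : charac t m = pi. Proof. by rewrite /charac nodem levelm mulr0 subr0. Qed.

(** By [sin_ratio], [charac t j / node j = 1 - t * sin (node j) / node j] increases with [j]; the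
    form without quotients covers [node 0 = 0]. *)
Lemma charac_ratio t i j : 0 <= t -> (i <= j <= m)%N ->
  node j * charac t i <= node i * charac t j.
Proof.
move=> t0 /andP[ij jm]; rewrite /charac.
have := sin_ratio (node_ge0 i) (node_le ij) (node_lepi jm).
by rewrite -!/(level _) => H; have := ler_wpM2l t0 H; lra.
Qed.

Lemma charac_le0 t i j : 0 <= t -> (i <= j <= m)%N ->
  charac t j <= 0 -> charac t i <= 0.
Proof.
move=> t0 ijm cj; have /andP[ij jm] := ijm.
have [->|i0] := posnP i; first by rewrite charac0.
have nj : 0 < node j by rewrite mulr_gt0 ?mesh_gt0// ltr0n (leq_trans i0).
rewrite -(pmulr_rle0 _ nj); apply: (le_trans (charac_ratio t0 ijm)).
by rewrite mulr_ge0_le0// node_ge0.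
Qed.

Lemma front0 t : front 0 t = - pi. Proof. by []. Qed.
Lemma dfront0 t : dfront 0 t = 0. Proof. by []. Qed.
Lemma front_last t : front (m.*2.+1) t = pi.
Proof.
rewrite /front /=; have -> : (m.*2 < m)%N = false by apply/negbTE; lia.
by rewrite ltnn.
Qed.
Lemma dfront_last t : dfront (m.*2.+1) t = 0.
Proof.
rewrite /dfront /=; have -> : (m.*2 < m)%N = false by apply/negbTE; lia.
by rewrite ltnn.
Qed.
Lemma front_right j t : (j < m)%N -> front (m + j).+1 t = pfront j.+1 t.
Proof.
move=> jm; rewrite /front /=; have -> : (m + j < m)%N = false by apply/negbTE; lia.
have -> : (m + j < m.*2)%N by lia.
by congr pfront; lia.
Qed.
Lemma dfront_right j t : (j < m)%N -> dfront (m + j).+1 t = dpfront j.+1 t.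
Proof.
move=> jm; rewrite /dfront /=; have -> : (m + j < m)%N = false by apply/negbTE; lia.
have -> : (m + j < m.*2)%N by lia.
by congr dpfront; lia.
Qed.
Lemma front_left j t : (j < m)%N -> front (m - j) t = - pfront j.+1 t.
Proof.
move=> jm; rewrite /front; have -> : (m - j == 0)%N = false by apply/negbTE; lia.
have -> : (m - j <= m)%N by lia.
by congr (- pfront _ _); lia.
Qed.
Lemma dfront_left j t : (j < m)%N -> dfront (m - j) t = - dpfront j.+1 t.
Proof.
move=> jm; rewrite /dfront; have -> : (m - j == 0)%N = false by apply/negbTE; lia.
have -> : (m - j <= m)%N by lia.
by congr (- dpfront _ _); lia.
Qed.

Variant front_spec i : Prop :=
  | FrontFirst of i = 0%N
  | FrontLeft j of (j < m)%N & i = (m - j)%N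
  | FrontRight j of (j < m)%N & i = (m + j).+1
  | FrontLast of i = m.*2.+1.

Lemma frontP i : (i <= m.*2.+1)%N -> front_spec i.
Proof.
move=> im; have [->|i0] := posnP i; first by constructor.
have [iLm|mLi] := leqP i m.
  by apply: (@FrontLeft _ (m - i)); lia.
have [->|ni] := eqVneq i m.*2.+1; first by constructor 4.
by apply: (@FrontRight _ (i - m.+1)); lia.
Qed.

Hypotheses (eta0 : 0 < eta) (etam : 2 * eta <= pi).

Lemma pfront_ge0 j t : 0 <= pfront j t. Proof. exact: soft_ge0. Qed.

Lemma pfront_mono i j t : 0 <= t -> (i <= j <= m)%N -> pfront i t <= pfront j t.
Proof.
move=> t0 ijm; have [c0|c0] := leP (charac t i) 0.
  by rewrite /pfront soft_eq0// soft_ge0.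
have /andP[ij jm] := ijm.
have [i0|i0] := posnP i; first by rewrite i0 charac0 ltxx in c0.
have ni : 0 < node i by rewrite mulr_gt0 ?mesh_gt0// ltr0n.
apply: soft_mono => //; rewrite -(ler_pM2l ni).
apply: le_trans (charac_ratio t0 ijm).
by apply: ler_wpM2r; [exact: ltW|exact: node_le].
Qed.

Lemma pfrontm t : pfront m t = pi - eta.
Proof. by rewrite /pfront characm soft_large. Qed.

Lemma pfront_lepi j t : 0 <= t -> (j <= m)%N -> pfront j t <= pi - eta.
Proof. by move=> t0 jm; rewrite -(pfrontm t); apply: pfront_mono; rewrite ?jm ?leqnn. Qed.

Lemma front_mono i t : 0 <= t -> (i <= m.*2)%N -> front i t <= front i.+1 t.
Proof.
move=> t0 im; have pi0 := @pi_gt0 R; have e0 := eta0.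
have [->|j jm ->|j jm ->|] := frontP (leqW im); last by lia.
- have -> : 1%N = (m - m.-1)%N by lia.
  rewrite front0 front_left; last lia.
  by rewrite prednK// pfrontm; lra.
- rewrite (front_left _ jm); case: j jm => [|j] jm.
    rewrite subn0 -[m in front m.+1]addn0 front_right//.
    by have := pfront_ge0 1 t; lra.
  have -> : (m - j.+1).+1 = (m - j)%N by lia.
  rewrite front_left; last lia.
  by rewrite lerN2 pfront_mono//; lia.
- rewrite front_right//; case: (ltnP j.+1 m) => jm'.
    by rewrite -addnS front_right// pfront_mono//; lia.
  have -> : (m + j).+2 = m.*2.+1 by lia.
  rewrite front_last; apply: (le_trans (pfront_lepi t0 _)); [lia|lra].
Qed.

Lemma front_bound i t : 0 <= t -> (i <= m.*2.+1)%N -> - pi <= front i t <= pi.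
Proof.
move=> t0 im; have pi0 := @pi_gt0 R; have e0 := eta0.
have [->|j jm ->|j jm ->|->] := frontP im.
- by rewrite front0; lra.
- rewrite front_left//; have := pfront_ge0 j.+1 t; have := @pfront_lepi j.+1 t t0 jm.
  lra.
- rewrite front_right//; have := pfront_ge0 j.+1 t; have := @pfront_lepi j.+1 t t0 jm.
  lra.
- by rewrite front_last; lra.
Qed.

(* The front [j] has not the speed of its characteristic while it is being stopped. *)
Definition slow t j : R := if 0 < charac t j < 2 * eta then 1 else 0.
Definition fronterr t j : R := mesh * (slow t j + 2 * mesh).

Lemma fronterr_ge0 t j : 0 <= fronterr t j.
Proof.
have := mesh_gt0; rewrite /fronterr /slow => ?.
by case: ifP => _; rewrite mulr_ge0//; lra.
Qed.

(** The jump is at most [mesh]. Outside the stopping zone the front has exactly the speed of the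
    value on its right; inside it the mismatch is at most 1. *)
Lemma relflux_right t j u : (j < m)%N -> 0 < charac t j.+1 ->
  relflux (dpfront j.+1 t) u (- level j.+1) - relflux (dpfront j.+1 t) u (- level j)
  <= fronterr t j.+1.
Proof.
move=> jm c0; have e0 := mesh_gt0.
apply: (@le_trans _ _ (mesh * (slow t j.+1 + mesh))); last first.
  by rewrite /fronterr ler_wpM2l; lra.
apply: relflux_diff.
  by rewrite opprK addrC distrC levelS.
have s0 := level_ge0 jm; have s1 := level_le1 j.+1.
rewrite /dpfront /slow c0 /=; case: ltP => c1.
  have := dsoft_ge0 (charac t j.+1) eta0; have := dsoft_le1 (charac t j.+1) eta0.
  set d := dsoft _ _ => d1 d0.
  by rewrite ler_norml; apply/andP; split; nra.
by rewrite dsoft_eq1// mul1r subrr normr0.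
Qed.

(** As on the right, except that the value compared with the front speed is now the neighbour
    [level j]; this costs one more [mesh] and is the origin of the 2 in [fronterr]. *)
Lemma relflux_left t j u : (j < m)%N -> 0 < charac t j.+1 ->
  relflux (- dpfront j.+1 t) u (level j) - relflux (- dpfront j.+1 t) u (level j.+1)
  <= fronterr t j.+1.
Proof.
move=> jm c0; have e0 := mesh_gt0.
have -> : fronterr t j.+1 = mesh * ((slow t j.+1 + mesh) + mesh).
  by rewrite /fronterr; ring.
apply: relflux_diff.
  by rewrite distrC levelS.
have s0 := level_ge0 jm; have s1 := level_le1 j.+1.
apply: (@le_trans _ _ (`|- dpfront j.+1 t - level j.+1| + `|level j.+1 - level j|)).
  apply: le_trans (ler_normD _ _); rewrite le_eqVlt; apply/orP; left; apply/eqP.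
  by congr `|_|; ring.
apply: lerD; last exact: levelS.
rewrite /dpfront /slow c0 /=; case: ltP => c1.
  have := dsoft_ge0 (charac t j.+1) eta0; have := dsoft_le1 (charac t j.+1) eta0.
  set d := dsoft _ _ => d1 d0.
  by rewrite ler_norml; apply/andP; split; nra.
by rewrite dsoft_eq1// mul1r opprK subrr normr0.
Qed.

(** Induction over mirror pairs of fronts, from the shock outwards. Stopped pairs sit at 0 with
    speed 0 and telescope to one shock term with the values [level M] and [- level M]. At the first
    moving pair that term is dropped by [relflux_shock], and from there on each pair pays its own
    [fronterr]. *)
Lemma sum_fronts_pairs t x u (r : R -> R) M : 0 <= t -> (forall z, 0 <= r z) ->
  (M <= m)%N ->
  \sum_(j < M) (r (x - pfront j.+1 t) * (relflux (dpfront j.+1 t) u (- level j.+1)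
       - relflux (dpfront j.+1 t) u (- level j))
     + r (x + pfront j.+1 t) * (relflux (- dpfront j.+1 t) u (level j)
       - relflux (- dpfront j.+1 t) u (level j.+1)))
  <= (if charac t M <= 0 then r x * (relflux 0 u (- level M) - relflux 0 u (level M)) else 0)
   + \sum_(j < M) (r (x - pfront j.+1 t) + r (x + pfront j.+1 t)) * fronterr t j.+1.
Proof.
move=> t0 r0; elim: M => [|M IH] Mm.
  by rewrite !big_ord0 charac0 lexx level0 oppr0 subrr mulr0 addr0.
rewrite !big_ord_recr /=; have := IH (ltnW Mm).
set S1 := \sum_(j < M) _; set S2 := \sum_(j < M) _ => {}IH.
have := relflux_shock u (level_ge0 (ltnW Mm)).
set g := relflux 0 u _ - _ => g0.
have [cS|cS] := leP (charac t M.+1) 0.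
  have cM : charac t M <= 0 by apply: charac_le0 t0 _ cS; lia.
  rewrite cM in IH.
  have -> : pfront M.+1 t = 0 by rewrite /pfront soft_eq0.
  have -> : dpfront M.+1 t = 0 by rewrite /dpfront dsoft_eq0// mul0r.
  rewrite oppr0 !addr0.
  apply: (@le_trans _ _ (r x * (relflux 0 u (- level M.+1) - relflux 0 u (level M.+1)) + S2)).
    by move: IH; rewrite /g; lra.
  rewrite lerD2l lerDl; apply: mulr_ge0; last exact: fronterr_ge0.
  by rewrite addr_ge0.
rewrite add0r.
have H1 := ler_wpM2l (r0 (x - pfront M.+1 t)) (relflux_right u Mm cS).
have H2 := ler_wpM2l (r0 (x + pfront M.+1 t)) (relflux_left u Mm cS).
have IH' : S1 <= S2.
  apply: (le_trans IH); case: ifP => _; rewrite ?add0r// gerDr.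
  by rewrite mulr_ge0_le0.
move: H1 H2 IH'; lra.
Qed.

(** Summation by parts: at each front the fluxes of the two adjacent layers are combined. Those at
    [- pi] and [pi] are left over, with value 0 and speed 0; periodicity cancels them after
    integration. *)
Lemma sum_fronts t x u (r : R -> R) : 0 <= t -> (forall z, 0 <= r z) ->
  \sum_(i < m.*2.+1) (r (x - front i t) * relflux (dfront i t) u (kval i)
     - r (x - front i.+1 t) * relflux (dfront i.+1 t) u (kval i))
  <= \sum_(j < m) (r (x - pfront j.+1 t) + r (x + pfront j.+1 t)) * fronterr t j.+1
   + (r (x + pi) - r (x - pi)) * relflux 0 u 0.
Proof.
move=> t0 r0.
pose A i := r (x - front i t) * relflux (dfront i t) u (kval i).
pose B i := r (x - front i.+1 t) * relflux (dfront i.+1 t) u (kval i).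
have -> : \sum_(i < m.*2.+1) (r (x - front i t) * relflux (dfront i t) u (kval i)
     - r (x - front i.+1 t) * relflux (dfront i.+1 t) u (kval i))
   = A 0%N - B m.*2 + \sum_(i < m.*2) (A i.+1 - B i).
  rewrite sumrB [X in X - _]big_ord_recl [X in _ - X]big_ord_recr /= sumrB.
  rewrite -!/(A _) -!/(B _) /=.
  under [X in A 0%N + X - _]eq_bigr do rewrite /bump /= add1n -/(A _).
  under [X in _ - (X + _)]eq_bigr do rewrite -/(B _).
  by ring.
have -> : A 0%N = r (x + pi) * relflux 0 u 0.
  have k0 : kval 0 = 0 by rewrite -(subnn m) kval_left ?leqnn// levelm.
  by rewrite /A front0 dfront0 opprK k0.
have -> : B m.*2 = r (x - pi) * relflux 0 u 0.
  by rewrite /B front_last dfront_last -addnn kval_right levelm oppr0.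
rewrite -mulrBl addrC lerD2r.
have -> : \sum_(i < m.*2) (A i.+1 - B i) = \sum_(j < m) ((A (m + j).+1 - B (m + j)%N)
    + (A (m - j)%N - B (m - j.+1)%N)).
  rewrite -addnn big_split_ord /= addrC [RHS]big_split /=; congr (_ + _).
  (* Mirrors the left half, so that both halves are indexed by the distance to the shock. *)
  rewrite (reindex_inj rev_ord_inj) /=; apply: eq_bigr => j _.
  by have jm := ltn_ord j; congr (A _ - B _); lia.
apply: le_trans (le_trans (@sum_fronts_pairs t x u r m t0 r0 (leqnn m)) _); last first.
  have pi0 : ((pi : R) <= 0) = false by rewrite leNgt pi_gt0.
  by rewrite characm pi0 add0r.
rewrite le_eqVlt; apply/orP; left; apply/eqP; apply: eq_bigr => j _.
have jm := ltn_ord j.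
rewrite /A /B !front_right// !dfront_right// !front_left// !dfront_left//.
have -> : (m - j.+1).+1 = (m - j)%N by lia.
have kl := kval_left (ltnW jm); have kl1 := kval_left jm.
rewrite !front_left// !dfront_left// -addnS !kval_right kl kl1.
by rewrite opprK; ring.
Qed.

End Fronts.

(** * A partition of unity that follows the layers *)

Section Layers.
Context {R : realType}.
Variables (m : nat) (eta h : R).
Hypotheses (m0 : (0 < m)%N) (eta0 : 0 < eta) (etam : 2 * eta <= pi) (h0 : 0 < h).
Implicit Types (t x z u : R) (i j : nat).
Local Notation mesh := (@mesh R m).
Local Notation node := (@node R m).
Local Notation level := (@level R m).
Local Notation charac := (@charac R m).
Local Notation pfront := (pfront m eta).
Local Notation front := (front m eta).
Local Notation kval := (@kval R m).

(** Each step begins at its front and ends [h] further to the right, so a layer leaks by [h] into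
    the next ones, also across the shock. *)
Definition layer i t z : R := ramp ((z - front i t) / h) - ramp ((z - front i.+1 t) / h).

Lemma layer_ge0 i t z : 0 <= t -> (i <= m.*2)%N -> 0 <= layer i t z.
Proof.
move=> t0 im; rewrite subr_ge0 ramp_mono// ler_pM2r ?invr_gt0// lerD2l lerN2.
exact: front_mono.
Qed.

Lemma layer_supp i t z : 0 <= t -> (i <= m.*2)%N -> layer i t z != 0 ->
  front i t <= z <= front i.+1 t + h.
Proof.
move=> t0 im; apply: contraR; rewrite negb_and -!ltNge => /orP[zl|zr].
  have zl' := lt_le_trans zl (front_mono m0 eta0 etam t0 im).
  rewrite /layer !ramp_eq0 ?subrr//; rewrite -oppr_ge0 -mulNr divr_ge0 ?(ltW h0)//; lra.
have zr' := front_mono m0 eta0 etam t0 im.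
rewrite /layer !ramp_eq1 ?subrr//; rewrite ler_pdivlMr//; lra.
Qed.

Lemma sum_layer t z : \sum_(i < m.*2.+1) layer i t z =
  ramp ((z + pi) / h) - ramp ((z - pi) / h).
Proof.
rewrite /layer; under eq_bigr do rewrite -opprB.
rewrite -(big_mkord xpredT (fun i => - (ramp ((z - front i.+1 t) / h) - ramp ((z - front i t) / h)))).
rewrite sumrN telescope_sumr// opprB front0 front_last// opprK.
by [].
Qed.

Lemma sum_layer_le1 t z : \sum_(i < m.*2.+1) layer i t z <= 1.
Proof.
rewrite sum_layer; have := ramp_le1 ((z + pi) / h); have := ramp_ge0 ((z - pi) / h); lra.
Qed.

Lemma sum_layer_eq1 t z : - pi + h <= z -> z <= pi -> \sum_(i < m.*2.+1) layer i t z = 1.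
Proof.
move=> z1 z2; rewrite sum_layer ramp_eq1 ?ramp_eq0 ?subr0//.
  by rewrite -oppr_ge0 -mulNr divr_ge0 ?(ltW h0)//; lra.
by rewrite ler_pdivlMr//; lra.
Qed.

Lemma layer_out i t z : 0 <= t -> (i <= m.*2)%N -> ~~ (- pi <= z <= pi + h) -> layer i t z = 0.
Proof.
move=> t0 im; apply: contraNeq => /(layer_supp t0 im).
have i1 : (i <= m.*2.+1)%N by lia.
have i2 : (i.+1 <= m.*2.+1)%N by lia.
have := front_bound m0 eta0 etam t0 i1; have := front_bound m0 eta0 etam t0 i2.
by move=> /andP[? ?] /andP[? ?] /andP[? ?]; lra.
Qed.

Lemma pfront_near_node j t : 0 <= t -> (j <= m)%N ->
  node j - t - eta <= pfront j t <= node j.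
Proof.
move=> t0 jm; have l0 := @level_ge0 R m m0 _ jm; have l1 := @level_le1 R m j.
have tl0 : 0 <= t * level j by rewrite mulr_ge0.
have tl1 : t * level j <= t by rewrite ler_piMr.
apply/andP; split.
  apply: le_trans (soft_ge _ eta0); rewrite !characE; lra.
apply: (le_trans (soft_le _ eta0)); have := @node_ge0 R m m0 j.
by case: posP => //; rewrite !characE; lra.
Qed.

(** Fronts move at speed at most 1. The summand [mesh] pays for the index shift on the left, where
    front [m - j] starts near [- node j.+1]. *)
Lemma front_near_node i t : 0 <= t -> (i <= m.*2.+1)%N ->
  `|front i t - (i%:R - m%:R) * mesh| <= mesh + eta + t.
Proof.
move=> t0 im; have pi0 := @pi_gt0 R; have e0 := eta0; have ms := @mesh_gt0 R m m0.
have nE j : j%:R * mesh = node j by [].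
have mj k : (m + k)%:R - m%:R = k%:R :> R by rewrite natrD addrC addKr.
have nm := @nodem R m m0; have nS j := @nodeS R m j.
have [->|j jm ->|j jm ->|->] := frontP m0 im.
- rewrite front0 sub0r mulNr nE nm opprK addrC subrr normr0; lra.
- rewrite front_left// natrB; last lia.
  rewrite addrAC subrr add0r mulNr opprK addrC.
  have /andP := pfront_near_node t0 jm.
  by rewrite nE nS ler_norml => -[? ?]; lra.
- rewrite front_right// -addnS mj.
  have /andP := pfront_near_node t0 jm.
  by rewrite nE ler_norml => -[? ?]; lra.
- rewrite front_last// -addnn -addnS mj.
  by rewrite nE nS nm ler_norml; lra.
Qed.

Lemma layer_init i t z : 0 <= t -> (i <= m.*2)%N -> layer i t z != 0 ->
  `|kval i - - sin z| <= t + eta + 2 * mesh + h.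
Proof.
move=> t0 im /(layer_supp t0 im) /andP[z1 z2].
have i1 : (i <= m.*2.+1)%N by lia.
have i2 : (i.+1 <= m.*2.+1)%N by lia.
have := front_near_node t0 i1; have := front_near_node t0 i2.
have -> : kval i - - sin z = sin z - sin ((i%:R - m%:R) * mesh) by rewrite opprK addrC.
rewrite -natr1 ![`|front _ _ - _| <= _]ler_norml => /andP[? ?] /andP[? ?].
have := sin_lipschitz z ((i%:R - m%:R) * mesh).
move/le_trans; apply; rewrite ler_norml.
have h0' := h0; have ms := @mesh_gt0 R m m0.
by apply/andP; split; lra.
Qed.

Section Final.
Variables (T tau t : R).
Hypotheses (hT : pi < T) (tau0 : 0 <= tau) (tT1 : T - tau <= t) (tT2 : t <= T) (tpi : pi / 2 <= t).

Let t0 : 0 <= t. Proof. by have ? := @pi_gt0 R; have ? := tpi; lra. Qed.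

Lemma charac_time j : (j <= m)%N -> charac T j <= charac t j <= charac T j + tau.
Proof.
move=> jm; have l0 := @level_ge0 R m m0 _ jm; have l1 := @level_le1 R m j.
rewrite !characE; have tT1' := tT1; have tT2' := tT2; have tau0' := tau0.
have d0 : 0 <= T - t by lra.
have := mulr_ge0 d0 l0; have : (T - t) * level j <= tau by nra.
by move=> ? ?; apply/andP; split; lra.
Qed.

(** If [node j] were below [pi / 2], then [sin_lower] would give [node j <= pi / 2 * level j <= t *
    level j], and the characteristic would have met the shock. So the surviving values lie on the
    branch with [|y| <= pi / 2]. *)
Lemma alive_node j : (j <= m)%N -> 0 < charac t j -> pi / 2 <= node j.
Proof.
move=> jm; rewrite !characE; apply: contraTT; rewrite -!ltNge -leNgt => /ltW np.
have := sin_lower (@node_ge0 R m m0 j) np; rewrite -/(level j) => H.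
have l0 := @level_ge0 R m m0 _ jm.
by have := ler_wpM2r l0 tpi; lra.
Qed.

(** At time [T] the characteristic of [node j.+1] carries the value given by [branch_node], and
    [branch_lipschitz] turns its distance to [z] into an error of values. The term [(1 + T) * mesh]
    bounds the distance of neighbouring characteristics; the others come from the smoothing and from
    [t] differing from [T]. *)
Lemma profile_node j z : (j < m)%N -> 0 <= z <= pi ->
  pfront j t - h <= z -> z <= pfront j.+1 t + h -> 0 < pfront j.+1 t ->
  `|- level j.+1 - profile T (z - pi)| <= tau + h + eta + (1 + T) * mesh.
Proof.
move=> jm /andP[z0 zpi] z1 z2 p0.
have ms := @mesh_gt0 R m m0; have pi0 := @pi_gt0 R; have hT' := hT; have e0 := eta0.
have c0 : 0 < charac t j.+1.
  have := soft_le (charac t j.+1) eta0; rewrite -/(pfront j.+1 t).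
  by case: posP => //; lra.
have np := alive_node jm c0.
have B1 := branch_node T np (@node_lepi R m m0 _ jm).
rewrite -/(level _) -/(charac T _) in B1.
have B2 : branch T (z - pi) (profile T (z - pi)).
  by apply: profileP => //; rewrite ler_norml; lra.
have T0 : 0 < T by lra.
have := branch_lipschitz T0 B1 B2.
have -> : charac T j.+1 - pi - (z - pi) = charac T j.+1 - z by ring.
move=> BL; apply: (@le_trans _ _ (T * `|- level j.+1 - profile T (z - pi)|)).
  by rewrite ler_peMl//; have := @pi_ge2 R; lra.
apply: (le_trans BL); rewrite ler_norml.
have /andP[ct1 ct2] := charac_time jm.
have S1 := soft_ge (charac t j) eta0; rewrite -/(pfront j t) in S1.
have S2 := soft_le (charac t j.+1) eta0; rewrite -/(pfront j.+1 t) in S2.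
have {}S2 : pfront j.+1 t <= charac t j.+1.
  by move: S2; case: posP; lra.
have := @levelS R m m0 j; rewrite ler_norml => /andP[L1 L2].
have cc : charac t j.+1 <= charac t j + (1 + T) * mesh.
  rewrite !characE nodeS.
  have : t * (level j - level j.+1) <= T * mesh.
    apply: (@le_trans _ _ (t * mesh)); first by rewrite ler_wpM2l//; lra.
    by rewrite ler_wpM2r//; lra.
  lra.
have tau0' := tau0; have h0' := h0; have Tm := mulr_gt0 T0 ms.
by apply/andP; split; lra.
Qed.

Lemma profile_last z : pi - eta - h <= z <= pi -> - pi <= z ->
  `|profile T (z - pi)| <= eta + h.
Proof.
move=> /andP[z1 z2] z3.
have pr0 : profile T 0 = 0.
  apply: profile_uniq; rewrite ?normr0 ?pi_ge0//.
  have pi0 := @pi_gt0 R.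
  by exists 0; rewrite sin0 mulr0 addr0; split => //; lra.
have := profile_lipschitz hT (z - pi) 0; rewrite pr0 !subr0 => /le_trans; apply.
have eta0' := eta0; have h0' := h0.
by rewrite ler_norml; apply/andP; split; lra.
Qed.

(** The strip [[0, h]] is left out because there layers from the left of the shock leak into those
    on the right, with values that are not close. *)
Lemma layer_final i z : (i <= m.*2)%N -> layer i t z != 0 -> - pi <= z <= pi ->
  ~~ (0 <= z <= h) ->
  `|kval i - shock_profile T z| <= tau + h + eta + (2 + T) * mesh.
Proof.
move=> im /(layer_supp t0 im) /andP[z1 z2] /andP[zm zp] zh.
have ms := @mesh_gt0 R m m0; have pi0 := @pi_gt0 R; have hT' := hT; have e0 := eta0.
have h0' := h0; have t0' := t0; have tau0' := tau0.
have Tm : 0 < T * mesh by rewrite mulr_gt0//; lra.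
rewrite /shock_profile; case: ifPn => z0.
  have {zh} hz : h < z by move: zh; rewrite (ltW z0) /= -ltNge.
  have i2 : (i.+1 <= m.*2.+1)%N by [].
  case: (frontP m0 i2) => [//|j jm ij|j jm ij|ij].
  - move: z2; rewrite ij front_left//.
    by have := pfront_ge0 m eta0 j.+1 t; lra.
  - have im' : i = (m + j)%N by apply: succn_inj.
    move: z2; rewrite ij front_right// im' kval_right => z2.
    have pj : pfront j t - h <= z.
      case: j jm ij im' {z2} => [|j] jm ij im'.
        by rewrite /pfront charac0 soft_eq0//; lra.
      move: z1; rewrite im' addnS front_right//; [lra|exact: ltnW].
    have H : 0 <= z <= pi by lra.
    have H2 : 0 < pfront j.+1 t by lra.
    have := profile_node jm H pj z2 H2.
    have := @levelS R m m0 j.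
    rewrite !ler_norml => /andP[? ?] /andP[? ?]; apply/andP; split; lra.
  - have im' : i = (m + m)%N by apply: succn_inj; rewrite ij addnn.
    rewrite im' kval_right levelm// oppr0 sub0r normrN.
    have : pi - eta <= z.
      have mm : (m + m)%N = (m + m.-1).+1 by rewrite -addnS prednK.
      move: z1; rewrite im' mm front_right ?prednK// pfrontm//; lra.
    move=> z3; apply: (le_trans (@profile_last z _ _)); lra.
have zneg : z < 0.
  rewrite lt_neqAle; rewrite -leNgt in z0; rewrite z0 andbT.
  by apply: contra zh => /eqP ->; rewrite lexx (ltW h0).
(* Oddness reduces the left side of the shock to [profile_node] at [- z]. *)
have prN : profile T (z + pi) = - profile T (- z - pi).
  by rewrite -profileN// ?ler_norml; [congr profile; ring|lra].
rewrite prN opprK.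
case: (frontP m0 (leqW im)) => [ij|j jm ij|j jm ij|ij]; last by move: im; rewrite ij ltnn.
- have k0 : kval 0 = 0 by rewrite -(subnn m) kval_left// levelm.
  rewrite ij k0 add0r.
  have : - z <= pi by lra.
  have : pi - eta - h <= - z.
    move: z2; rewrite ij; have {1}-> : 1%N = (m - m.-1)%N by rewrite -{1}(prednK m0) subSnn.
    rewrite front_left ?prednK// pfrontm//; lra.
  move=> H1 H2; apply: (le_trans (@profile_last (- z) _ _)); lra.
- move: z1 z2; rewrite ij front_left// => z1.
  rewrite kval_left ?(ltnW jm)// => z2.
  have H : 0 <= - z <= pi by lra.
  have pj : pfront j t - h <= - z.
    case: j jm ij z1 z2 => [|j] jm ij z1 z2.
      by rewrite /pfront charac0 soft_eq0//; lra.
    have jm2 : (j < m)%N := ltnW jm.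
    by move: z2; rewrite (subnSK jm2) (front_left eta m0 _ jm2); lra.
  have H1 : - z <= pfront j.+1 t + h by lra.
  have H2 : 0 < pfront j.+1 t by lra.
  have := profile_node jm H pj H1 H2.
  have := @levelS R m m0 j.
  rewrite !ler_norml => /andP[? ?] /andP[? ?]; apply/andP; split; lra.
- move: z1; rewrite ij front_right//.
  by have := pfront_ge0 m eta0 j.+1 t; lra.
Qed.

End Final.

End Layers.

(** * Closure properties for continuity goals *)

Section Continuity.
Context {R : realType} {X : topologicalType}.
Implicit Types f g : X -> R.

Lemma ctsD f g : continuous f -> continuous g -> continuous (fun p => f p + g p).
Proof. by move=> cf cg p; apply: cvgD; [exact: cf|exact: cg]. Qed.

Lemma ctsN f : continuous f -> continuous (fun p => - f p).
Proof. by move=> cf p; apply: cvgN; exact: cf. Qed.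

Lemma ctsM f g : continuous f -> continuous g -> continuous (fun p => f p * g p).
Proof. by move=> cf cg p; apply: cvgM; [exact: cf|exact: cg]. Qed.

Lemma cts_cst (c : R) : continuous (fun _ : X => c).
Proof. by move=> p; exact: cvg_cst. Qed.

Lemma cts_comp (f : R -> R) g : continuous f -> continuous g -> continuous (fun p => f (g p)).
Proof. by move=> cf cg p; apply: (@continuous_comp _ _ _ g f); [exact: cg|exact: cf]. Qed.

End Continuity.

Ltac cts_step := match goal with
  | |- continuous (fun p => @?f p + @?g p) => apply: (@ctsD _ _ f g)
  | |- continuous (fun p => - @?f p) => apply: (@ctsN _ _ f)
  | |- continuous (fun p => @?f p * @?g p) => apply: (@ctsM _ _ f g)
  | |- continuous (fun p => ?c) => exact: cts_cst
  | |- continuous (fun p => p) => move=> ?; exact: cvg_id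
  | |- continuous (fun p => p.1) => move=> ?; exact: cvg_fst
  | |- continuous (fun p => p.2) => move=> ?; exact: cvg_snd
  | H : continuous ?f |- continuous ?f => exact: H
  | H : continuous ?f |- continuous (fun p => ?f (@?g p)) => apply: (@cts_comp _ _ f g H)
  end.
Ltac cts := repeat cts_step.

Section ProfileContinuity.
Context {R : realType}.

Lemma continuous_pos : continuous (@pos R).
Proof.
move=> x; apply/cvgrPdist_le => e e0; near=> y.
have : `|x - y| <= e by near: y; apply: cvgr_dist_le => //; exact: cvg_id.
rewrite !ler_norml => /andP[? ?].
by case: (posP x); case: (posP y) => *; apply/andP; split; lra.
Unshelve. all: by end_near.
Qed.

Lemma continuous_hat : continuous (@hat R).
Proof. by have cp := continuous_pos; rewrite /hat; cts. Qed.

Lemma continuous_dsoft (e : R) : continuous (dsoft e).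
Proof. by have cp := continuous_pos; rewrite /dsoft; cts. Qed.

End ProfileContinuity.

(** * Test functions between two fronts *)

Section TestLayer.
Context {R : realType}.
Variables (T tau h xi : R).
Hypotheses (tau0 : 0 < tau) (h0 : 0 < h) (tauT : 2 * tau <= T).
Implicit Types (t x : R).

(** A cut-off equal to 1 from [2 * tau] to [T - tau]. Test functions live at positive times, so the
    datum is reached only through continuity in time. *)
Definition chi t : R := ramp ((t - tau) / tau) - ramp ((t - (T - tau)) / tau).
Definition dchi t : R := hat ((t - tau) / tau) / tau - hat ((t - (T - tau)) / tau) / tau.

Lemma chi_ge0 t : 0 <= chi t.
Proof.
have ? := tauT.
by rewrite subr_ge0 ramp_mono// ler_pM2r ?invr_gt0//; lra.
Qed.

Lemma chi_le1 t : chi t <= 1.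
Proof.
rewrite /chi; have := ramp_le1 ((t - tau) / tau).
have := ramp_ge0 ((t - (T - tau)) / tau); lra.
Qed.

Lemma chi_eq0 t : t <= tau \/ T <= t -> chi t = 0.
Proof.
have ? := tauT; have ? := tau0.
move=> [tt|tt].
  rewrite /chi !ramp_eq0 ?subrr// pmulr_lle0 ?invr_gt0//; lra.
rewrite /chi !ramp_eq1 ?subrr// ler_pdivlMr//; lra.
Qed.

Lemma is_derive_scale (f df : R -> R) a c s : c != 0 -> (forall z, is_derive z (1:R) f (df z)) ->
  is_derive s (1:R) (fun s => f ((s - a) / c)) (df ((s - a) / c) / c).
Proof.
move=> c0 dfz; have D : is_derive s (1:R) (fun s => (s - a) / c) (c^-1).
  by apply: is_derive_eq; rewrite /GRing.scale /=; ring.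
have := @is_derive1_comp R f (fun s => (s - a) / c) s _ _ (dfz _) D.
by apply.
Qed.

Lemma is_derive_chi t : is_derive t (1 : R) chi (dchi t).
Proof.
have tn0 : tau != 0 by rewrite gt_eqF.
have D a := @is_derive_scale ramp hat a tau t tn0 (@is_derive_ramp R).
exact: (is_deriveB (D tau) (D (T - tau))).
Qed.

Variables (q1 q2 dq1 dq2 : R -> R).
Hypotheses (Dq1 : forall t, is_derive t (1 : R) q1 (dq1 t))
           (Dq2 : forall t, is_derive t (1 : R) q2 (dq2 t)).
Hypotheses (Cq1 : continuous dq1) (Cq2 : continuous dq2).
Hypotheses (q12 : forall t, 0 <= t -> [/\ - pi <= q1 t, q1 t <= q2 t & q2 t <= pi]).

Definition ridge (q : R -> R) t x : R := hat ((x - xi - q t) / h) / h.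
Definition step (q : R -> R) t x : R := ramp ((x - xi - q t) / h).

Lemma is_derive_step_t (q dq : R -> R) t x : is_derive t (1 : R) q (dq t) ->
  is_derive t (1 : R) (fun s => step q s x) (- dq t * ridge q t x).
Proof.
move=> Dq.
have D : is_derive t (1 : R) (fun s => (x - xi - q s) / h) (- dq t / h).
  by apply: is_derive_eq; rewrite /GRing.scale /=; ring.
have := @is_derive1_comp R _ _ t _ _ (is_derive_ramp ((x - xi - q t) / h)) D.
by rewrite /ridge mulrA mulrAC [X in is_derive _ _ _ X -> _]mulrC mulrA.
Qed.

Lemma is_derive_step_x (q : R -> R) t x :
  is_derive x (1 : R) (fun y => step q t y) (ridge q t x).
Proof.
have hn0 : h != 0 by rewrite gt_eqF.
have := @is_derive_scale _ _ (xi + q t) h x hn0 (@is_derive_ramp R).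
rewrite /step /ridge.
have E y : y - (xi + q t) = y - xi - q t by ring.
rewrite E.
by have -> : (fun s => ramp ((s - (xi + q t)) / h)) = (fun y => ramp ((y - xi - q t) / h))
  by apply/funext => s; rewrite E.
Qed.

Lemma continuous_ridge (q dq : R -> R) : (forall t, is_derive t (1 : R) q (dq t)) ->
  continuous (fun p : R * R => ridge q p.1 p.2).
Proof.
move=> Dq; have cq : continuous q.
  move=> t; apply: differentiable_continuous; apply/derivable1_diffP.
  exact: (@ex_derive _ _ _ _ _ _ _ (Dq t)).
by have ch := @continuous_hat R; rewrite /ridge; cts.
Qed.

Lemma continuous_step (q dq : R -> R) : (forall t, is_derive t (1 : R) q (dq t)) ->
  continuous (fun p : R * R => step q p.1 p.2).
Proof.
move=> Dq; have cq : continuous q.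
  move=> t; apply: differentiable_continuous; apply/derivable1_diffP.
  exact: (@ex_derive _ _ _ _ _ _ _ (Dq t)).
have cr : continuous (@ramp R).
  move=> t; apply: differentiable_continuous; apply/derivable1_diffP.
  exact: (@ex_derive _ _ _ _ _ _ _ (is_derive_ramp t)).
by rewrite /step; cts.
Qed.

Lemma continuous_dchi : continuous dchi.
Proof.
by have ch := @continuous_hat R; rewrite /dchi; cts.
Qed.

Lemma continuous_chi : continuous chi.
Proof.
move=> t; apply: differentiable_continuous; apply/derivable1_diffP.
exact: (@ex_derive _ _ _ _ _ _ _ (is_derive_chi t)).
Qed.

(** The fronts are ordered for [t >= 0] only; this suffices for the sign, since [chi] vanishes
    before [tau]. *)
Lemma test_fun_layer : test_fun
  (fun t x => chi t * (step q1 t x - step q2 t x))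
  (fun t x => dchi t * (step q1 t x - step q2 t x)
     + chi t * (dq2 t * ridge q2 t x - dq1 t * ridge q1 t x))
  (fun t x => chi t * (ridge q1 t x - ridge q2 t x)).
Proof.
have tau0' := tau0; have tauT' := tauT; have h0' := h0; have pi0 := @pi_gt0 R.
have mono t x : 0 <= t -> 0 <= step q1 t x - step q2 t x.
  move=> t0; have [_ q q'] := q12 t0.
  by rewrite subr_ge0 ramp_mono// ler_pM2r ?invr_gt0// lerD2l lerN2.
split; [|split; [|split; [|split; [|split]]]].
- move=> t x; have [t0|/ltW t0] := leP 0 t; first by rewrite mulr_ge0 ?chi_ge0 ?mono.
  by rewrite chi_eq0 ?mul0r//; left; lra.
- move=> t x.
  have D1 := is_derive_step_t x (Dq1 t); have D2 := is_derive_step_t x (Dq2 t).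
  have D0 := is_derive_chi t.
  apply: is_derive_eq; rewrite /GRing.scale /=; ring.
- move=> t x.
  have D1 := is_derive_step_x q1 t x; have D2 := is_derive_step_x q2 t x.
  by apply: is_derive_eq; rewrite /GRing.scale /=; ring.
- have c1 := continuous_ridge Dq1; have c2 := continuous_ridge Dq2.
  have c3 := continuous_step Dq1; have c4 := continuous_step Dq2.
  by have cc := continuous_chi; have cd := continuous_dchi; cts.
- have c1 := continuous_ridge Dq1; have c2 := continuous_ridge Dq2.
  by have cc := continuous_chi; cts.
- exists tau, T, (`|xi| + pi + h); split=> // t x.
  apply: contraNP => /not_andP ntx.
  have [tt|tt] := leP t tau; first by rewrite chi_eq0 ?mul0r//; left.
  have [tT|tT] := leP T t; first by rewrite chi_eq0 ?mul0r//; right.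
  have t0 : 0 <= t by lra.
  have [q a b] := q12 t0.
  have [xs|xs] : x - xi <= - pi \/ pi + h <= x - xi.
  + case: ntx => [|/negP]; first by rewrite (ltW tt) (ltW tT).
    rewrite -ltNge => xl; have [?|?] := leP (x - xi) (- pi); [by left|right].
    have := ler_norm xi; have := ler_norm (- xi); rewrite normrN.
    by move: xl; case: (ger0P x); lra.
  + rewrite /step !ramp_eq0 ?subrr ?mulr0// pmulr_lle0 ?invr_gt0//; lra.
  + rewrite /step !ramp_eq1 ?subrr ?mulr0// ler_pdivlMr//; lra.
Qed.

End TestLayer.

(** * Differentiability of the fronts in time *)

Section FrontDerivative.
Context {R : realType}.
Variables (m : nat) (eta : R).
Hypotheses (eta0 : 0 < eta).

Lemma is_derive_pfront j t : is_derive t (1 : R) (pfront m eta j) (dpfront m eta j t).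
Proof.
have D : is_derive t (1 : R) (fun t => @charac R m t j) (- level m j).
  rewrite /charac; apply: is_derive_eq; rewrite /GRing.scale /=; ring.
have := @is_derive1_comp R _ _ t _ _ (is_derive_soft (charac m t j) eta0) D.
by apply.
Qed.

Lemma is_derive_front i t : is_derive t (1 : R) (front m eta i) (dfront m eta i t).
Proof.
rewrite /front /dfront; case: ifP => _; first exact: is_derive_cst.
case: ifP => _; first exact: (is_deriveN (is_derive_pfront _ _)).
case: ifP => _; [exact: is_derive_pfront|exact: is_derive_cst].
Qed.

Lemma continuous_dpfront j : continuous (dpfront m eta j).
Proof.
by have cd := @continuous_dsoft R eta; rewrite /dpfront /charac; cts.
Qed.

Lemma continuous_dfront i : continuous (dfront m eta i).
Proof.
rewrite /dfront; case: (i == 0)%N; first exact: cts_cst.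
case: (i <= m)%N; first by apply: ctsN; exact: continuous_dpfront.
case: (i <= m.*2)%N; [exact: continuous_dpfront|exact: cts_cst].
Qed.

End FrontDerivative.

(** * Integration lemmas *)

Section Integrals.
Context {R : realType}.
Local Notation mu := (@lebesgue_measure R).
Local Open Scope ereal_scope.

(* No measurability: the integral of a nonnegative function is a supremum over the
   simple functions below it. *)
Lemma ge0_le_integral_nomeas d (X : measurableType d) (nu : {measure set X -> \bar R})
    (D : set X) (f g : X -> \bar R) : (forall x, D x -> 0 <= f x) ->
  (forall x, D x -> f x <= g x) ->
  \int[nu]_(x in D) f x <= \int[nu]_(x in D) g x.
Proof.
move=> f0 fg; have g0 x : D x -> 0 <= g x by move=> Dx; apply: le_trans (fg _ Dx); exact: f0.
rewrite !ge0_integralE//; apply: le_ereal_sup => _ [k kf <-]; exists k => // x.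
apply: (le_trans (kf x)); rewrite /patch; case: ifPn => // xD; exact/fg/set_mem.
Qed.

Definition shiftR (c x : R) : measurableTypeR R := (x + c)%R.

Lemma measurable_shiftR c : measurable_fun [set: measurableTypeR R] (shiftR c).
Proof. by apply: measurable_funD; [exact: measurable_id|exact: measurable_cst]. Qed.

Lemma lebesgue_measure_shift (c : R) (A : set R) : measurable A ->
  pushforward mu (shiftR c) A = mu A.
Proof.
move=> mA; apply/esym; apply: lebesgue_measure_unique => //.
  exact: measurable_shiftR.
move=> mS X [[a b]] _ <- /=.
rewrite /pushforward.
have -> : shiftR c @^-1` `]a, b]%classic = `](a - c)%R, (b - c)%R]%classic :> set R.
  by apply/seteqP; split => x /=; rewrite /shiftR !in_itv/= ltrBlDr lerBrDr.
have e (p q : R) : (p - c < q - c)%R = (p < q)%R by rewrite ltrD2r.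
rewrite !lebesgue_measure_itv/= !lte_fin e; case: ifP => // _.
by rewrite -!EFinB; congr _%:E; ring.
Qed.

Lemma ge0_integral_shift (c : R) (f : R -> \bar R) : measurable_fun [set: R] f ->
  (forall x, 0 <= f x) -> \int[mu]_x f (x + c)%R = \int[mu]_x f x.
Proof.
move=> mf f0.
have := @ge0_integral_pushforward _ _ _ _ R _ (measurable_shiftR c) mu [set: R] f measurableT mf (fun x _ => f0 x).
rewrite preimage_setT /comp /shiftR => <-.
apply: eq_measure_integral; first exact: measurable_shiftR.
by move=> mS A mA _; exact: (lebesgue_measure_shift c mA).
Qed.

Lemma integral_zero_out d (X : measurableType d) (nu : {measure set X -> \bar R})
    (D : set X) (f : X -> \bar R) : (forall x, ~ D x -> f x = 0) ->
  \int[nu]_(x in D) f x = \int[nu]_x f x.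
Proof.
move=> f0; rewrite integral_mkcond; apply: eq_integral => x _.
by rewrite /patch; case: ifPn => // /negP xD; rewrite f0// => Dx; apply: xD; rewrite inE.
Qed.

Lemma integral_itv_const (a b c : R) : (a <= b)%R ->
  \int[mu]_(x in `[a, b]) c%:E = (c * (b - a))%:E.
Proof.
move=> ab; rewrite integral_cst//= lebesgue_measure_itv/= lte_fin.
move: ab; rewrite le_eqVlt => /predU1P[->|ab]; last by rewrite ab -EFinB -EFinM.
by rewrite ltxx subrr mulr0 mule0.
Qed.

Lemma periodic_shift_int (f : R -> \bar R) (p : R) : (forall x, f (x + p)%R = f x) ->
  forall (n : int) x, f (x + n%:~R * p)%R = f x.
Proof.
move=> fp n x.
have H (k : nat) y : f (y + k%:R * p)%R = f y.
  elim: k y => [|k IH] y; first by rewrite mul0r addr0.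
  by rewrite -natr1 mulrDl mul1r addrA fp IH.
case: n => k; first exact: H.
rewrite NegzE mulrNz -(H k.+1 (x + - k.+1%:~R * p)%R) -addrA mulNr addNr addr0.
by [].
Qed.

Lemma ge0_integral_period (f : R -> \bar R) (p : R) (n : int) : (0 < p)%R ->
  measurable_fun [set: R] f -> (forall x, 0 <= f x) -> (forall x, f (x + p)%R = f x) ->
  \int[mu]_(x in `[(n%:~R * p)%R, (n%:~R * p + p)%R]) f x = \int[mu]_(x in `[0%R, p]) f x.
Proof.
move=> p0 mf f0 fp.
rewrite integral_mkcond [RHS]integral_mkcond.
rewrite -(@ge0_integral_shift (n%:~R * p)).
- apply: eq_integral => x _; rewrite /patch.
  have -> : (x + n%:~R * p \in `[(n%:~R * p)%R, (n%:~R * p + p)%R]%classic)%R =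
            (x \in `[0%R, p]%classic).
    by apply/idP/idP; rewrite !inE /= !in_itv/= => /andP[? ?]; apply/andP; split; lra.
  by rewrite (periodic_shift_int fp).
- by apply/(measurable_restrictT _ _).1 => //; exact: measurable_funTS.
- by move=> x; rewrite /patch; case: ifP.
Qed.

(** A window of one period and a half fits into three consecutive periods that start at a multiple
    of [p]. *)
Lemma ge0_integral_cover3 (f : R -> \bar R) (p a : R) : (0 < p)%R ->
  measurable_fun [set: R] f -> (forall x, 0 <= f x) -> (forall x, f (x + p)%R = f x) ->
  \int[mu]_(x in `[a, (a + 3 / 2 * p)%R]) f x <= 3%:E * \int[mu]_(x in `[0%R, p]) f x.
Proof.
move=> p0 mf f0 fp.
set n := Num.floor (a / p).
pose J (k : int) : set R := `[((n + k)%:~R * p)%R, ((n + k)%:~R * p + p)%R]%classic.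
have mJ k : measurable (J k) by rewrite /J.
pose J3 : set R := J 0%R `|` (J 1%R `|` J 2%R).
have H1 : \int[mu]_(x in `[a, (a + 3 / 2 * p)%R]) f x <= \int[mu]_(x in J3) f x.
  apply: ge0_subset_integral => //.
  - by apply: measurableU; [exact: mJ|apply: measurableU; exact: mJ].
  - exact: measurable_funTS.
  - move=> x; rewrite /J3 /J /= !in_itv/= !intrD => /andP[xa xb].
    have [f1 f2] : (n%:~R * p <= a)%R /\ (a < n%:~R * p + p)%R.
      have /andP[H1 H2] := floor_itv (a / p)%R.
      rewrite -/n intrD in H1 H2; split; first by rewrite -ler_pdivlMr.
      by move: H2; rewrite ltr_pdivrMr// mulrDl mul1r.
    rewrite !mulrDl.
    have [x1|x1] := leP x (n%:~R * p + p)%R.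
      by left; apply/andP; split; lra.
    have [x2|x2] := leP x (n%:~R * p + p + p)%R.
      by right; left; apply/andP; split; lra.
    by right; right; apply/andP; split; lra.
apply: (le_trans H1).
have U (A B : set R) : measurable A -> measurable B ->
    \int[mu]_(x in A `|` B) f x <= \int[mu]_(x in A) f x + \int[mu]_(x in B) f x.
  move=> mA mB; rewrite integral_mkcond [in leRHS]integral_mkcond [X in _ + X]integral_mkcond.
  have P0 (C : set R) x : 0 <= (f \_ C) x by rewrite /patch; case: ifP.
  rewrite -ge0_integralD//; last 2 first.
    by apply/(measurable_restrictT _ _).1 => //; exact: measurable_funTS.
    by apply/(measurable_restrictT _ _).1 => //; exact: measurable_funTS.
  apply: ge0_le_integral_nomeas => // x _.
  rewrite /patch in_setU; case: (x \in A) => /=; first by rewrite leeDl//; case: ifP.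
  by case: (x \in B); rewrite add0e.
have E k : \int[mu]_(x in J k) f x = \int[mu]_(x in `[0%R, p]) f x.
  exact: ge0_integral_period.
apply: (le_trans (U _ _ _ _)) => //; first by apply: measurableU; exact: mJ.
apply: (@le_trans _ _ (\int[mu]_(x in J 0%R) f x + (\int[mu]_(x in J 1%R) f x + \int[mu]_(x in J 2%R) f x))).
  by rewrite leeD2l// U.
rewrite !E.
have -> : 3%:E = 1 + (1 + 1) :> \bar R by rewrite -!EFinD; congr _%:E; ring.
have I0 : 0 <= \int[mu]_(x in `[0%R, p]) f x by exact: integral_ge0.
rewrite !ge0_muleDl; by rewrite ?mul1e ?adde_ge0 ?lee01.
Qed.

End Integrals.

(** * Bounded measurable functions, closed under ring operations and integrable on sets of finite
    measure *)

Section BoundedMeasurable.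
Context {R : realType} {d : measure_display} {X : measurableType d}.
Implicit Types f g : X -> R.

Definition bmf f := measurable_fun [set: X] f /\ exists M : R, forall x, `|f x| <= M.

Lemma bmfD f g : bmf f -> bmf g -> bmf (fun x => f x + g x).
Proof.
move=> [mf [M fM]] [mg [N gN]]; split; first exact: measurable_funD.
by exists (M + N) => x; apply: (le_trans (ler_normD _ _)); exact: lerD.
Qed.

Lemma bmfN f : bmf f -> bmf (fun x => - f x).
Proof.
move=> [mf [M fM]]; split; first by apply: measurableT_comp.
by exists M => x; rewrite normrN.
Qed.

Lemma bmfM f g : bmf f -> bmf g -> bmf (fun x => f x * g x).
Proof.
move=> [mf [M fM]] [mg [N gN]]; split; first exact: measurable_funM.
by exists (M * N) => x; rewrite normrM; exact: ler_pM.
Qed.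

Lemma bmf_norm f : bmf f -> bmf (fun x => `|f x|).
Proof.
move=> [mf [M fM]]; split; first by apply: measurableT_comp.
by exists M => x; rewrite normr_id.
Qed.

Lemma bmf_cst c : bmf (fun _ => c).
Proof. by split; [exact: measurable_cst|exists `|c|]. Qed.

Lemma bmf_sum (I : Type) (s : seq I) (F : I -> X -> R) :
  (forall i, bmf (F i)) -> bmf (fun x => \sum_(i <- s) F i x).
Proof.
move=> bF; elim: s => [|i s IH].
  have -> : (fun x => \sum_(i <- [::]) F i x) = (fun=> 0).
    by apply/funext => x; rewrite big_nil.
  exact: bmf_cst.
have -> : (fun x => \sum_(j <- i :: s) F j x) = (fun x => F i x + \sum_(j <- s) F j x).
  by apply/funext => x; rewrite big_cons.
exact: bmfD.
Qed.

Lemma bmf_integrable (mu : {measure set X -> \bar R}) (D : set X) f :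
  measurable D -> (mu D < +oo)%E -> bmf f -> mu.-integrable D (EFin \o f).
Proof.
move=> mD fD [mf [M fM]]; apply: measurable_bounded_integrable => //.
  exact: measurable_funTS.
by exists M; split; [exact: num_real|move=> N MN x _; exact: (le_trans (fM x) (ltW MN))].
Qed.

End BoundedMeasurable.

Ltac bmf_step := match goal with
  | |- bmf (fun p => @?f p + @?g p) => apply: (@bmfD _ _ _ f g)
  | |- bmf (fun p => - @?f p) => apply: (@bmfN _ _ _ f)
  | |- bmf (fun p => @?f p * @?g p) => apply: (@bmfM _ _ _ f g)
  | |- bmf (fun p => `| @?f p |) => apply: (@bmf_norm _ _ _ f)
  | |- bmf (fun p => ?c) => exact: bmf_cst
  | H : bmf ?f |- bmf ?f => exact: H
  | H : forall i, bmf (@?f i) |- bmf _ => exact: H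
  | |- bmf (fun p => \sum_(i < _) _) => apply: bmf_sum => ?
  end.
Ltac bmft := repeat bmf_step.

(** * Integration over a space-time box *)

Section BoxIntegral.
Context {R : realType}.
Local Notation mu := (@lebesgue_measure R).
Local Notation mu2 := (mu \x mu)%E.
Variables (T A : R).
Hypotheses (T0 : 0 <= T) (A0 : 0 <= A).

Local Notation RR := (measurableTypeR R * measurableTypeR R)%type.
Implicit Types f g : RR -> R.

Definition box : set RR := `[0, T]%classic `*` `[- A, A]%classic.

Lemma measurable_box : measurable box.
Proof. by apply: measurableX. Qed.

Lemma box_finite : (mu2 box < +oo)%E.
Proof.
rewrite /box product_measure1E//= !lebesgue_measure_itv/=.
by do 2!case: ifP => _; rewrite ?mul0e ?mule0 ?lt0y// -!EFinB -EFinM ltry.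
Qed.

Definition bint (f : RR -> R) : R := Rintegral mu2 box f.

Lemma bintE f : bmf f -> (bint f)%:E = (\int[mu2]_(p in box) (f p)%:E)%E.
Proof.
move=> bf; rewrite /bint /Rintegral fineK//.
have := bmf_integrable measurable_box box_finite bf.
by apply: integrable_fin_num; exact: measurable_box.
Qed.

Lemma bintD f g : bmf f -> bmf g -> bint (fun p => f p + g p) = bint f + bint g.
Proof.
move=> bf bg; rewrite /bint RintegralD//; first exact: measurable_box.
all: by apply: bmf_integrable => //; [exact: measurable_box|exact: box_finite].
Qed.

Lemma bintB f g : bmf f -> bmf g -> bint (fun p => f p - g p) = bint f - bint g.
Proof.
move=> bf bg; rewrite /bint RintegralB//; first exact: measurable_box.
all: by apply: bmf_integrable => //; [exact: measurable_box|exact: box_finite].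
Qed.

Lemma le_bint f g : bmf f -> bmf g -> (forall p, box p -> f p <= g p) -> bint f <= bint g.
Proof.
move=> bf bg fg; apply: le_Rintegral => //; first exact: measurable_box.
all: by apply: bmf_integrable => //; [exact: measurable_box|exact: box_finite].
Qed.

Lemma bint_sum n (F : 'I_n -> RR -> R) : (forall i, bmf (F i)) ->
  bint (fun p => \sum_(i < n) F i p) = \sum_(i < n) bint (F i).
Proof.
move=> bF; apply: EFin_inj; rewrite bintE; last exact: bmf_sum.
under eq_integral do rewrite -sumEFin.
rewrite integral_sum; first by rewrite -sumEFin; apply: eq_bigr => i _; rewrite bintE.
  exact: measurable_box.
by move=> i; apply: bmf_integrable => //; [exact: measurable_box|exact: box_finite].
Qed.

Lemma bint_tonelli (f : RR -> R) : measurable_fun setT f -> (forall p, 0 <= f p) ->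
  (\int[mu2]_(p in box) (f p)%:E =
   \int[mu]_(t in `[0%R, T]) \int[mu]_(x in `[(- A)%R, A]) (f (t, x))%:E)%E.
Proof.
move=> mf f0; rewrite integral_mkcond fubini_tonelli1.
- rewrite [RHS]integral_mkcond; apply: eq_integral => t _; rewrite /fubini_F.
  rewrite /patch; case: ifPn => tT.
    rewrite [RHS]integral_mkcond; apply: eq_integral => x _; rewrite /patch.
    by rewrite /box in_setX tT.
  by rewrite integral0_eq// => x _; rewrite /box in_setX (negbTE tT).
- apply/(measurable_restrictT _ _).1; first exact: measurable_box.
  by apply: measurable_funTS; exact/measurable_EFinP.
- by move=> p; rewrite /patch; case: ifP => // _; rewrite lee_fin.
Qed.

(** Tonelli with a time weight. The slice bound is asked only where the weight is nonzero, which
    lets [rise_bound] look at times close to 0 alone. *)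
Lemma bint_le_avg (a : R -> R) (psi : RR -> R) (K L : R) :
  measurable_fun setT a -> measurable_fun setT psi ->
  (forall t, 0 <= a t) -> (forall p, 0 <= psi p) -> 0 <= K ->
  (forall t, 0 <= t <= T -> a t != 0 ->
     (\int[mu]_(x in `[(- A)%R, A]) (psi (t, x))%:E <= K%:E)%E) ->
  (\int[mu]_(t in `[0%R, T]) (a t)%:E <= L%:E)%E ->
  (\int[mu2]_(p in box) (a p.1 * psi p)%:E <= (K * L)%:E)%E.
Proof.
move=> ma mpsi a0 psi0 K0 H1 H2; rewrite bint_tonelli; last 2 first.
  apply: measurable_funM => //; apply: measurableT_comp => //; exact: measurable_fst.
  by move=> p; rewrite mulr_ge0.
apply: (@le_trans _ _ (\int[mu]_(t in `[0%R, T]) (K%:E * (a t)%:E))%E).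
  apply: ge0_le_integral_nomeas => t /=; rewrite in_itv/= => tT.
    by apply: integral_ge0 => x _; rewrite lee_fin mulr_ge0.
  under eq_integral do rewrite EFinM.
  rewrite ge0_integralZl_EFin//.
  - have [->|at0] := eqVneq (a t) 0; first by rewrite mul0e mule0.
    by rewrite [leRHS]muleC lee_wpmul2l ?lee_fin//; exact: H1.
  - by move=> x _; rewrite lee_fin.
  - apply/measurable_EFinP/measurable_funTS.
    exact: (measurableT_comp mpsi (@pair1_measurable _ _ (measurableTypeR R) (measurableTypeR R) t)).
rewrite ge0_integralZl_EFin//.
- by rewrite EFinM lee_wpmul2l ?lee_fin.
- by move=> x _; rewrite lee_fin.
- exact/measurable_EFinP/measurable_funTS.
Qed.

End BoxIntegral.

(** * Integrals of the scaled tents *)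

Section KernelIntegrals.
Context {R : realType}.
Local Notation mu := (@lebesgue_measure R).

Lemma measurable_hat : measurable_fun [set: R] (@hat R).
Proof. by apply: continuous_measurable_fun; exact: continuous_hat. Qed.

Lemma measurable_ramp : measurable_fun [set: R] (@ramp R).
Proof.
apply: continuous_measurable_fun => t; apply: differentiable_continuous; apply/derivable1_diffP.
exact: (@ex_derive _ _ _ _ _ _ _ (is_derive_ramp t)).
Qed.

Lemma hat_scaled_ge0 (h z : R) : 0 < h -> 0 <= hat (z / h) / h.
Proof. by move=> h0; rewrite divr_ge0 ?hat_ge0// ltW. Qed.

Lemma hat_scaled_eq0 (h z : R) : 0 < h -> z <= 0 \/ h <= z -> hat (z / h) / h = 0.
Proof.
move=> h0 [z0|hz]; rewrite hat_eq0 ?mul0r//; first by left; rewrite pmulr_lle0 ?invr_gt0.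
by right; rewrite ler_pdivlMr// mul1r.
Qed.

Lemma integral_hat (T c tau : R) : 0 < tau -> 0 <= c -> c + tau <= T ->
  (\int[mu]_(t in `[0%R, T]) (hat ((t - c) / tau) / tau)%:E = 1)%E.
Proof.
move=> tau0 c0 cT; have T0 : 0 < T by lra.
have tn0 : tau != 0 by rewrite gt_eqF.
have D t := @is_derive_scale R ramp hat c tau t tn0 (@is_derive_ramp R).
have C : continuous (fun t : R => ramp ((t - c) / tau)).
  move=> t; apply: differentiable_continuous; apply/derivable1_diffP.
  exact: (@ex_derive _ _ _ _ _ _ _ (D t)).
rewrite (@continuous_FTC2 R _ (fun t => ramp ((t - c) / tau)))//.
- rewrite ramp_eq1 ?ramp_eq0 ?sube0//.
    by rewrite pmulr_lle0 ?invr_gt0//; lra.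
  by rewrite ler_pdivlMr//; lra.
- apply: continuous_subspaceT.
  by have ch := @continuous_hat R; cts.
- split; first by move=> x _; exact: (@ex_derive _ _ _ _ _ _ _ (D x)).
  + by apply: cvg_at_right_filter; exact: C.
  + by apply: cvg_at_left_filter; exact: C.
- by move=> x _; rewrite derive1E; exact: (@derive_val _ _ _ _ _ _ _ (D x)).
Qed.

Lemma ge0_integral_le_itv (D : set R) (f : R -> R) (a b K : R) : a <= b ->
  measurable D -> measurable_fun setT f ->
  (forall x, 0 <= f x) -> (forall x, f x != 0 -> a <= x <= b) -> (forall x, f x <= K) ->
  (\int[mu]_(x in D) (f x)%:E <= (K * (b - a))%:E)%E.
Proof.
move=> ab mD mf f0 fs fK.
rewrite -integral_itv_const//.
apply: (@le_trans _ _ (\int[mu]_x (f x)%:E)%E).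
  apply: ge0_subset_integral => //; first exact/measurable_EFinP.
  by move=> x _; rewrite lee_fin.
rewrite -(@integral_zero_out _ _ _ mu `[a, b]%classic).
  by apply: ge0_le_integral_nomeas => x _; rewrite lee_fin.
move=> x /= xab; congr _%:E; apply/eqP; apply: contra_notT xab => /fs.
by rewrite in_itv.
Qed.

Lemma integral_hat_le2 (D : set R) (h a : R) : 0 < h -> measurable D ->
  (\int[mu]_(x in D) (hat ((x - a) / h) / h)%:E <= 2%:E)%E.
Proof.
move=> h0 mD.
have -> : 2%:E = ((2 / h) * ((a + h) - a))%:E :> \bar R.
  by congr _%:E; field; rewrite gt_eqF.
apply: ge0_integral_le_itv => //.
- lra.
- apply: measurable_funM => //; apply: (measurableT_comp measurable_hat).
  by apply: measurable_funM => //; apply: measurable_funB.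
- by move=> x; exact: hat_scaled_ge0.
- move=> x; apply: contraNT; rewrite negb_and -!ltNge => H.
  by apply/eqP; apply: hat_scaled_eq0 => //; case/orP: H => ?; [left|right]; lra.
- by move=> x; rewrite ler_pM2r ?invr_gt0//; exact: hat_le2.
Qed.

End KernelIntegrals.

(** * How long a characteristic takes to be stopped *)

Section Slow.
Context {R : realType}.
Variables (m : nat) (T : R).
Hypotheses (m0 : (0 < m)%N) (T0 : 0 <= T).
Local Notation mu := (@lebesgue_measure R).
Local Notation mesh := (@mesh R m).
Local Notation node := (@node R).
Local Notation level := (@level R).

(** The value used for [eta]: a zone of width [2 * eta] is crossed in time [2 * eta / level m j],
    and [level m j >= sin mesh] for [0 < j < m]. *)
Definition soften : R := mesh * sin mesh.

Lemma level_ge j : (0 < j)%N -> (j < m)%N -> sin mesh <= level m j.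
Proof.
move=> j0 jm.
have ms := mesh_gt0 (R := R) m0; have pi0 := @pi_gt0 R.
have n1 : mesh <= node m j.
  by have := node_le (R := R) m0 j0; rewrite nodeS node0 add0r.
have n2 : node m j <= pi - mesh.
  by have := node_le (R := R) m0 jm; rewrite nodeS nodem//; lra.
have pmh : pi / 2 = pi - pi / 2 :> R by field.
rewrite /level; have [h1|h1] := leP (node m j) (pi / 2).
  by apply: le_sin_half => //; lra.
have -> : sin (node m j) = sin (pi - node m j).
  by rewrite sinB sinpi cospi mul0r sub0r mulN1r opprK.
by apply: le_sin_half; lra.
Qed.

Hypothesis m1 : (1 < m)%N.

Lemma sin_mesh_gt0 : 0 < sin mesh.
Proof.
rewrite sin_gt0_pi// mesh_gt0//= ltr_pdivrMr ?ltr0n// ltr_pMr ?pi_gt0//.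
by rewrite ltr1n.
Qed.

Lemma soften_gt0 : 0 < soften.
Proof. by rewrite mulr_gt0 ?mesh_gt0// sin_mesh_gt0. Qed.

Lemma soften_le : soften <= mesh.
Proof. by rewrite ler_piMr ?sin_le1// ltW// mesh_gt0. Qed.

Lemma soften_lepi : 2 * soften <= pi.
Proof.
apply: (@le_trans _ _ (2 * mesh)); first by rewrite ler_pM2l// soften_le.
rewrite mulrCA ler_piMr ?pi_ge0// ler_pdivrMr ?ltr0n// mul1r.
by rewrite ler_nat.
Qed.

Lemma measurable_slow j : measurable_fun [set: R] (fun t => slow m soften t j).
Proof.
apply: measurable_fun_ifT; [|exact: measurable_cst|exact: measurable_cst].
have mc : measurable_fun [set: R] (fun t => @charac R m t j).
  by apply: measurable_funB => //; apply: measurable_funM.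
by apply: measurable_and; apply: measurable_fun_ltr.
Qed.

Lemma slow_ge0 t j : 0 <= slow m soften t j.
Proof. by rewrite /slow; case: ifP. Qed.

Lemma integral_slow j : (0 < j <= m)%N ->
  (\int[mu]_(t in `[0%R, T]) (slow m soften t j)%:E <= (2 * mesh)%:E)%E.
Proof.
(* The characteristic of [node m] has speed 0 and rests at [pi], outside the stopping zone, so it is
   treated apart. *)
move=> /andP[j0]; rewrite leq_eqVlt => /predU1P[->|jm].
  rewrite (integral0_eq mu) ?lee_fin; last first.
    by move=> t _; rewrite /slow characm// (le_gtF soften_lepi) andbF.
  by rewrite mulr_ge0// ltW// mesh_gt0.
have s0 := level_ge j0 jm; have sm := sin_mesh_gt0.
have l0 : 0 < level m j by exact: lt_le_trans s0.
have so := soften_gt0; have ms := mesh_gt0 (R := R) m0.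
pose a := (node m j - 2 * soften) / level m j; pose b := node m j / level m j.
have ab : b - a = 2 * soften / level m j by rewrite /a /b; field; rewrite gt_eqF.
have ab0 : 0 <= b - a by rewrite ab divr_ge0//; lra.
apply: (@le_trans _ _ (1 * (b - a))%:E).
  apply: ge0_integral_le_itv => //.
  - lra.
  - exact: measurable_slow.
  - by move=> t; rewrite /slow; case: ifP.
  - move=> t; rewrite /slow; case: ifP; rewrite ?eqxx// characE => /andP[? ?] _.
    by rewrite /a /b ler_pdivrMr// ler_pdivlMr//; apply/andP; split; lra.
  - by move=> t; rewrite /slow; case: ifP.
rewrite lee_fin mul1r ab ler_pdivrMr// /soften.
have : mesh * sin mesh <= mesh * level m j by rewrite ler_pM2l.
lra.
Qed.

Lemma measurable_fronterr j : measurable_fun [set: R] (fun t => fronterr m soften t j).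
Proof.
by apply: measurable_funM => //; apply: measurable_funD => //; exact: measurable_slow.
Qed.

Lemma integral_fronterr j : (0 < j <= m)%N ->
  (\int[mu]_(t in `[0%R, T]) (fronterr m soften t j)%:E <= (2 * (1 + T) * mesh ^+ 2)%:E)%E.
Proof.
move=> jm; have ms := mesh_gt0 (R := R) m0.
rewrite /fronterr; under eq_integral do rewrite EFinM EFinD.
rewrite ge0_integralZl_EFin//; last 3 first.
- move=> t _; have a0 := slow_ge0 t j; rewrite -EFinD lee_fin; apply: addr_ge0 => //.
  by apply: mulr_ge0 => //; exact: ltW.
- apply: emeasurable_funD => //; apply/measurable_EFinP/measurable_funTS.
  exact: measurable_slow.
- exact: ltW.
rewrite ge0_integralD//; last 3 first.
- by move=> t _; rewrite lee_fin slow_ge0.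
- by apply/measurable_EFinP/measurable_funTS; exact: measurable_slow.
- by move=> t _; rewrite lee_fin mulr_ge0 ?(ltW ms).
rewrite integral_itv_const//.
apply: (@le_trans _ _ (mesh%:E * ((2 * mesh)%:E + (2 * mesh * (T - 0))%:E))%E).
  by rewrite lee_wpmul2l ?lee_fin ?(ltW ms)// leeD2r// integral_slow.
by rewrite -EFinD -EFinM lee_fin le_eqVlt; apply/orP; left; apply/eqP; ring.
Qed.

End Slow.

(** * Comparison of an entropy solution with the fronts *)

Section Comparison.
Context {R : realType}.
Local Notation mu := (@lebesgue_measure R).
Local Notation mu2 := (mu \x mu)%E.
Local Notation RR := (measurableTypeR R * measurableTypeR R)%type.
Variables (u : R -> R -> R) (xi T M tau h : R) (m : nat).
Hypotheses (m1 : (1 < m)%N) (tau0 : 0 < tau) (h0 : 0 < h) (tauT : 2 * tau <= T) (h1 : h <= 1).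
Hypothesis uM : forall x t, 0 <= t -> `|u x t| <= M.
Hypothesis um : measurable_fun setT (fun p : R * R => u p.2 p.1).
Hypothesis uper : forall x t, u (x + 2 * pi) t = u x t.
Hypothesis uent : forall (k : R) (phi phit phix : R -> R -> R), test_fun phi phit phix ->
     (0 <= \int[mu2]_(p in setT)
        ((`|u p.2 p.1 - k| * phit p.1 p.2
          + Num.sg (u p.2 p.1 - k)
            * (burgers_flux (u p.2 p.1) - burgers_flux k) * phix p.1 p.2)%:E))%E.

Local Notation mesh := (@mesh R m).
Local Notation eta := (@soften R m).
Local Notation front := (front m eta).
Local Notation dfront := (dfront m eta).
Local Notation kval := (@kval R m).

Let m0 : (0 < m)%N. Proof. exact: ltnW. Qed.
Let eta0 : 0 < eta. Proof. exact: soften_gt0. Qed.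
Let etam : 2 * eta <= pi. Proof. exact: soften_lepi. Qed.
Let T0 : 0 <= T. Proof. by have ? := tau0; have ? := tauT; lra. Qed.

Definition width : R := `|xi| + 3 * pi + 1.
Let A0 : 0 <= width.
Proof. by rewrite /width addr_ge0// addr_ge0// mulr_ge0// pi_ge0. Qed.

Local Notation bx := (box T width).

(* A solution is not known to be bounded for negative times. *)
Definition past (p : RR) : R := if 0 <= p.1 then u p.2 p.1 else 0.

Lemma bmf_past : bmf past.
Proof.
split.
  apply: measurable_fun_ifT => //.
  by apply: measurable_fun_ler => //; exact: measurable_fst.
exists M => p; rewrite /past; case: ifP => [/uM//|_].
by rewrite normr0 (le_trans _ (uM 0 (lexx 0))).
Qed.

Lemma continuous_front i : continuous (front i).
Proof.
move=> t; apply: differentiable_continuous; apply/derivable1_diffP.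
exact: (@ex_derive _ _ _ _ _ _ _ (is_derive_front m eta0 i t)).
Qed.

Lemma measurable_offset i : measurable_fun [set: RR] (fun p : RR => (p.2 - xi - front i p.1) / h).
Proof.
apply: measurable_funM => //; apply: measurable_funB.
  by apply: measurable_funB => //; exact: measurable_snd.
apply: (measurableT_comp (continuous_measurable_fun (@continuous_front i))).
exact: measurable_fst.
Qed.

Lemma bmf_step i : bmf (fun p : RR => step h xi (front i) p.1 p.2).
Proof.
split.
  exact: (measurableT_comp measurable_ramp (measurable_offset i)).
by exists 1 => p; rewrite ger0_norm ?ramp_ge0 ?ramp_le1.
Qed.

Lemma bmf_ridge i : bmf (fun p : RR => ridge h xi (front i) p.1 p.2).
Proof.
split.
  by apply: measurable_funM => //; exact: (measurableT_comp measurable_hat (measurable_offset i)).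
exists (2 / h) => p; rewrite ger0_norm ?hat_scaled_ge0//.
by rewrite ler_pM2r ?invr_gt0// hat_le2.
Qed.

Lemma bmf_time (f : R -> R) (K : R) : continuous f -> (forall t, `|f t| <= K) ->
  bmf (fun p : RR => f p.1).
Proof.
move=> cf fK; split; last by exists K => p; exact: fK.
apply: (measurableT_comp (continuous_measurable_fun cf)); exact: measurable_fst.
Qed.

Lemma dpfront_le1 j t : `|dpfront m eta j t| <= 1.
Proof.
rewrite /dpfront normrM normrN ger0_norm ?dsoft_ge0//.
by apply: mulr_ile1 => //; [exact: dsoft_ge0|exact: dsoft_le1|exact: sin_max].
Qed.

Lemma bmf_dfront i : bmf (fun p : RR => dfront i p.1).
Proof.
apply: (@bmf_time _ 1); first exact: continuous_dfront.
move=> t; rewrite /(dfront _ _); case: ifP => _; first by rewrite normr0.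
case: ifP => _; first by rewrite normrN dpfront_le1.
by case: ifP => _; rewrite ?normr0 ?dpfront_le1.
Qed.

Definition rise t : R := hat ((t - tau) / tau) / tau.
Definition fall t : R := hat ((t - (T - tau)) / tau) / tau.

Lemma dchiE t : dchi T tau t = rise t - fall t. Proof. by []. Qed.

Lemma measurable_hat_scaled (c s : R) : measurable_fun [set: R] (fun t => hat ((t - c) / s) / s).
Proof.
apply: measurable_funM => //; apply: (measurableT_comp measurable_hat).
by apply: measurable_funM => //; apply: measurable_funB.
Qed.

Lemma bmf_hat_time (c s : R) : 0 < s -> bmf (fun p : RR => hat ((p.1 - c) / s) / s).
Proof.
move=> s0; apply: (@bmf_time (fun t => hat ((t - c) / s) / s) (2 / s)).
  by have ch := @continuous_hat R; cts.
move=> t; rewrite ger0_norm ?hat_scaled_ge0//.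
by rewrite ler_pM2r ?invr_gt0// hat_le2.
Qed.

Lemma bmf_rise : bmf (fun p : RR => rise p.1). Proof. exact: bmf_hat_time. Qed.
Lemma bmf_fall : bmf (fun p : RR => fall p.1). Proof. exact: bmf_hat_time. Qed.

Lemma bmf_chi : bmf (fun p : RR => chi T tau p.1).
Proof.
apply: (@bmf_time _ 1); first exact: continuous_chi.
by move=> t; rewrite ger0_norm ?chi_ge0 ?chi_le1.
Qed.

(** The Kruzhkov integrand of layer [i], regrouped: the derivative of the cut-off is [rise - fall],
    and the rest is the flux through the two bounding fronts. *)
Definition ent i (p : RR) : R :=
  (rise p.1 - fall p.1) * (`|past p - kval i| * layer m eta h i p.1 (p.2 - xi))
  + chi T tau p.1 * (ridge h xi (front i) p.1 p.2 * relflux (dfront i p.1) (past p) (kval i)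
     - ridge h xi (front i.+1) p.1 p.2 * relflux (dfront i.+1 p.1) (past p) (kval i)).

Lemma bmf_layer i : bmf (fun p : RR => layer m eta h i p.1 (p.2 - xi)).
Proof.
have -> : (fun p : RR => layer m eta h i p.1 (p.2 - xi)) =
  (fun p : RR => step h xi (front i) p.1 p.2 - step h xi (front i.+1) p.1 p.2) by [].
by have b := bmf_step; bmft.
Qed.

Lemma bmf_relflux i k : bmf (fun p : RR => relflux (dfront i p.1) (past p) k).
Proof. by have b := bmf_dfront; have b' := bmf_past; rewrite /relflux; bmft. Qed.

Lemma bmf_ent i : bmf (ent i).
Proof.
have b1 := bmf_rise; have b2 := bmf_fall; have b3 := bmf_past; have b4 := bmf_layer.
have b5 := bmf_chi; have b6 := bmf_ridge; have b7 := bmf_relflux.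
by rewrite /ent; bmft; do ?[exact: b4|exact: b6|exact: b7].
Qed.

Lemma front_cond i t : (i <= m.*2)%N -> 0 <= t ->
  [/\ - pi <= front i t, front i t <= front i.+1 t & front i.+1 t <= pi].
Proof.
move=> im t0; have /andP[a _] := front_bound m0 eta0 etam t0 (leqW im).
have /andP[_ b] := front_bound m0 eta0 etam t0 (im : (i.+1 <= m.*2.+1)%N).
by split => //; exact: front_mono.
Qed.

Lemma sg_flux (a k : R) : Num.sg (a - k) * (burgers_flux a - burgers_flux k) =
  `|a - k| * ((a + k) / 2).
Proof.
rewrite /burgers_flux [in RHS]normrEsg.
have -> : a ^+ 2 / 2 - k ^+ 2 / 2 = (a - k) * ((a + k) / 2) by field.
by ring.
Qed.

Lemma bint_ent_ge0 i : (i <= m.*2)%N -> 0 <= bint T width (ent i).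
Proof.
move=> im; rewrite -lee_fin bintE; last exact: bmf_ent.
have tf := @test_fun_layer R T tau h xi tau0 h0 tauT (front i) (front i.+1) (dfront i) (dfront i.+1)
  (is_derive_front m eta0 i) (is_derive_front m eta0 i.+1) (@continuous_dfront R m eta i)
  (@continuous_dfront R m eta i.+1) (fun t => @front_cond i t im).
apply: (le_trans (uent (kval i) tf)); rewrite le_eqVlt; apply/orP; left; apply/eqP.
have tau0' := tau0; have tauT' := tauT; have h0' := h0; have h1' := h1.
rewrite -(@integral_zero_out _ _ _ mu2 bx).
  apply: eq_integral => p /set_mem[/=]; rewrite in_itv/= => /andP[t0 tT] _.
  congr _%:E; rewrite sg_flux /ent /past t0 /layer -!/(step h xi _ _ _) dchiE /relflux.
  by ring.
move=> p pbox; congr _%:E.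
have [tt|tt] := leP p.1 tau.
  rewrite chi_eq0//; last by left.
  rewrite dchiE /rise /fall !hat_scaled_eq0//; first by ring.
    by left; lra.
  by left; lra.
have [tT|tT] := leP T p.1.
  rewrite chi_eq0//; last by right.
  rewrite dchiE /rise /fall !hat_scaled_eq0//; first by ring.
    by right; lra.
  by right; lra.
have t0 : 0 <= p.1 by lra.
have [q1 _ q2] := front_cond im t0; have [_ q q2'] := front_cond im t0.
have [xs|xs] : p.2 - xi <= - pi \/ pi + h <= p.2 - xi.
+ have [?|?] := leP (p.2 - xi) (- pi); [by left|right].
  rewrite leNgt; apply/negP => xs; apply: pbox.
  split => /=; rewrite in_itv/=; first by rewrite t0 ltW.
  have := ler_norm xi; have := ler_norm (- xi); rewrite normrN /width.
  have pi0 := @pi_gt0 R => *; apply/andP; split; lra.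
+ rewrite /step !ramp_eq0 ?pmulr_lle0 ?invr_gt0//; try lra.
  rewrite /ridge !hat_scaled_eq0//; first by ring.
    by left; lra.
  by left; lra.
+ rewrite /step !ramp_eq1 ?ler_pdivlMr//; try lra.
  rewrite /ridge !hat_scaled_eq0//; first by ring.
    by right; lra.
  by right; lra.
Qed.

(** The density of a smoothed L^1 distance between the solution and the piecewise constant
    comparison state. *)
Definition gap (p : RR) : R := \sum_(i < m.*2.+1) `|past p - kval i| * layer m eta h i p.1 (p.2 - xi).

Definition kern (z : R) : R := hat (z / h) / h.

Lemma kern_ge0 z : 0 <= kern z. Proof. exact: hat_scaled_ge0. Qed.

Definition transient (j : nat) (p : RR) : R :=
  fronterr m eta p.1 j.+1 * (kern (p.2 - xi - pfront m eta j.+1 p.1)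
    + kern (p.2 - xi + pfront m eta j.+1 p.1)).

Definition edge (s : R) (p : RR) : R := chi T tau p.1 * kern (p.2 - xi + s) * relflux 0 (past p) 0.

Lemma continuous_kern : continuous kern.
Proof. by have ch := @continuous_hat R; rewrite /kern; cts. Qed.

Lemma bmf_kern (f : RR -> R) : measurable_fun setT f -> bmf (fun p => kern (f p)).
Proof.
move=> mf; split.
  by apply: (measurableT_comp _ mf); exact: continuous_measurable_fun continuous_kern.
exists (2 / h) => p; rewrite ger0_norm ?kern_ge0//.
by rewrite ler_pM2r ?invr_gt0// hat_le2.
Qed.

Lemma bmf_gap : bmf gap.
Proof.
have b3 := bmf_past; have b4 := bmf_layer.
by rewrite /gap; apply: bmf_sum => i; bmft; do ?exact: b4.
Qed.

Lemma measurable_pfront j : measurable_fun [set: RR] (fun p : RR => pfront m eta j p.1).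
Proof.
have cp : continuous (pfront m eta j).
  move=> t; apply: differentiable_continuous; apply/derivable1_diffP.
  exact: (@ex_derive _ _ _ _ _ _ _ (is_derive_pfront m eta0 j t)).
apply: (measurableT_comp (continuous_measurable_fun cp)); exact: measurable_fst.
Qed.

Lemma bmf_fronterr j : bmf (fun p : RR => fronterr m eta p.1 j).
Proof.
split; first by apply: (measurableT_comp (@measurable_fronterr R m j)); exact: measurable_fst.
exists (mesh * (1 + 2 * mesh)) => p; have ms := mesh_gt0 (R := R) m0.
rewrite ger0_norm ?fronterr_ge0// /fronterr ler_pM2l// lerD2r /slow.
by case: ifP.
Qed.

Lemma measurable_x : measurable_fun [set: RR] (fun p : RR => p.2 - xi).
Proof. by apply: measurable_funB => //; exact: measurable_snd. Qed.

Lemma bmf_transient j : bmf (transient j).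
Proof.
apply: bmfM; first exact: bmf_fronterr.
apply: bmfD; apply: bmf_kern.
  by apply: measurable_funB; [exact: measurable_x|exact: measurable_pfront].
by apply: measurable_funD; [exact: measurable_x|exact: measurable_pfront].
Qed.

Lemma bmf_edge s : bmf (edge s).
Proof.
have b := bmf_past; have b1 := bmf_chi.
apply: bmfM; last by rewrite /relflux; bmft.
apply: bmfM => //; apply: bmf_kern.
by apply: measurable_funD => //; exact: measurable_x.
Qed.

(** This is [sum_fronts] at each point, multiplied by the cut-off; the factor [chi <= 1] is dropped
    from the transient terms, which are nonnegative. *)
Lemma sum_ent_le p : bx p -> \sum_(i < m.*2.+1) ent i p <=
  rise p.1 * gap p - fall p.1 * gap p + \sum_(j < m) transient j p + (edge pi p - edge (- pi) p).
Proof.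
move=> [/=]; rewrite in_itv/= => /andP[t0 tT] _.
rewrite /ent big_split /= -!mulr_sumr -/(gap p).
have := @sum_fronts R m eta m0 eta0 etam p.1 (p.2 - xi) (past p) kern t0 kern_ge0.
rewrite -!/(ridge h xi _ _ _).
set S1 := \sum_(i < m.*2.+1) _; set S2 := \sum_(j < m) _ => S12.
have c0 := chi_ge0 tau0 tauT p.1; have c1 := chi_le1 T tau p.1.
have S20 : 0 <= S2.
  by apply: sumr_ge0 => j _; rewrite mulr_ge0 ?addr_ge0 ?kern_ge0 ?fronterr_ge0.
have -> : \sum_(j < m) transient j p = S2.
  by apply: eq_bigr => j _; rewrite /transient mulrC.
have -> : edge pi p - edge (- pi) p = chi T tau p.1 *
    ((kern (p.2 - xi + pi) - kern (p.2 - xi - pi)) * relflux 0 (past p) 0).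
  by rewrite /edge; ring.
have H1 := ler_wpM2l c0 S12.
have H2 : chi T tau p.1 * S2 <= S2 by rewrite ler_piMl.
by rewrite mulrDr in H1; lra.
Qed.

Lemma integral_width_kern (t s : R) (w : R -> R) : `|s| <= pi -> measurable_fun setT w ->
  (forall x, 0 <= w x) ->
  (\int[mu]_(x in `[(- width)%R, width]) (kern (x - xi + s) * w x)%:E =
   \int[mu]_x (kern (x - xi + s) * w x)%:E)%E.
Proof.
move=> spi mw w0; apply: integral_zero_out => x /= xw; congr _%:E.
have h1' := h1; have h0' := h0; have pi0 := @pi_gt0 R.
move: spi; rewrite ler_norml => /andP[s1 s2].
rewrite /kern hat_scaled_eq0 ?mul0r//.
have [?|?] := leP (x - xi + s) 0; first by left.
right; rewrite leNgt; apply/negP => ?; apply: xw; rewrite in_itv/= /width.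
have := ler_norm xi; have := ler_norm (- xi); rewrite normrN => *.
by apply/andP; split; lra.
Qed.

(** The two kernels differ by a translation of one period, under which [w] is invariant, and the box
    contains both supports. *)
Lemma bint_edge_shift (w : RR -> R) : bmf w -> (forall p, 0 <= w p) ->
  (forall x t, w (t, x + 2 * pi) = w (t, x)) ->
  bint T width (fun p => chi T tau p.1 * kern (p.2 - xi + pi) * w p) =
  bint T width (fun p => chi T tau p.1 * kern (p.2 - xi + - pi) * w p).
Proof.
move=> bw w0 wper.
have bk s : bmf (fun p : RR => kern (p.2 - xi + s)).
  by apply: bmf_kern; apply: measurable_funD => //; exact: measurable_x.
have b1 := bmf_chi.
have bs s : bmf (fun p : RR => chi T tau p.1 * kern (p.2 - xi + s) * w p).
  by bmft; exact: bk.
have pos s p : 0 <= chi T tau p.1 * kern (p.2 - xi + s) * w p.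
  by apply: mulr_ge0; [apply: mulr_ge0; [exact: chi_ge0|exact: kern_ge0]|].
apply: EFin_inj; rewrite (bintE _ _ (bs pi)) (bintE _ _ (bs (- pi))).
rewrite (bint_tonelli _ _ (bs pi).1 (pos pi)) (bint_tonelli _ _ (bs (- pi)).1 (pos (- pi))).
have pi0 := @pi_ge0 R.
apply: eq_integral => t _ /=.
have mwt : measurable_fun [set: R] (fun x => w (t, x)).
  exact: (measurableT_comp bw.1 (@pair1_measurable _ _ (measurableTypeR R) (measurableTypeR R) t)).
have mk s : measurable_fun [set: R] (fun x : R => kern (x - xi + s)).
  apply: (measurableT_comp (continuous_measurable_fun continuous_kern)).
  by apply: measurable_funD => //; apply: measurable_funB.
have E s : `|s| <= pi -> (\int[mu]_(x in `[(- width)%R, width]) (chi T tau t * kern (x - xi + s) * w (t, x))%:E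
   = (chi T tau t)%:E * \int[mu]_x (kern (x - xi + s) * w (t, x))%:E)%E.
  move=> spi; rewrite -integral_width_kern//.
  under eq_integral do rewrite -mulrA EFinM.
  rewrite ge0_integralZl_EFin ?chi_ge0//.
  - by move=> x _; rewrite lee_fin mulr_ge0 ?kern_ge0.
  - by apply/measurable_EFinP/measurable_funTS; exact: (measurable_funM (mk s) mwt).
rewrite !E ?normrN ?ger0_norm//; congr (_ * _)%E.
rewrite -(@ge0_integral_shift R (2 * pi) (fun x => (kern (x - xi + - pi) * w (t, x))%:E)).
- apply: eq_integral => x _; rewrite wper; congr (kern _ * _)%:E; ring.
- by apply/measurable_EFinP; exact: (measurable_funM (mk (- pi)) mwt).
- by move=> x; rewrite lee_fin mulr_ge0 ?kern_ge0.
Qed.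

Lemma bint_edge : bint T width (edge pi) = bint T width (edge (- pi)).
Proof.
have M0 : 0 <= M by rewrite (le_trans _ (uM 0 (lexx 0))).
have bpast p : `|past p| <= M by rewrite /past; case: ifP => [/uM//|_]; rewrite normr0.
(* [bint_edge_shift] wants a nonnegative function. The flux is at least [- (M * M) / 2], so adding
   [K] is enough, and the part due to [K] is shifted in the same way. *)
pose K := M * M.
have G0 p : 0 <= relflux 0 (past p) 0 + K.
  rewrite /relflux /K !subr0 addr0.
  have := bpast p; rewrite ler_norml => /andP[].
  by case: (ger0P (past p)) => *; nra.
have bp := bmf_past; have bc := bmf_chi.
have bG : bmf (fun p : RR => relflux 0 (past p) 0 + K) by rewrite /relflux; bmft.
have pastper x t : past (t, x + 2 * pi) = past (t, x) by rewrite /past /= uper.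
have bk s : bmf (fun p : RR => kern (p.2 - xi + s)).
  by apply: bmf_kern; apply: measurable_funD => //; exact: measurable_x.
have E s : bint T width (edge s) =
    bint T width (fun p => chi T tau p.1 * kern (p.2 - xi + s) * (relflux 0 (past p) 0 + K))
    - bint T width (fun p => chi T tau p.1 * kern (p.2 - xi + s) * K).
  rewrite -bintB; last 2 first.
    by apply: bmfM bG; apply: bmfM bc (bk s).
    by apply: bmfM (bmf_cst K); apply: bmfM bc (bk s).
  by congr (bint _ _ _); apply/funext => p; rewrite /edge; ring.
rewrite !E; congr (_ - _).
  by apply: bint_edge_shift => // x t; rewrite pastper.
by apply: (bint_edge_shift (bmf_cst K)) => // p; rewrite mulr_ge0.
Qed.

(** Each of the two kernels contributes at most 2 in space, and [integral_fronterr] gives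
    [2 * (1 + T) * mesh ^+ 2] in time. *)
Lemma bint_transient j : (j < m)%N -> bint T width (transient j) <= 8 * (1 + T) * mesh ^+ 2.
Proof.
move=> jm; rewrite -lee_fin bintE; last exact: bmf_transient.
have -> : 8 * (1 + T) * mesh ^+ 2 = 4 * (2 * (1 + T) * mesh ^+ 2) by ring.
have mk c : measurable_fun [set: R] (fun x : R => kern (x - xi + c)).
  apply: (measurableT_comp (continuous_measurable_fun continuous_kern)).
  by apply: measurable_funD => //; apply: measurable_funB.
apply: (@bint_le_avg R T width (fun t => fronterr m eta t j.+1)
  (fun p => kern (p.2 - xi - pfront m eta j.+1 p.1) + kern (p.2 - xi + pfront m eta j.+1 p.1))) => //.
- exact: measurable_fronterr.
- apply: measurable_funD; apply: (measurableT_comp (continuous_measurable_fun continuous_kern)).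
    by apply: measurable_funB; [exact: measurable_x|exact: measurable_pfront].
  by apply: measurable_funD; [exact: measurable_x|exact: measurable_pfront].
- by move=> t; exact: fronterr_ge0.
- by move=> p; rewrite addr_ge0 ?kern_ge0.
- move=> t _ _ /=; under eq_integral do rewrite EFinD.
  rewrite ge0_integralD//; last 4 first.
  - by move=> x _; rewrite lee_fin kern_ge0.
  - by apply/measurable_EFinP/measurable_funTS; exact: mk.
  - by move=> x _; rewrite lee_fin kern_ge0.
  - by apply/measurable_EFinP/measurable_funTS; exact: mk.
  have -> : 4%:E = 2%:E + 2%:E :> \bar R by rewrite -EFinD; congr _%:E; ring.
  apply: leeD.
    have H2 := @integral_hat_le2 R `[(- width)%R, width]%classic h (xi + pfront m eta j.+1 t) h0 (measurable_itv _).
    apply: le_trans H2; rewrite le_eqVlt; apply/orP; left; apply/eqP.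
    by apply: eq_integral => x _; rewrite /kern opprD addrA.
  have H2 := @integral_hat_le2 R `[(- width)%R, width]%classic h (xi - pfront m eta j.+1 t) h0 (measurable_itv _).
  apply: le_trans H2; rewrite le_eqVlt; apply/orP; left; apply/eqP.
  by apply: eq_integral => x _; rewrite /kern opprB addrA addrAC.
- exact: integral_fronterr.
Qed.

(** L^1 contraction towards the comparison state: the gap averaged just before [T] is controlled by
    the gap averaged just after 0. The last term sums [m] front errors, with [m * mesh = pi]. *)
Lemma bint_gap_decay :
  bint T width (fun p => fall p.1 * gap p) <=
  bint T width (fun p => rise p.1 * gap p) + 8 * (1 + T) * pi * mesh.
Proof.
have b1 := bmf_rise; have b2 := bmf_fall; have b3 := bmf_gap; have b4 := bmf_transient.
have b5 := bmf_edge; have b6 := bmf_ent.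
have b7 : bmf (fun p : RR => \sum_(j < m) transient j p) by apply: bmf_sum => j.
have H : 0 <= bint T width (fun p => \sum_(i < m.*2.+1) ent i p).
  rewrite bint_sum//; apply: sumr_ge0 => i _; apply: bint_ent_ge0.
  by have := ltn_ord i; rewrite ltnS.
have c1 : bmf (fun p : RR => rise p.1 * gap p) by exact: bmfM.
have c2 : bmf (fun p : RR => fall p.1 * gap p) by exact: bmfM.
have c3 : bmf (fun p : RR => rise p.1 * gap p - fall p.1 * gap p).
  by apply: bmfD => //; exact: bmfN.
have c4 : bmf (fun p : RR => rise p.1 * gap p - fall p.1 * gap p + \sum_(j < m) transient j p).
  exact: bmfD.
have c5 : bmf (fun p : RR => edge pi p - edge (- pi) p).
  by apply: bmfD => //; apply: bmfN.
have c6 : bmf (fun p : RR => \sum_(i < m.*2.+1) ent i p) by apply: bmf_sum => i; exact: b6.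
have := le_trans H (le_bint c6 (bmfD c4 c5) sum_ent_le).
rewrite (bintD _ _ c4 c5) (bintD _ _ c3 b7) (bintB _ _ c1 c2) (bintB _ _ (b5 pi) (b5 (- pi))).
rewrite bint_edge subrr addr0 bint_sum// => H2.
have H3 : \sum_(j < m) bint T width (transient j) <= 8 * (1 + T) * pi * mesh.
  apply: (@le_trans _ _ (\sum_(j < m) (8 * (1 + T) * mesh ^+ 2))).
    by apply: ler_sum => j _; exact: bint_transient.
  rewrite sumr_const card_ord -mulr_natr le_eqVlt; apply/orP; left; apply/eqP.
  by rewrite /mesh; field; rewrite pnatr_eq0 -lt0n.
move: H2 H3; move: (bint _ _ _) (bint _ _ _) (\sum_(j < m) _) => a b c H2 H3.
rewrite -lerBDr; move: (8 * (1 + T) * pi * mesh) H3 => K H3.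
by lra.
Qed.

Lemma measurable_past_section t : measurable_fun [set: R] (fun x => past (t, x)).
Proof.
exact: (measurableT_comp bmf_past.1 (@pair1_measurable _ _ (measurableTypeR R) (measurableTypeR R) t)).
Qed.

Lemma measurable_gap_section t : measurable_fun [set: R] (fun x => gap (t, x)).
Proof.
exact: (measurableT_comp bmf_gap.1 (@pair1_measurable _ _ (measurableTypeR R) (measurableTypeR R) t)).
Qed.

Lemma gap_ge0 p : 0 <= p.1 -> 0 <= gap p.
Proof.
move=> t0; apply: sumr_ge0 => i _; rewrite mulr_ge0// layer_ge0//.
by have := ltn_ord i; rewrite ltnS.
Qed.

(** If all layers present at [p] carry values near [w], the triangle inequality in both directions
    exchanges [gap] for the distance of the solution to [w]. *)
Lemma gap_near (p : RR) (w c : R) : 0 <= p.1 ->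
  (forall i, (i <= m.*2)%N -> layer m eta h i p.1 (p.2 - xi) != 0 -> `|kval i - w| <= c) ->
  0 <= c ->
  gap p <= `|past p - w| + c /\
  `|past p - w| * (\sum_(i < m.*2.+1) layer m eta h i p.1 (p.2 - xi)) <= gap p + c.
Proof.
move=> t0 kw c0.
have l0 (i : 'I_m.*2.+1) : 0 <= layer m eta h i p.1 (p.2 - xi).
  by apply: layer_ge0 => //; rewrite -ltnS.
have l1 := sum_layer_le1 eta h m0 p.1 (p.2 - xi).
have kwl (i : 'I_m.*2.+1) : `|kval i - w| * layer m eta h i p.1 (p.2 - xi) <= c * layer m eta h i p.1 (p.2 - xi).
  have [->|ln] := eqVneq (layer m eta h i p.1 (p.2 - xi)) 0; first by rewrite !mulr0.
  by apply: ler_wpM2r => //; apply: kw => //; rewrite -ltnS.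
have cl : \sum_(i < m.*2.+1) c * layer m eta h i p.1 (p.2 - xi) <= c.
  by rewrite -mulr_sumr ler_piMr.
split.
  apply: (@le_trans _ _ (\sum_(i < m.*2.+1) (`|past p - w| * layer m eta h i p.1 (p.2 - xi)
     + c * layer m eta h i p.1 (p.2 - xi)))).
    apply: ler_sum => i _; apply: (@le_trans _ _ ((`|past p - w| + `|kval i - w|) * layer m eta h i p.1 (p.2 - xi))).
      apply: ler_wpM2r => //; rewrite [`|kval i - w|]distrC; exact: ler_distD.
    by rewrite mulrDl lerD2l.
  by rewrite big_split /= lerD// -mulr_sumr ler_piMr.
rewrite mulr_sumr; apply: (@le_trans _ _ (\sum_(i < m.*2.+1)
    (`|past p - kval i| * layer m eta h i p.1 (p.2 - xi) + c * layer m eta h i p.1 (p.2 - xi)))).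
  apply: ler_sum => i _; apply: (@le_trans _ _ ((`|past p - kval i| + `|kval i - w|) * layer m eta h i p.1 (p.2 - xi))).
    by apply: ler_wpM2r => //; exact: ler_distD.
  by rewrite mulrDl lerD2l.
by rewrite big_split /= lerD2l.
Qed.

Local Notation W := (`[(xi - pi)%R, (xi + 2 * pi)%R]%classic : set R).

Lemma gap_out t x : 0 <= t -> ~ W x -> gap (t, x) = 0.
Proof.
move=> t0 xW; apply: big1 => i _; rewrite layer_out ?mulr0//=.
  by have := ltn_ord i; rewrite ltnS.
apply/negP => /andP[? ?]; apply: xW; rewrite /= in_itv/=.
have h1' := h1; have pi2 := @pi_ge2 R.
by apply/andP; split; lra.
Qed.

Lemma integral_gap_width t (f : R -> R) : 0 <= t ->
  measurable_fun setT f -> (forall x, 0 <= f x) -> (forall x, gap (t, x) <= f x) ->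
  (\int[mu]_(x in `[(- width)%R, width]) (gap (t, x))%:E <= \int[mu]_(x in W) (f x)%:E)%E.
Proof.
move=> t0 mf f0 gf.
apply: (@le_trans _ _ (\int[mu]_x (gap (t, x))%:E)%E).
  apply: ge0_subset_integral => //; first by apply/measurable_EFinP; exact: measurable_gap_section.
  by move=> x _; rewrite lee_fin gap_ge0.
rewrite -(@integral_zero_out _ _ _ mu W); last by move=> x xW; rewrite gap_out.
by apply: ge0_le_integral_nomeas => x _; rewrite lee_fin ?gf// gap_ge0.
Qed.

Section Endpoints.
Hypothesis hT : pi < T.
Hypothesis tau_pi : tau <= pi / 2.
Hypothesis u0 : forall x, u x 0 = ubar xi x.
Variables e : R.
Hypothesis e0 : 0 <= e.
Hypothesis near0 : forall t, 0 <= t -> t <= 2 * tau ->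
  (\int[mu]_(x in W) (`|u x t - u x 0|)%:E <= e%:E)%E.
Hypothesis nearT : forall t, T - tau <= t -> t <= T ->
  (\int[mu]_(x in W) (`|u x t - u x T|)%:E <= e%:E)%E.

Let c0 : R := 2 * tau + eta + 2 * mesh + h.

(** The weight [rise] has mass 1 and lives on [[tau, 2 * tau]], where the solution is within [e] of
    its datum in L^1 and the layer values within [c0]; the length of [W] is [3 * pi]. *)
Lemma rise_bound : bint T width (fun p => rise p.1 * gap p) <= e + c0 * (3 * pi).
Proof.
have tau0' := tau0; have h0' := h0; have eta0' := eta0; have ms := mesh_gt0 (R := R) m0.
have pi0 := @pi_gt0 R; have tauT' := tauT.
have c00 : 0 <= c0 by rewrite /c0; lra.
rewrite -lee_fin bintE; last by apply: bmfM; [exact: bmf_rise|exact: bmf_gap].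
(* [gap] may be negative at negative times, where [bint_le_avg] wants a nonnegative function. *)
pose gapp (p : RR) := `|gap p|.
have -> : (\int[mu2]_(p in bx) (rise p.1 * gap p)%:E = \int[mu2]_(p in bx) (rise p.1 * gapp p)%:E)%E.
  apply: eq_integral => p /set_mem[/=]; rewrite in_itv/= => /andP[t0 _] _.
  by rewrite /gapp ger0_norm// gap_ge0.
have -> : e + c0 * (3 * pi) = (e + c0 * (3 * pi)) * 1 by rewrite mulr1.
apply: (@bint_le_avg R T width rise gapp) => //.
- exact: measurable_hat_scaled.
- by apply: measurableT_comp => //; exact: bmf_gap.1.
- by move=> t; exact: hat_scaled_ge0.
- by move=> p; exact: normr_ge0.
- by rewrite addr_ge0// mulr_ge0//; lra.
- move=> t /andP[t0 _] rt.
  have [t1 t2] : tau <= t /\ t <= 2 * tau.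
    split; rewrite leNgt; apply: contra rt => ?; apply/eqP; apply: hat_scaled_eq0 => //; [left|right]; lra.
  have us : measurable_fun [set: R] (fun x => `|past (t, x) - past (0, x)|).
    apply: measurableT_comp => //; apply: measurable_funB; exact: measurable_past_section.
  apply: (@le_trans _ _ (\int[mu]_(x in W) (`|past (t, x) - past (0, x)| + c0)%:E)%E).
    have -> : (\int[mu]_(x in `[(- width)%R, width]) (gapp (t, x))%:E =
               \int[mu]_(x in `[(- width)%R, width]) (gap (t, x))%:E)%E.
      by apply: eq_integral => x _; rewrite /gapp ger0_norm// gap_ge0.
    apply: integral_gap_width => //.
    + exact: measurable_funD.
    + by move=> x; rewrite addr_ge0.
    + move=> x; have -> : past (0, x) = - sin (x - xi) by rewrite /past/= lexx u0.
      apply: (@gap_near (t, x) (- sin (x - xi)) c0 t0 _ c00).1 => i im ln.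
      apply: (le_trans (layer_init m0 eta0 etam h0 t0 im ln)) => /=.
      by rewrite /c0; lra.
  under eq_integral do rewrite EFinD.
  rewrite ge0_integralD//; last first.
    by apply/measurable_EFinP/measurable_funTS.
  rewrite [(e + c0 * (3 * pi))%:E]EFinD; apply: leeD.
    apply: le_trans (near0 t0 t2); apply: ge0_le_integral_nomeas => x _; rewrite lee_fin//.
    by rewrite /past /= t0 lexx.
  rewrite integral_itv_const; last lra.
  by rewrite lee_fin le_eqVlt; apply/orP; left; apply/eqP; ring.
- by rewrite integral_hat//; lra.
Qed.

Let c1 : R := tau + h + eta + (2 + T) * mesh.
Let Wpi : set R := `[(xi - pi)%R, (xi + pi)%R]%classic.
Let dist : \bar R := (\int[mu]_(x in Wpi) (`|u x T - shock_profile T (x - xi)|)%:E)%E.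

(** Two strips of width [h] are given up with the crude bound [M + 1]: next to [xi - pi], where the
    layers do not yet sum to 1, and next to the shock, which [layer_final] leaves out. *)
Lemma dist_le_gap t : T - tau <= t -> t <= T ->
  (dist <= \int[mu]_(x in `[(- width)%R, width]) (gap (t, x))%:E
     + (e + c1 * (2 * pi) + 2 * (M + 1) * h)%:E)%E.
Proof.
move=> t1 t2.
have tau0' := tau0; have h0' := h0; have eta0' := eta0; have ms := mesh_gt0 (R := R) m0.
have pi0 := @pi_gt0 R; have tauT' := tauT; have hT' := hT; have tp' := tau_pi.
have t0 : 0 <= t by lra.
have T00 := T0.
have Tm : 0 <= (2 + T) * mesh by apply: mulr_ge0; lra.
have c10 : 0 <= c1 by rewrite /c1; lra.
have M0 : 0 <= M by rewrite (le_trans _ (uM 0 (lexx 0))).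
pose b1 (x : R) : R := if xi - pi <= x <= xi - pi + h then M + 1 else 0.
pose b2 (x : R) : R := if xi <= x <= xi + h then M + 1 else 0.
have mb (a b : R) : measurable_fun [set: R] (fun x : R => if a <= x <= b then M + 1 else 0).
  apply: measurable_fun_ifT; [|exact: measurable_cst|exact: measurable_cst].
  by apply: measurable_and; apply: measurable_fun_ler.
have b0 (a b x : R) : 0 <= (if a <= x <= b then M + 1 else 0 : R) by case: ifP => _; lra.
have ib (a : R) : (\int[mu]_(x in Wpi) (if a <= x <= a + h then M + 1 else 0 : R)%:E <= ((M + 1) * h)%:E)%E.
  have -> : (M + 1) * h = (M + 1) * ((a + h) - a) by ring.
  apply: ge0_integral_le_itv => //.
  - lra.
  - by rewrite /Wpi.
  - by move=> x; case: ifP => //; rewrite eqxx.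
  - by move=> x; case: ifP => _; lra.
have us : measurable_fun [set: R] (fun x => `|past (t, x) - past (T, x)|).
  apply: measurableT_comp => //; apply: measurable_funB; exact: measurable_past_section.
pose F x := (`|past (t, x) - past (T, x)| + gap (t, x)) + (c1 + (b1 x + b2 x)).
apply: (@le_trans _ _ (\int[mu]_(x in Wpi) (F x)%:E)%E).
  apply: ge0_le_integral_nomeas => x; first by rewrite lee_fin.
  rewrite /Wpi /= in_itv/= => /andP[x1 x2]; rewrite lee_fin /F.
  have pT : past (T, x) = u x T by rewrite /past /= T00.
  have g0 : 0 <= gap (t, x) by exact: gap_ge0.
  have [bad|/norP[nb1 nb2]] := boolP ((xi - pi <= x <= xi - pi + h) || (xi <= x <= xi + h)).
    have H1 : M + 1 <= b1 x + b2 x.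
      have p1 := b0 xi (xi + h) x; have p2 := b0 (xi - pi) (xi - pi + h) x.
      rewrite -/(b2 x) in p1; rewrite -/(b1 x) in p2.
      case/orP: bad => b; first by (have -> : b1 x = M + 1 by rewrite /b1 b); lra.
      by (have -> : b2 x = M + 1 by rewrite /b2 b); lra.
    have H2 : `|u x T - shock_profile T (x - xi)| <= M + 1.
      apply: (le_trans (ler_normB _ _)); apply: lerD; first exact: uM.
      exact: shock_profile_le1.
    have H3 := normr_ge0 (past (t, x) - past (T, x)).
    lra.
  rewrite /b1 /b2 (negbTE nb1) (negbTE nb2) !addr0.
  have l1 : \sum_(i < m.*2.+1) layer m eta h i t (x - xi) = 1.
    apply: sum_layer_eq1 => //; last lra.
    move: nb1; rewrite x1 /=; rewrite -ltNge; lra.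
  have kw i : (i <= m.*2)%N -> layer m eta h i t (x - xi) != 0 -> `|kval i - shock_profile T (x - xi)| <= c1.
    move=> im ln; apply: (@layer_final R m eta h m0 eta0 etam h0 T tau t) => //; [exact: ltW|lra|apply/andP; split; lra|].
    apply: contra nb2 => /andP[? ?]; apply/andP; split; lra.
  have [_] := @gap_near (t, x) (shock_profile T (x - xi)) c1 t0 kw c10.
  rewrite /= l1 mulr1 => H.
  have := ler_distD (past (t, x)) (u x T) (shock_profile T (x - xi)).
  rewrite -pT [`|past (T, x) - past (t, x)|]distrC; lra.
have mg := measurable_gap_section t.
rewrite /F; under eq_integral do rewrite 2!EFinD.
have mW : measurable Wpi by rewrite /Wpi.
have bb x : 0 <= b1 x + b2 x by apply: addr_ge0; exact: b0.
have fin0 (a b : R) : 0 <= a -> 0 <= b -> (0 <= a%:E + b%:E)%E by move=> *; rewrite adde_ge0 ?lee_fin.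
have g0 x : 0 <= gap (t, x) by exact: gap_ge0.
rewrite ge0_integralD//; last 4 first.
- by move=> x _; exact: fin0.
- by apply: emeasurable_funD; apply/measurable_EFinP/measurable_funTS.
- by move=> x _; rewrite lee_fin; exact: addr_ge0 c10 (bb x).
- by apply/measurable_EFinP/measurable_funTS; apply: measurable_funD => //; apply: measurable_funD; exact: mb.
rewrite ge0_integralD//; try (by move=> x _; rewrite lee_fin);
  try (by apply/measurable_EFinP/measurable_funTS).
under [X in (_ + X <= _)%E]eq_integral do rewrite (EFinD c1).
rewrite [X in (_ + X <= _)%E]ge0_integralD//; last 2 first.
- by move=> x _; rewrite lee_fin; exact: bb.
- by apply/measurable_EFinP/measurable_funTS; apply: measurable_funD; exact: mb.
under [X in (_ + (_ + X) <= _)%E]eq_integral do rewrite EFinD.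
rewrite [X in (_ + (_ + X) <= _)%E]ge0_integralD//; last 4 first.
- by move=> x _; rewrite lee_fin b0.
- by apply/measurable_EFinP/measurable_funTS; exact: mb.
- by move=> x _; rewrite lee_fin b0.
- by apply/measurable_EFinP/measurable_funTS; exact: mb.
have I1 : (\int[mu]_(x in Wpi) (`|past (t, x) - past (T, x)|)%:E <= e%:E)%E.
  apply: le_trans (nearT t1 t2).
  apply: (@le_trans _ _ (\int[mu]_(x in W) (`|past (t, x) - past (T, x)|)%:E)%E).
    apply: ge0_subset_integral => //.
    + exact/measurable_EFinP/measurable_funTS.
    + by move=> x; rewrite /Wpi /= !in_itv/= => /andP[? ?]; apply/andP; split; lra.
  by apply: ge0_le_integral_nomeas => x _; rewrite lee_fin// /past /= t0 T00.
have I2 : (\int[mu]_(x in Wpi) (gap (t, x))%:E <= \int[mu]_(x in `[(- width)%R, width]) (gap (t, x))%:E)%E.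
  apply: ge0_subset_integral => //.
  + exact/measurable_EFinP/measurable_funTS.
  + by move=> x _; rewrite lee_fin.
  + move=> x; rewrite /Wpi /= !in_itv/= /width => /andP[? ?].
    have := ler_norm xi; have := ler_norm (- xi); rewrite normrN => *.
    by apply/andP; split; lra.
have I3 : (\int[mu]_(x in Wpi) c1%:E = (c1 * (2 * pi))%:E)%E.
  by rewrite integral_itv_const; [congr _%:E; ring|lra].
rewrite I3.
have -> : (e + c1 * (2 * pi) + 2 * (M + 1) * h)%:E =
  (e%:E + ((c1 * (2 * pi))%:E + (((M + 1) * h)%:E + ((M + 1) * h)%:E)))%E.
  by rewrite -!EFinD; congr _%:E; ring.
rewrite [leRHS]addeA [X in (_ <= X + _)%E]addeC; apply: leeD; first exact: leeD I1 I2.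
by apply: leeD => //; apply: leeD; exact: ib.
Qed.

(** Since [dist] does not depend on [t], averaging [dist_le_gap] against [fall], of mass 1, produces
    the left-hand side of [bint_gap_decay]. *)
Lemma dist_le : (dist <= (e + c0 * (3 * pi) + 8 * (1 + T) * pi * mesh
   + (e + c1 * (2 * pi) + 2 * (M + 1) * h))%:E)%E.
Proof.
have tau0' := tau0; have h0' := h0; have eta0' := eta0; have ms := mesh_gt0 (R := R) m0.
have pi0 := @pi_gt0 R; have tauT' := tauT; have hT' := hT; have tp' := tau_pi; have e0' := e0.
have T00 := T0.
have M0 : 0 <= M by rewrite (le_trans _ (uM 0 (lexx 0))).
set K := e + c1 * (2 * pi) + 2 * (M + 1) * h.
have K0 : 0 <= K.
  have Tm : 0 <= (2 + T) * mesh by apply: mulr_ge0; lra.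
have c10 : 0 <= c1 by rewrite /c1; lra.
  by rewrite /K !addr_ge0 ?mulr_ge0//; lra.
have w0 : 0 < 2 * width by rewrite /width; have := normr_ge0 xi; lra.
(* Spread over the width of the box, the constant [K] can be kept under the space integral. *)
pose K' := K / (2 * width).
have KE : K' * (width - - width) = K.
  by rewrite opprK -mulr2n -mulr_natl divfK// gt_eqF.
have K'0 : 0 <= K' by rewrite divr_ge0// ltW.
have d0 : (0 <= dist)%E by apply: integral_ge0 => x _; rewrite lee_fin.
have mf : measurable_fun [set: R] fall by exact: measurable_hat_scaled.
have f0 t : 0 <= fall t by exact: hat_scaled_ge0.
have If : (\int[mu]_(t in `[0%R, T]) (fall t)%:E = 1)%E by rewrite integral_hat//; lra.
pose G (p : RR) : R := fall p.1 * (`|gap p| + K').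
have bG : bmf G.
  by apply: bmfM; [exact: bmf_fall|apply: bmfD; [apply: bmf_norm; exact: bmf_gap|exact: bmf_cst]].
have G0 p : 0 <= G p by rewrite mulr_ge0// addr_ge0.
have -> : dist = (dist * \int[mu]_(t in `[0%R, T]) (fall t)%:E)%E by rewrite If mule1.
rewrite -ge0_integralZl//; last 2 first.
- exact/measurable_EFinP/measurable_funTS.
- by move=> t _; rewrite lee_fin.
apply: (@le_trans _ _ (\int[mu2]_(p in bx) (G p)%:E)%E).
  rewrite (bint_tonelli _ _ bG.1 G0).
  apply: ge0_le_integral_nomeas => t /=; first by rewrite mule_ge0 ?lee_fin.
  rewrite in_itv/= => /andP[t0 tT].
  have [ft|ft] := eqVneq (fall t) 0.
    by rewrite ft mule0; apply: integral_ge0 => x _; rewrite lee_fin.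
  have [t1 t2] : T - tau <= t /\ t <= T.
    by split => //; rewrite leNgt; apply: contra ft => ?; apply/eqP; apply: hat_scaled_eq0 => //; left; lra.
  rewrite /G /=; under eq_integral do rewrite EFinM.
  have mg : measurable_fun [set: R] (fun x => `|gap (t, x)|).
    by apply: measurableT_comp => //; exact: measurable_gap_section.
  rewrite ge0_integralZl_EFin//; last 2 first.
  - by move=> x _; rewrite lee_fin addr_ge0.
  - by apply/measurable_EFinP/measurable_funTS; exact: measurable_funD.
  rewrite [leLHS]muleC lee_wpmul2l ?lee_fin//.
  apply: (le_trans (dist_le_gap t1 t2)).
  under [X in (_ <= X)%E]eq_integral do rewrite EFinD.
  rewrite ge0_integralD//; last by apply/measurable_EFinP/measurable_funTS.
  apply: leeD.
    by apply: ge0_le_integral_nomeas => x _; rewrite lee_fin ?gap_ge0// ler_norm.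
  rewrite integral_itv_const; last by rewrite /width; have := normr_ge0 xi; lra.
  by rewrite KE lexx.
rewrite -(bintE _ _ bG) lee_fin.
have bfg : bmf (fun p : RR => fall p.1 * gap p) by apply: bmfM; [exact: bmf_fall|exact: bmf_gap].
have bfK : bmf (fun p : RR => fall p.1 * K') by apply: bmfM; [exact: bmf_fall|exact: bmf_cst].
have H1 : bint T width G <= bint T width (fun p => fall p.1 * gap p) + bint T width (fun p => fall p.1 * K').
  rewrite -bintD//; apply: le_bint => //; first exact: bmfD.
  move=> p [/=]; rewrite in_itv/= => /andP[t0 _] _.
  by rewrite /G ger0_norm ?gap_ge0// mulrDr.
have H2 : bint T width (fun p => fall p.1 * K') <= K.
  rewrite -lee_fin bintE//; have -> : K = K * 1 by rewrite mulr1.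
  apply: (@bint_le_avg R T width fall (fun=> K')) => //; last by rewrite If.
  move=> t _ _; rewrite integral_itv_const; last by rewrite /width; have := normr_ge0 xi; lra.
  by rewrite KE lexx.
have H3 := bint_gap_decay; have H4 := rise_bound.
apply: (le_trans H1); apply: lerD => //; apply: (le_trans H3).
by rewrite lerD2r.
Qed.

End Endpoints.

End Comparison.

(** * Identification of every entropy solution at time [T] *)

Section Uniqueness.
Context {R : realType}.
Local Notation mu := (@lebesgue_measure R).
Variables (T xi : R) (u : R -> R -> R).
Hypotheses (hT : pi < T) (hu : entropy_solution u (ubar xi)).

Local Notation W := (`[(xi - pi)%R, (xi + 2 * pi)%R]%classic : set R).

Lemma measurable_solution_section t : measurable_fun [set: R] (fun x => u x t).
Proof.
have [_ [_ [um _]]] := hu.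
exact: (measurableT_comp um (@pair1_measurable _ _ (measurableTypeR R) (measurableTypeR R) t)).
Qed.

Lemma continuity_window t0 e : 0 <= t0 -> 0 < e -> exists2 d, 0 < d &
  forall t, 0 <= t -> `|t - t0| < d ->
  (\int[mu]_(x in W) (`|u x t - u x t0|)%:E <= e%:E)%E.
Proof.
move=> t00 e0; have [uper [_ [_ [_ [uc _]]]]] := hu.
have [d [d0 H]] := uc t0 t00 (e / 3) (divr_gt0 e0 (ltr0n _ 3)).
exists d => // t tt0 /(H t tt0) {}H.
have pp : 0 < 2 * pi :> R by rewrite mulr_gt0// pi_gt0.
have mf : measurable_fun [set: R] (fun x => (`|u x t - u x t0|)%:E).
  apply/measurable_EFinP; apply: measurableT_comp => //.
  by apply: measurable_funB; exact: measurable_solution_section.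
have := @ge0_integral_cover3 R (fun x => (`|u x t - u x t0|)%:E) (2 * pi) (xi - pi) pp mf.
have -> : xi - pi + 3 / 2 * (2 * pi) = xi + 2 * pi by field.
move=> cov; apply: le_trans (cov _ _) _ => //.
- by move=> x; rewrite !uper.
have -> : e = 3 * (e / 3) by field.
by rewrite EFinM lee_wpmul2l ?lee_fin.
Qed.

Lemma entropy_profile :
  (\int[mu]_(x in `[(xi - pi)%R, (xi + pi)%R]) (`|u x T - shock_profile T (x - xi)|)%:E = 0)%E.
Proof.
have [uper [[M uM] [um [uent [uc u0]]]]] := hu.
have pi0 := @pi_gt0 R; have pi2 := @pi_ge2 R; have hT' := hT.
have M0 : 0 <= M by rewrite (le_trans _ (uM 0 0 (lexx 0))).
apply/eqP; rewrite eq_le; apply/andP; split; last first.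
  by apply: integral_ge0 => x _; rewrite lee_fin.
apply/lee_addgt0Pr => e e0; rewrite add0e.
have e30 : 0 < e / 3 by rewrite divr_gt0.
have [d0 d00 near0] := continuity_window (lexx 0) e30.
have T0 : 0 <= T by lra.
have [d1 d10 nearT] := continuity_window T0 e30.
(* [C * mesh] collects the errors of [dist_le] for [h = mesh], [soften <= mesh] and
   [tau <= mesh / 2]; for instance [c0 <= 6 * mesh] on length [3 * pi] gives [18 * pi]. *)
pose C : R := 18 * pi + 8 * (1 + T) * pi + (5 + T) * (2 * pi) + 2 * (M + 1).
have C0 : 0 < C.
  have ? : 0 <= (1 + T) * pi by apply: mulr_ge0; lra.
  have ? : 0 <= (5 + T) * pi by apply: mulr_ge0; lra.
  by rewrite /C; lra.
(* The first summand forces [C * mesh <= e / 3], the second [mesh <= 1]. *)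
pose m := (Num.truncn (3 * C * pi / e + 2 * pi)).+2.
have m1 : (1 < m)%N by [].
have m0 : (0 < m)%N by [].
have mR : 0 < m%:R :> R by rewrite ltr0n.
have mb : 3 * C * pi / e + 2 * pi < m%:R.
  have := @truncnS_gt R (3 * C * pi / e + 2 * pi).
  by move=> H; apply: (lt_trans H); rewrite ltr_nat.
have q0 : 0 <= 3 * C * pi / e.
  by apply: divr_ge0; [apply: mulr_ge0; [apply: mulr_ge0|]|]; lra.
have ms0 := mesh_gt0 (R := R) m0.
have ms1 : mesh m <= 1 :> R by rewrite ler_pdivrMr// mul1r; lra.
have mse : C * mesh m <= e / 3.
  rewrite /mesh mulrA ler_pdivrMr// -ler_pdivrMl//.
  have -> : (e / 3)^-1 * (C * pi) = 3 * C * pi / e by field; rewrite gt_eqF.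
  lra.
pose tau := Num.min (Num.min (d0 / 3) (d1 / 2)) (mesh m / 2).
have tau0 : 0 < tau by rewrite !lt_min !divr_gt0.
have tau1 : tau <= d0 / 3 by rewrite /tau !ge_min lexx.
have tau2 : tau <= d1 / 2 by rewrite /tau !ge_min lexx orbT.
have tau3 : tau <= mesh m / 2 by rewrite /tau !ge_min lexx orbT.
have tauT : 2 * tau <= T by lra.
have taupi : tau <= pi / 2 by lra.
have n0 t : 0 <= t -> t <= 2 * tau ->
    (\int[mu]_(x in W) (`|u x t - u x 0|)%:E <= (e / 3)%:E)%E.
  by move=> t0 t1; apply: near0 => //; rewrite subr0 ger0_norm//; lra.
have nT t : T - tau <= t -> t <= T ->
    (\int[mu]_(x in W) (`|u x t - u x T|)%:E <= (e / 3)%:E)%E.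
  by move=> t0 t1; apply: nearT; [lra|rewrite ltr_norml; apply/andP; split; lra].
have := @dist_le R u xi T M tau (mesh m) m m1 tau0 ms0 tauT ms1 uM um uper uent hT taupi u0
  (e / 3) (ltW e30) n0 nT.
move=> /le_trans; apply; rewrite lee_fin.
have et := soften_le (R := R) m0; have et0 := soften_gt0 (R := R) m0 m1.
apply: (@le_trans _ _ (2 * (e / 3) + C * mesh m)); last by lra.
set ms : R := mesh m in ms0 ms1 mse tau3 et *.
have H1 : (2 * tau + soften m + 2 * ms + ms) * (3 * pi) <= (6 * ms) * (3 * pi).
  by apply: ler_wpM2r; lra.
have H2 : (tau + ms + soften m + (2 + T) * ms) * (2 * pi) <= ((5 + T) * ms) * (2 * pi).
  by apply: ler_wpM2r; lra.
rewrite /C; lra.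
Qed.

End Uniqueness.

(** * ReLU programs *)

Section Programs.
Context {R : realType}.
Local Notation dim := 12%N.
Local Notation vect := 'cV[R]_dim.

Definition dense_layer : Type := 'M[R]_dim * 'cV[R]_dim.
Definition run_layer (v : vect) (l : dense_layer) : vect := relu_mx (l.1 *m v + l.2).
Definition run (prog : seq dense_layer) (v : vect) : vect := foldl run_layer v prog.

Lemma run_cat p q v : run (p ++ q) v = run q (run p v).
Proof. exact: foldl_cat. Qed.

Definition affine (g : vect -> R) : Prop :=
  exists (w : 'rV[R]_dim) (c : R), forall v, g v = (w *m v) ord0 ord0 + c.

Lemma affine_coord (i : 'I_dim) : affine (fun v => v i ord0).
Proof.
exists (delta_mx ord0 i), 0 => v; rewrite addr0 mxE (bigD1 i)//= big1 => [|j ji].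
  by rewrite addr0 mxE !eqxx mul1r.
by rewrite mxE (negbTE ji) andbF mul0r.
Qed.

Lemma affineD g h : affine g -> affine h -> affine (fun v => g v + h v).
Proof.
move=> [w [c gE]] [w' [c' hE]]; exists (w + w'), (c + c') => v.
by rewrite gE hE mulmxDl [in RHS]mxE addrACA.
Qed.

Lemma affineZ a g : affine g -> affine (fun v => a * g v).
Proof.
move=> [w [c gE]]; exists (a *: w), (a * c) => v.
by rewrite gE -scalemxAl [in RHS]mxE mulrDr.
Qed.

Lemma affine_cst c : affine (fun=> c).
Proof. by exists 0, c => v; rewrite mul0mx mxE add0r. Qed.

Lemma affineN g : affine g -> affine (fun v => - g v).
Proof. by move=> /(affineZ (-1)); under eq_fun do rewrite mulN1r. Qed.

Definition vec (s : seq R) : vect := \col_i s`_i.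
Definition coord (k : nat) (v : vect) : R := v (inord k) ord0.

Lemma coord_vec k s : (k < dim)%N -> coord k (vec s) = s`_k.
Proof. by move=> kd; rewrite /coord mxE inordK. Qed.

Lemma nth_affine (gs : seq (vect -> R)) : foldr (fun g P => affine g /\ P) True gs ->
  forall i, affine (nth (fun=> 0) gs i).
Proof.
elim: gs => [_ i|g gs IH [ag ags] [|i]]; [|done|exact: IH].
by rewrite nth_default//; exact: affine_cst.
Qed.

(** Lets a layer be specified by the affine functions its ReLUs act on; the coordinates beyond the
    list are 0, matching the default value in [vec]. *)
Lemma affine_list (gs : seq (vect -> R)) : foldr (fun g P => affine g /\ P) True gs ->
  exists l, forall v, run_layer v l = vec [seq pos (g v) | g <- gs].
Proof.
move=> /nth_affine ga; have [f fP] := choice (fun i : 'I_dim => ga i).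
have [c cP] := choice fP.
exists (\matrix_(i, j) f i ord0 j, \col_i c i) => v; apply/colP => i.
have [ig|ig] := ltnP i (size gs).
  rewrite /run_layer /relu_mx !mxE (nth_map (fun=> 0))// -/(pos _); congr pos.
  rewrite cP mxE; congr (_ + _); apply: eq_bigr => j _; by rewrite mxE.
rewrite /run_layer /relu_mx !mxE [RHS]nth_default ?size_map//.
have := cP i v; rewrite nth_default// => H.
rewrite -[X in Num.max X 0]/(_ + _) (_ : \sum_(_ < _) _ + _ = 0) ?maxxx//.
by rewrite [RHS]H mxE; congr (_ + _); apply: eq_bigr => j _; rewrite mxE.
Qed.

Ltac affine_tac := repeat first
  [ assumption | apply: affineD | apply: affineN | apply: affineZ | exact: affine_coord | exact: affine_cst ].
Ltac affine_list_tac := by repeat (split; [affine_tac|]).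

(* [(E, B, X, Y)] holds the target, the current angle and a unit vector; every layer ends
   with a ReLU, so that [enc] stores positive and negative parts. *)
Definition state : Type := (R * R * R * R)%type.
Definition enc (z : state) : vect := let: (E, B, X, Y) := z in
  vec [:: pos E; pos (- E); pos B; pos (- B); pos X; pos (- X); pos Y; pos (- Y)].

Lemma posB (x : R) : pos x - pos (- x) = x.
Proof. by case: (posP x); case: (posP (- x)) => *; lra. Qed.

Lemma posD (x : R) : pos x + pos (- x) = `|x|.
Proof. by case: (posP x); case: (posP (- x)); case: (ger0P x) => *; lra. Qed.

(** A sign that is exact for all [D >= 0] and for [D <= -2]: a margin is required on the negative
    side alone. *)
Definition clampsign (D : R) : R := pos (2 + D) - pos D - 1.

(* [|v + s| - 1] is [s * v] for [s = 1, -1] and [|v| <= 1] *)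
Definition rotate (cE cB cY delta eta : R) (z : state) : state :=
  let: (E, B, X, Y) := z in
  let s := clampsign (2 / delta * (cE * E + cB * B + cY * Y)) in
  (E, B + s * eta, X * cos eta - sin eta * (`|Y + s| - 1),
   Y * cos eta + sin eta * (`|X + s| - 1)).

(** The layers form the test value, then the sign together with [X + s] and [Y + s], then the
    rotated vector. The second one stores six signed quantities, whence the dimension 12. *)
Lemma rotate_prog cE cB cY delta eta : exists2 prog, size prog = 3%N &
  forall z, run prog (enc z) = enc (rotate cE cB cY delta eta z).
Proof.
pose dE v := coord 0 v - coord 1 v; pose dB v := coord 2 v - coord 3 v.
pose dX v := coord 4 v - coord 5 v; pose dY v := coord 6 v - coord 7 v.
have aE : affine dE by rewrite /dE /coord; affine_tac.
have aB : affine dB by rewrite /dB /coord; affine_tac.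
have aX : affine dX by rewrite /dX /coord; affine_tac.
have aY : affine dY by rewrite /dY /coord; affine_tac.
pose D v := 2 / delta * (cE * dE v + cB * dB v + cY * dY v).
have aD : affine D by apply: affineZ; apply: affineD; [apply: affineD|]; exact: affineZ.
pose sg v := coord 8 v - coord 9 v - 1.
have asg : affine sg by rewrite /sg /coord; affine_tac.
have [l1 H1] := @affine_list [:: dE; (fun v => - dE v); dB; (fun v => - dB v); dX; (fun v => - dX v);
   dY; (fun v => - dY v); (fun v => 2 + D v); D]
  ltac:(affine_list_tac).
pose nB v := dB v + eta * sg v; pose Xs v := dX v + sg v; pose Ys v := dY v + sg v.
have anB : affine nB by apply: affineD => //; exact: affineZ.
have aXs : affine Xs by exact: affineD.
have aYs : affine Ys by exact: affineD.
have [l2 H2] := @affine_list [:: dE; (fun v => - dE v); nB; (fun v => - nB v); dX; (fun v => - dX v);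
   dY; (fun v => - dY v); Xs; (fun v => - Xs v); Ys; (fun v => - Ys v)]
  ltac:(affine_list_tac).
pose X' v := cos eta * dX v + - sin eta * (coord 10 v + coord 11 v - 1).
pose Y' v := cos eta * dY v + sin eta * (coord 8 v + coord 9 v - 1).
have aX' : affine X'.
  by apply: affineD; apply: affineZ => //; rewrite /coord; affine_tac.
have aY' : affine Y'.
  by apply: affineD; apply: affineZ => //; rewrite /coord; affine_tac.
have [l3 H3] := @affine_list [:: dE; (fun v => - dE v); dB; (fun v => - dB v); X'; (fun v => - X' v);
   Y'; (fun v => - Y' v)]
  ltac:(affine_list_tac).
exists [:: l1; l2; l3] => // -[[[E B] X] Y].
rewrite /run /= H1 /= /D /dE /dB /dX /dY !coord_vec//= !posB.
set d := 2 / delta * _.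
rewrite H2 /= /nB /Xs /Ys /sg /dE /dB /dX /dY !coord_vec//= !posB -/(clampsign d).
rewrite H3 /= /X' /Y' /dE /dB /dX /dY !coord_vec//= !posB !posD -/d.
by congr (vec [:: _; _; pos _; pos _; pos _; pos _; pos _; pos _]); ring.
Qed.

(** The link between the sweeps: minus the angle found by the first becomes the target of the
    second, and angle and vector are reset. *)
Lemma affine_prog (cB cX cY : R) :
  exists l, forall E B X Y, run_layer (enc (E, B, X, Y)) l = enc (- B, cB, cX, cY).
Proof.
pose dB v := coord 2 v - coord 3 v.
have aB : affine dB by rewrite /dB /coord; affine_tac.
have [l H] := @affine_list [:: (fun v => - dB v); dB; (fun=> cB); (fun=> - cB); (fun=> cX); (fun=> - cX);
   (fun=> cY); (fun=> - cY)]
  ltac:(affine_list_tac).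
exists l => E B X Y; rewrite H /= /dB !coord_vec//= !posB opprK.
by [].
Qed.

(** The output is [Y] clipped to [[-1, 1]], hence bounded even where the sweeps go wrong. A third
    unit holds the constant 1, because [Q] is linear. *)
Lemma readout_prog : exists l (Q : 'rV[R]_dim), forall E B X Y,
  (Q *m run_layer (enc (E, B, X, Y)) l) ord0 ord0 = pos (Y + 1) - pos (Y - 1) - 1.
Proof.
pose dY v := coord 6 v - coord 7 v.
have aY : affine dY by rewrite /dY /coord; affine_tac.
have [l H] := @affine_list [:: (fun v => dY v + 1); (fun v => dY v + -1); (fun=> 1)]
  ltac:(affine_list_tac).
exists l, (\row_i [:: 1; -1; -1 : R]`_i) => E B X Y.
rewrite H mxE /= !big_ord_recl big_ord0 !mxE /= /dY !coord_vec//= !posB.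
have -> : pos (1 : R) = 1 by case: (posP (1 : R)) => *; lra.
by ring.
Qed.

Definition sweep (cE cB cY delta eta0 : R) n (z : state) : state :=
  foldl (fun z k => rotate cE cB cY delta (eta0 / 2 ^+ k) z) z (iota 0 n).

Lemma sweepS cE cB cY delta eta0 n z : sweep cE cB cY delta eta0 n.+1 z =
  rotate cE cB cY delta (eta0 / 2 ^+ n) (sweep cE cB cY delta eta0 n z).
Proof. by rewrite /sweep -[n.+1]addn1 iotaD foldl_cat. Qed.

Lemma sweep_prog cE cB cY delta eta0 n : exists2 prog, size prog = (3 * n)%N &
  forall z, run prog (enc z) = enc (sweep cE cB cY delta eta0 n z).
Proof.
elim: n => [|n [p sp pE]]; first by exists [::].
have [q sq qE] := rotate_prog cE cB cY delta (eta0 / 2 ^+ n).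
exists (p ++ q); first by rewrite size_cat sp sq mulnS addnC.
by move=> z; rewrite run_cat pE qE sweepS.
Qed.

End Programs.

(** * Bisection by rotations *)

Section Sweeps.
Context {R : realType}.
Implicit Types (T a b x y phi theta eta delta : R) (i j : int) (n k m : nat).

Lemma clampsign_ge0 x : 0 <= x -> clampsign x = 1.
Proof. by move=> x0; rewrite /clampsign; case: (posP x); case: (posP (2 + x)) => *; lra. Qed.

Lemma clampsign_le x : x <= -2 -> clampsign x = -1.
Proof. by move=> x0; rewrite /clampsign; case: (posP x); case: (posP (2 + x)) => *; lra. Qed.

Lemma rotate_ge0 cE cB cY delta eta E B theta : 0 < delta ->
  0 <= cE * E + cB * B + cY * sin theta ->
  rotate cE cB cY delta eta (E, B, cos theta, sin theta) =
  (E, B + eta, cos (theta + eta), sin (theta + eta)).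
Proof.
move=> d0 D0; rewrite /rotate clampsign_ge0; last by rewrite mulr_ge0// divr_ge0// ltW.
have := sin_geN1 theta; have := cos_geN1 theta => c1 s1.
rewrite ger0_norm; last lra.
rewrite ger0_norm; last lra.
by rewrite cosD sinD; congr (_, _, _, _); ring.
Qed.

Lemma rotate_le cE cB cY delta eta E B theta : 0 < delta ->
  cE * E + cB * B + cY * sin theta <= - delta ->
  rotate cE cB cY delta eta (E, B, cos theta, sin theta) =
  (E, B - eta, cos (theta - eta), sin (theta - eta)).
Proof.
move=> d0 D0; rewrite /rotate clampsign_le; last first.
  by rewrite mulrAC ler_pdivrMr// mulNr -mulrN ler_pM2l.
have := sin_le1 theta; have := cos_le1 theta => c1 s1.
rewrite ler0_norm; last lra.
rewrite ler0_norm; last lra.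
by rewrite cosB sinB; congr (_, _, _, _); ring.
Qed.

Lemma halving_gap eta y : `|y| <= 2 * eta ->
  (0 <= y -> `|y - eta| <= eta) /\ (y <= 0 -> `|y + eta| <= eta).
Proof. by rewrite !ler_norml => /andP[? ?]; split=> ?; apply/andP; split; lra. Qed.

Lemma exp2_split n k : (k <= n)%N -> (2 ^+ n : R) = 2 ^+ k * 2 ^+ (n - k).
Proof. by move=> kn; rewrite -exprD subnKC. Qed.

Definition off_grid n delta phi := forall i, delta <= `|phi + i%:~R * (pi / 2 ^+ n)|.

Lemma off_grid_le n k delta phi i : (k <= n)%N -> off_grid n delta phi ->
  delta <= `|phi + i%:~R * (pi / 2 ^+ k)|.
Proof.
move=> kn /(_ (i * 2 ^+ (n - k))); rewrite intrM (exp2_split kn).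
have e0 m : (2 ^+ m : R) != 0 by rewrite expf_neq0.
have -> : ((2 ^+ (n - k) : int)%:~R : R) = 2 ^+ (n - k) by rewrite rmorphXn.
rewrite (_ : i%:~R * 2 ^+ (n - k) * _ = i%:~R * (pi / 2 ^+ k))//.
by field; rewrite !e0.
Qed.

Lemma sin_separated delta theta : 0 < delta -> delta <= pi / 2 ->
  delta <= theta -> theta <= pi - delta -> sin delta <= sin theta.
Proof.
move=> d0 d1 t0 t1; have := pi_gt0 R => p0.
have [t2|t2] := leP theta (pi / 2); first by apply: le_sin_half; lra.
have -> : sin theta = sin (pi - theta) by rewrite sinB sinpi cospi mul0r; lra.
by apply: le_sin_half; lra.
Qed.

(** The vector has angle [phi + B], and its sine tells the side of 0. Since the sine also vanishes
    at [pi], a positive residual must stay away from both 0 and [pi], and [off_grid] is used twice.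
    In the end [- B] is a grid angle close to [phi]. *)
Lemma sweep_phase n delta phi : 0 < delta -> delta <= pi / 2 -> `|phi| <= pi ->
  off_grid n delta phi -> forall k, (k <= n)%N -> exists B, [/\
  sweep 0 0 (-1) (sin delta) (pi / 2) k (0, 0, cos phi, sin phi) =
    (0, B, cos (phi + B), sin (phi + B)), `|phi + B| <= pi / 2 ^+ k,
  `|B| <= pi - pi / 2 ^+ k & exists i, B = i%:~R * (pi / 2 ^+ k)].
Proof.
move=> d0 d1 phi1 good; have p0 := pi_gt0 R; elim=> [_|k IH kn].
  exists 0; split; rewrite ?addr0// ?expr0 ?divr1// ?normr0 ?subrr//.
  by exists 0; rewrite mul0r.
have [B [E H1 H2 [i BE]]] := IH (ltnW kn).
have sd : 0 < sin delta by apply: sin_gt0_pi; rewrite d0/=; lra.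
have e0 : (2 ^+ k : R) != 0 by rewrite expf_neq0.
have etaE : pi / 2 / 2 ^+ k = pi / 2 ^+ k.+1 :> R by rewrite exprS; field.
have eta2 : pi / 2 ^+ k = 2 * (pi / 2 ^+ k.+1) :> R by rewrite exprS; field.
have eta0 : 0 < pi / 2 ^+ k.+1 :> R by rewrite divr_gt0// exprn_gt0.
have etapi : pi / 2 ^+ k <= pi :> R.
  by rewrite ler_pdivrMr ?exprn_gt0// ler_peMr ?(ltW p0)// exprn_ege1// ler1n.
rewrite sweepS E etaE; move: H1 H2; rewrite eta2 => H1 H2.
set eta := pi / 2 ^+ k.+1 in H1 H2 eta0 eta2 *.
have [G1 G2] := halving_gap H1.
have [t0|t0] := leP (phi + B) 0.
  have st : sin (phi + B) <= 0.
    rewrite -oppr_ge0 -sinN; apply: sin_ge0_pi.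
    by move: H1; rewrite ler_norml => /andP[? ?]; apply/andP; split; lra.
  exists (B + eta); rewrite addrA; split; [|exact: G2| |].
  - by apply: rotate_ge0 => //; lra.
  - by apply: (le_trans (ler_normD _ _)); rewrite (gtr0_norm eta0); lra.
  - by exists (2 * i + 1); rewrite BE eta2 intrD intrM; ring.
have st : sin delta <= sin (phi + B).
  apply: sin_separated => //.
    by have := off_grid_le i (ltnW kn) good; rewrite -BE gtr0_norm.
  (* Lowering the index by [2 ^+ k] subtracts [pi] from [B]. *)
  have := off_grid_le (i - 2 ^+ k) (ltnW kn) good.
  have -> : (i - 2 ^+ k)%:~R * (pi / 2 ^+ k) = B - pi :> R.
    by rewrite BE intrB rmorphXn/=; field.
  by rewrite addrA ler0_norm; move: H1; rewrite ler_norml => /andP[? ?]; lra.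
exists (B - eta); rewrite addrA; split; [|exact/G1/ltW| |].
- by apply: rotate_le => //; lra.
- by apply: (le_trans (ler_normB _ _)); rewrite (gtr0_norm eta0); lra.
- by exists (2 * i - 1); rewrite BE eta2 intrB intrM; ring.
Qed.

Definition separated T n delta := forall i j,
  let A := i%:~R * (pi / 2 ^+ n) in let B := j%:~R * (pi / 2 / 2 ^+ n) in
  `|A| <= pi -> `|B| <= pi / 2 -> A - B - T * sin B < 0 ->
  A - B - T * sin B <= - delta.

Lemma seq_gap (s : seq R) : exists2 delta, 0 < delta & {in s, forall x, x < 0 -> x <= - delta}.
Proof.
elim: s => [|a s [delta d0 H]]; first by exists 1.
have [a0|a0] := ltP a 0.
  exists (Num.min delta (- a)); first by rewrite lt_min d0 oppr_gt0.
  move=> x; rewrite inE lerNr ge_min => /predU1P[->|xs] x0; first by rewrite lexx orbT.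
  by have := H _ xs x0; rewrite lerNr => ->.
exists delta => // x; rewrite inE => /predU1P[->|xs] x0; [lra|exact: H].
Qed.

Lemma index_range n i a : 0 < a -> `|i%:~R * (a / 2 ^+ n)| <= a ->
  exists2 m, m \in iota 0 (2 ^ n.+1).+1 & i = m%:Z - 2 ^+ n.
Proof.
move=> a0; have e0 : 0 < (2 ^+ n : R) by rewrite exprn_gt0.
rewrite normrM (gtr0_norm (divr_gt0 a0 e0)) mulrCA ger_pMr// ler_pdivrMr// mul1r.
have -> : (2 ^+ n : R) = (2 ^+ n : int)%:~R by rewrite rmorphXn.
rewrite -intr_norm ler_int => H; exists (absz (i + 2 ^+ n)); last first.
  rewrite gez0_abs ?addrK//; lia.
rewrite mem_iota /=.
have : (absz (i + 2 ^+ n))%:Z <= 2 ^+ n.+1.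
  by rewrite exprS gez0_abs; lia.
have -> : (2 ^+ n.+1 : int) = (2 ^ n.+1)%N by rewrite -natrX natz.
lia.
Qed.

Lemma exists_separated T n : exists2 delta, 0 < delta & separated T n delta.
Proof.
pose A i : R := i%:~R * (pi / 2 ^+ n); pose B j : R := j%:~R * (pi / 2 / 2 ^+ n).
pose f i j := A i - B j - T * sin (B j); pose r := iota 0 (2 ^ n.+1).+1.
have [delta d0 H] := seq_gap
  [seq f (p%:Z - 2 ^+ n) (q%:Z - 2 ^+ n) | p <- r, q <- r].
exists delta => // i j /= Ai Bj; have p0 := pi_gt0 R.
have [p pr ->] := index_range p0 Ai.
have [q qr ->] := index_range (divr_gt0 p0 (ltr0Sn _ 1)) Bj.
by apply: H; apply/allpairsP; exists (p, q).
Qed.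

(** As [y + T * sin y] increases, the sign of [A - B - T * sin B] tells on which side of [B] the
    solution lies, and [sin B] is read off the vector. Both [A] and [B] stay on their grids, so
    [separated] supplies the margin. *)
Lemma sweep_profile T n delta A y : 0 < T -> 0 < delta -> separated T n delta ->
  `|A| <= pi -> (exists i, A = i%:~R * (pi / 2 ^+ n)) ->
  - (pi / 2) <= y -> y <= pi / 2 -> y + T * sin y = A ->
  forall k, (k <= n)%N -> exists B, [/\
  sweep 1 (-1) (-T) delta (pi / 4) k (A, 0, 1, 0) = (A, B, cos B, sin B),
  `|y - B| <= pi / 2 / 2 ^+ k,
  `|B| <= pi / 2 - pi / 2 / 2 ^+ k & exists j, B = j%:~R * (pi / 2 / 2 ^+ k)].
Proof.
move=> T0 d0 sep A1 [i AE] y0 y1 yA; have p0 := pi_gt0 R; elim=> [_|k IH kn].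
  exists 0; rewrite sin0 cos0 expr0 divr1 subr0 normr0 subrr ler_norml y0 y1.
  by split=> //; exists 0; rewrite mul0r.
have [B [E H1 H2 [j BE]]] := IH (ltnW kn).
have e0 m : (2 ^+ m : R) != 0 by rewrite expf_neq0.
have etaE : pi / 4 / 2 ^+ k = pi / 2 / 2 ^+ k.+1 :> R by rewrite exprS; field.
have eta2 : pi / 2 / 2 ^+ k = 2 * (pi / 2 / 2 ^+ k.+1) :> R by rewrite exprS; field.
have eta0 : 0 < pi / 2 / 2 ^+ k.+1 :> R by rewrite !divr_gt0// exprn_gt0.
have H3 : `|B| <= pi / 2 by apply: (le_trans H2); rewrite gerBl !divr_ge0// ?ltW// exprn_ge0.
rewrite sweepS E etaE; move: H1 H2; rewrite eta2 => H1 H2.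
set eta := pi / 2 / 2 ^+ k.+1 in H1 H2 eta0 eta2 *.
have [G1 G2] := halving_gap H1.
move: (H3); rewrite ler_norml => /andP[B0 B1].
have [D0|D0] := ltP (A - B - T * sin B) 0; last first.
  have yB : B <= y.
    rewrite leNgt; apply/negP => yB.
    have : T * sin y <= T * sin B by rewrite ler_pM2l// le_sin_half// ltW.
    lra.
  exists (B + eta); rewrite opprD addrA; split.
  - by apply: rotate_ge0 => //; lra.
  - by apply: G1; rewrite subr_ge0.
  - by apply: (le_trans (ler_normD _ _)); rewrite (gtr0_norm eta0); lra.
  - by exists (2 * j + 1); rewrite BE eta2 intrD intrM; ring.
have yB : y <= B.
  rewrite leNgt; apply/negP => yB.
  have : T * sin B <= T * sin y by rewrite ler_pM2l// le_sin_half// ltW.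
  lra.
have D1 : A - B - T * sin B <= - delta.
  have BE' : B = (j * 2 ^+ (n - k))%:~R * (pi / 2 / 2 ^+ n).
    rewrite BE intrM (exp2_split (ltnW kn)) rmorphXn/=.
    by field; rewrite !e0.
  by move: (sep i (j * 2 ^+ (n - k))); rewrite /= -AE -BE'; apply.
exists (B - eta); rewrite opprB addrCA addrC; split.
- by apply: rotate_le => //; lra.
- by apply: G2; rewrite subr_le0.
- by apply: (le_trans (ler_normB _ _)); rewrite (gtr0_norm eta0); lra.
- by exists (2 * j - 1); rewrite BE eta2 intrB intrM; ring.
Qed.

(** Two sweeps of [3 * n] layers, a link and a readout. The first sweep moves [phi] by at most
    [pi / 2 ^+ n], which the 1-Lipschitz profile does not enlarge; the second adds at most
    [pi / 2 / 2 ^+ n]. *)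
Lemma profile_prog T n delta : pi < T -> 0 < delta -> delta <= pi / 2 ->
  exists (prog : seq dense_layer) (Q : 'rV[R]_12), [/\ size prog = (6 * n + 2)%N,
    forall z, `|(Q *m run prog (enc z)) ord0 ord0| <= 1 &
    forall phi, `|phi| <= pi -> off_grid n delta phi ->
      `|(Q *m run prog (enc (0, 0, cos phi, sin phi))) ord0 ord0 - profile T phi|
        <= 2 * pi / 2 ^+ n].
Proof.
move=> hT d0 d1; have p0 := pi_gt0 R; have T0 := lt_trans p0 hT.
have [delta' d'0 sep] := exists_separated T n.
have [p1 s1 E1] := sweep_prog 0 0 (-1) (sin delta) (pi / 2) n.
have [l2 E2] := @affine_prog R 0 1 0.
have [p3 s3 E3] := sweep_prog 1 (-1) (- T) delta' (pi / 4) n.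
have [l4 [Q E4]] := @readout_prog R.
exists (p1 ++ l2 :: p3 ++ [:: l4]), Q; split.
- by rewrite size_cat/= size_cat/= s1 s3; lia.
- move=> z; rewrite run_cat E1 /run /= foldl_cat/=.
  case: (sweep _ _ _ _ _ _ _) => [[[E B] X] Y].
  rewrite E2 -/(run p3 _) E3; case: (sweep _ _ _ _ _ _ _) => [[[E' B'] X'] Y'].
  by rewrite E4 ler_norml; case: (posP (Y' + 1)); case: (posP (Y' - 1)) => *; apply/andP; split; lra.
move=> phi phi1 good.
have [B [E H1 H2 [i BE]]] := sweep_phase d0 d1 phi1 good (leqnn n).
have e0 : 0 < pi / 2 ^+ n :> R by rewrite divr_gt0// exprn_gt0.
have B1 : `|- B| <= pi by rewrite normrN; lra.
have [y [y0 y1 ysin yB]] := profileP hT B1.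
have BE' : exists i, - B = i%:~R * (pi / 2 ^+ n) by exists (- i); rewrite BE intrN mulNr.
have [B' [E' H1' _ _]] := sweep_profile T0 d'0 sep B1 BE' y0 y1 yB (leqnn n).
rewrite run_cat E1 E /run /= foldl_cat/= E2 -/(run p3 _) E3 E' E4.
have -> : pos (sin B' + 1) - pos (sin B' - 1) - 1 = sin B'.
  have := sin_geN1 B'; have := sin_le1 B' => *.
  by case: (posP (sin B' + 1)); case: (posP (sin B' - 1)) => *; lra.
rewrite -(subrK (profile T (- B)) (sin B')) -addrA.
apply: (le_trans (ler_normD _ _)).
have F1 : `|sin B' - profile T (- B)| <= pi / 2 / 2 ^+ n.
  by rewrite ysin; apply: (le_trans (sin_lipschitz _ _)); rewrite distrC.
have F2 : `|profile T (- B) - profile T phi| <= pi / 2 ^+ n.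
  by apply: (le_trans (profile_lipschitz hT _ _)); rewrite -opprD normrN addrC.
move: F1 F2; rewrite -!mulrA (mulrC 2^-1) !mulrA.
set q := pi / 2 ^+ n in e0 *; move: (`|_|) (`|_|) => a b *.
have -> : 2 * pi / 2 ^+ n = 2 * q by rewrite /q mulrA.
lra.
Qed.

End Sweeps.

(** * Compilation to a Fourier neural operator *)

Section Network.
Context {R : realType}.
Implicit Types (x a c xi : R) (s : seq R).

Definition col0_mx s : 'M[R]_12 := \matrix_(i, j) (if j == ord0 then s`_i else 0).

Lemma mul_col0_mx s (v : 'cV[R]_12) : col0_mx s *m v = v ord0 ord0 *: vec s.
Proof.
apply/colP => i; rewrite !mxE (bigD1 ord0)//= big1 => [|j /negbTE j0].
  by rewrite mxE eqxx addr0 mulrC.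
by rewrite mxE j0 mul0r.
Qed.

(* In the Fourier data the index 1 is the wave number 0 and the index 2 the wave number 1.
   Layer 0 convolves the datum with [sin], which shifts its phase by a quarter period. *)
Definition profile_fno (prog : seq (dense_layer (R := R))) (Q : 'rV[R]_12) : FNO R :=
  let layer (l : 'I_(size prog).+1) := nth (0, 0) prog l.-1 in
  MkFNO 12 1 2 (size prog).+1
    (\matrix_(i, j) (if j == ord0 then [:: 1; -1]`_i else 0)) 0
    (\matrix_(i, j) (if i == ord0 then [:: 1; -1]`_j else 0)) 0
    (fun l => if l == ord0 then col0_mx [:: 0; 0; 0; 0; 0; 0; 1; -1] else (layer l).1)
    (fun _ _ => 0)
    (fun l i => if (l == ord0) && (val i == 2%N) then col0_mx [:: 0; 0; 0; 0; 2; -2] else 0)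
    (fun l i => if (l != ord0) && (val i == 1%N) then (layer l).2 else 0)
    (fun _ _ => 0) Q.

(** Per layer: [144] for the matrix, [3 * 288] for the complex multipliers and [3 * 24] for the
    complex biases. *)
Lemma size_profile_fno prog Q : fno_size (profile_fno prog Q) = (54 + 1080 * (size prog).+1)%N.
Proof. rewrite /fno_size /profile_fno; cbn [fno_dv fno_kmax fno_width fno_depth]; lia. Qed.

Section Evaluation.
Variables (prog : seq (dense_layer (R := R))) (Q : 'rV[R]_12) (N : nat).
Let net := profile_fno prog Q.

Lemma fno_lift_profile a x : fno_lift net a x = vec [:: a] :> 'cV[R]_12.
Proof.
apply/colP => i; rewrite !mxE !big_ord_recl big_ord0 !mxE !big_ord_recl !big_ord0 !mxE /=.
have [->|i0] := eqVneq i ord0.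
  have -> : 1 * a + (0 * trep x + 0) + 0 = a by ring.
  have -> : -1 * a + (0 * trep x + 0) + 0 = - a by ring.
  by have := posB a; rewrite /pos /= => E; rewrite -[RHS]E; ring.
rewrite !mul0r !addr0; case: i i0 => -[|i]//= _ _.
by rewrite nth_nil.
Qed.

Lemma fno_layerS (i : 'I_(size prog)) (v : R -> 'cV[R]_12) x :
  fno_layer (net := net) N (lift ord0 i) v x = run_layer (v x) (nth (0, 0) prog i).
Proof.
rewrite /fno_layer /run_layer; congr (relu_mx _).
have -> : fno_K N (lift ord0 i : 'I_(fno_depth net)) v x = 0.
  by rewrite /fno_K big1// => k _; rewrite /= !mul0mx subr0.
rewrite addr0 /=; congr (_ *m _ + _).
rewrite /fno_bias (bigD1 (Ordinal (isT : (1 < 2 * 1 + 1)%N)))//= big1 => [|k /negbTE k1].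
  by rewrite /wnum /= subrr mul0r cos0 scale1r scaler0 subr0 addr0.
by rewrite [val k == _]k1 !scaler0 subr0.
Qed.

Lemma fno_layers (ls : seq 'I_(size prog)) (v : R -> 'cV[R]_12) x :
  foldl (fun v l => fno_layer (net := net) N l v) v [seq lift ord0 i | i <- ls] x =
  run [seq nth (0, 0) prog (val i) | i <- ls] (v x).
Proof. by elim: ls v => //= i ls IH v; rewrite IH fno_layerS. Qed.

(** The sum [c] is the discrete convolution with the sine. The weights 2 and -2 undo the factor 1/2
    of [grid_convolution], and their signs are reversed because [fno_K] subtracts the sine part. *)
Lemma fno_layer0 (f : R -> R) x :
  let c := N%:R^-1 * \sum_(j < N) sin (x - grid R j) * f (grid R j) in
  fno_layer (net := net) N ord0 (fun y => vec [:: f y]) x =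
  vec [:: 0; 0; 0; 0; pos (- 2 * c); pos (2 * c); pos (f x); pos (- f x)].
Proof.
move=> c; rewrite /fno_layer.
have -> : fno_bias (ord0 : 'I_(fno_depth net)) x = 0.
  by rewrite /fno_bias big1// => k _; rewrite /= !scaler0 subr0.
rewrite addr0 /fno_K (bigD1 (Ordinal (isT : (2 < 2 * 1 + 1)%N)))//= [X in _ + (_ + X)]big1 => [|k /negbTE k1]; last first.
  by rewrite [val k == _]k1 !mul0mx subr0.
rewrite addr0 mul0mx sub0r !mul_col0_mx.
have -> : (N%:R^-1 *: \sum_(j < N) sin (wnum (net := net) (Ordinal (isT : (2 < 2 * 1 + 1)%N)) *
     (x - grid R j)) *: vec [:: f (grid R j)]) ord0 ord0 = c.
  rewrite mxE summxE; congr (_ * _); apply: eq_bigr => j _.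
  by rewrite !mxE /wnum /= (_ : 2%:R - 1%:R = 1) ?mul1r//; lra.
apply/colP => i; rewrite !mxE /=; case: i => i /=.
do 4 (case: i => [_|i] /=; first by rewrite !mulr0 subr0 maxxx).
do 4 (case: i => [_|i] /=; first by congr (Num.max _ 0); ring).
by move=> _; rewrite ?nth_nil ?mulr0 ?subr0 ?maxxx.
Qed.

Lemma fno_eval_profile (f : R -> R) x :
  let c := N%:R^-1 * \sum_(j < N) sin (x - grid R j) * f (grid R j) in
  fno_eval net N f x = (Q *m run prog (enc (0, 0, - 2 * c, f x))) ord0 ord0.
Proof.
move=> c; rewrite /fno_eval; congr ((_ *m _) _ _).
have -> : (fun y => fno_lift net (f y) y) = (fun y => vec [:: f y]) :> (R -> 'cV[R]_12).
  by apply: funext => y; exact: fno_lift_profile.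
rewrite [enum _]enum_ordSl /=.
have := fno_layers (enum 'I_(size prog)); rewrite /= => ->.
have pos0 : pos 0 = 0 :> R by rewrite /pos maxxx.
rewrite fno_layer0 -/c /enc oppr0 pos0 -[- (-2 * c)]mulNr opprK; congr run.
by rewrite -[RHS](mkseq_nth (0, 0)) /mkseq -val_enum_ord -map_comp.
Qed.

End Evaluation.

(* [N >= 3] excludes aliasing of the wave number 2. *)
Lemma sum_cos_grid N c : (3 <= N)%N -> \sum_(j < N) cos (c - 2 * grid R j) = 0.
Proof.
move=> N3; have p0 := pi_gt0 R; pose h : R := 2 * pi / N%:R.
have NR : 3 <= N%:R :> R by rewrite (ler_nat R 3 N).
have N0 : N%:R != 0 :> R by rewrite gt_eqF//; lra.
have h0 : 0 < h by apply: divr_gt0; lra.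
have hpi : h < pi by rewrite ltr_pdivrMr; nra.
have sh : 0 < sin h by apply: sin_gt0_pi; rewrite h0.
(* Multiplied by [2 * sin h], each term is a difference of sines and the sum telescopes;
   [0 < h < pi] makes this factor nonzero. *)
suff H m : 2 * sin h * \sum_(j < m) cos (c - 2 * (h * j.+1%:R)) =
    sin (c - h) - sin (c - h - 2 * (h * m%:R)).
  have : 2 * sin h * \sum_(j < N) cos (c - 2 * grid R j) = 0.
    rewrite (eq_bigr (fun j : 'I_N => cos (c - 2 * (h * j.+1%:R)))); last first.
      by move=> j _; congr (cos (c - 2 * _)); rewrite /grid /h; field.
    (* Around the grid the argument makes two full turns. *)
    rewrite H (_ : 2 * (h * N%:R) = pi *+ 2 + pi *+ 2); last by rewrite /h; field.
    by rewrite opprD addrA -[X in _ - X]sinD2pi subrK -[X in _ - X]sinD2pi subrK subrr.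
  by move/eqP; rewrite !mulf_eq0 pnatr_eq0/= gt_eqF//= => /eqP.
elim: m => [|m IH]; first by rewrite big_ord0 !mulr0 subr0 subrr.
rewrite big_ord_recr/= mulrDr IH -[m.+1%:R]natr1.
set a := c - 2 * (h * (m%:R + 1)).
have -> : c - h - 2 * (h * m%:R) = a + h by rewrite /a; ring.
have -> : c - h - 2 * (h * (m%:R + 1)) = a - h by rewrite /a; ring.
by rewrite [sin (a + h)]sinD [sin (a - h)]sinB; ring.
Qed.

(** By the product formula, [sin (x - y) * ubar xi y] is a constant in [y] plus a wave of number 2,
    which averages to 0 on the grid. *)
Lemma grid_convolution N x xi : (3 <= N)%N ->
  N%:R^-1 * \sum_(j < N) sin (x - grid R j) * ubar xi (grid R j) = cos (x - xi) / 2.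
Proof.
move=> N3; have N0 : N%:R != 0 :> R by rewrite pnatr_eq0; case: N N3.
have E y : sin (x - y) * ubar xi y = cos (x - xi) / 2 - cos (x + xi - 2 * y) / 2.
  rewrite /ubar (_ : x - xi = (x - y) + (y - xi)); last by ring.
  rewrite (_ : x + xi - 2 * y = (x - y) - (y - xi)); last by ring.
  by rewrite [cos (x - y + _)]cosD [cos (x - y - _)]cosB; field.
under eq_bigr do rewrite E.
rewrite big_split/= sumrN -[X in _ - X]mulr_suml sum_cos_grid// mul0r oppr0 addr0.
by rewrite sumr_const card_ord -mulr_natl; field.
Qed.

Lemma fno_eval_ubar prog Q N xi x phi : (3 <= N)%N -> cos phi = - cos (x - xi) ->
  sin phi = - sin (x - xi) ->
  fno_eval (profile_fno prog Q) N (ubar xi) x =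
  (Q *m run prog (enc (0, 0, cos phi, sin phi))) ord0 ord0.
Proof.
move=> N3 cE sE; rewrite fno_eval_profile grid_convolution// cE sE /ubar.
by congr ((_ *m run _ (enc (_, _, _, _))) _ _); field.
Qed.

End Network.

(** * The error estimate *)

Section Estimate.
Context {R : realType}.
Implicit Types (x y xi p phi delta eps : R) (n m : nat).
Local Notation mu := (@lebesgue_measure R).

(** For [x] and [xi] in [[0, 2 * pi]], one of these shifts of [xi] brings the shock within [pi] of
    [x]. *)
Definition periods : seq R := [:: 0; 2 * pi; - (2 * pi)].

Lemma sin_period y p : p \in periods -> sin (y - p) = sin y.
Proof.
have P (z : R) : sin (z + 2 * pi) = sin z by rewrite mulr_natl sinD2pi.
rewrite !inE => /or3P[] /eqP ->; rewrite ?subr0// ?opprK//.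
by rewrite -(P (y - 2 * pi)) subrK.
Qed.

Lemma cos_period y p : p \in periods -> cos (y - p) = cos y.
Proof.
have P (z : R) : cos (z + 2 * pi) = cos z by rewrite mulr_natl cosD2pi.
rewrite !inE => /or3P[] /eqP ->; rewrite ?subr0// ?opprK//.
by rewrite -(P (y - 2 * pi)) subrK.
Qed.

Lemma ubar_period xi p : p \in periods -> ubar (xi + p) = ubar xi.
Proof.
by move=> pp; apply: funext => x; rewrite /ubar -(sin_period (x - xi) pp) -addrA -opprD.
Qed.

(** The bad positions [x] for a given [xi]. From [|x - xi| <= 2 * pi] the grid angles concerned are
    at most [4 * pi], so the indices run from [- 2 ^+ n.+2] to [2 ^+ n.+2]. *)
Definition node_ball n delta xi m : set R :=
  let y := xi - (m%:Z - 2 ^+ n.+2)%:~R * (pi / 2 ^+ n) in `[y - delta, y + delta].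

Lemma node_ball_cover n delta x xi i : delta <= pi / 2 -> `|x - xi| <= 2 * pi ->
  `|x - xi + i%:~R * (pi / 2 ^+ n)| < delta ->
  exists2 m, m \in iota 0 (2 ^ n.+3).+1 & node_ball n delta xi m x.
Proof.
move=> d1 x1 xd; have p0 := pi_gt0 R.
have nE : pi / 2 ^+ n = 4 * pi / 2 ^+ n.+2 :> R by rewrite !exprS; field.
have : `|i%:~R * (4 * pi / 2 ^+ n.+2)| <= 4 * pi :> R.
  rewrite -nE -(addKr (x - xi) (i%:~R * _)) addrC.
  apply: (le_trans (ler_normB _ _)); lra.
move=> /(@index_range R n.+2 i (4 * pi))[|m mi iE]; first lra.
exists m => //; move: xd; rewrite iE /node_ball /= in_itv/= ltr_norml => /andP[? ?].
by apply/andP; split; lra.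
Qed.

Lemma le_sum_mem (I : eqType) (s : seq I) (F : I -> \bar R) (i : I) :
  (forall j, 0 <= F j)%E -> i \in s -> (F i <= \sum_(j <- s) F j)%E.
Proof. by move=> F0 si; rewrite (big_rem i)//= leeDl// sume_ge0. Qed.

Lemma integral_patch_le (D W : set R) (f : R -> \bar R) : measurable D -> measurable W ->
  measurable_fun setT f -> (forall x, 0 <= f x)%E ->
  (\int[mu]_(x in D) (f \_ W) x <= \int[mu]_(x in W) f x)%E.
Proof.
move=> mD mW mf f0; rewrite -integral_mkcondr.
apply: ge0_subset_integral => //; first exact: measurableI.
exact: measurable_funTS.
Qed.

Lemma measurable_patch (W : set R) (f : R -> \bar R) : measurable W ->
  measurable_fun setT f -> measurable_fun setT (f \_ W).
Proof. by move=> mW mf; apply/(measurable_restrictT f mW); exact: measurable_funTS. Qed.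

Variables (T : R) (n : nat) (delta : R).
Hypotheses (hT : pi < T) (d0 : 0 < delta) (d1 : delta <= pi / 2).
Variables (prog : seq (dense_layer (R := R))) (Q : 'rV[R]_12).
Hypothesis prog_le1 : forall z, `|(Q *m run prog (enc z)) ord0 ord0| <= 1.
Hypothesis prog_profile : forall phi, `|phi| <= pi -> off_grid n delta phi ->
  `|(Q *m run prog (enc (0, 0, cos phi, sin phi))) ord0 ord0 - profile T phi|
    <= 2 * pi / 2 ^+ n.

Let netval N xi x := fno_eval (profile_fno prog Q) N (ubar xi) x.

(** On the bad set both functions are bounded by 1. The total shift [p + s * pi] is a multiple of
    [pi], hence on the grid, so the same balls serve all periods and both sides of the shock. *)
Lemma profile_fno_pointwise N xi x : (3 <= N)%N -> 0 <= x <= 2 * pi -> 0 <= xi <= 2 * pi ->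
  exists p, [/\ p \in periods, `[xi + p - pi, xi + p + pi]%classic x &
    `|shock_profile T (x - (xi + p)) - netval N xi x| <= 2 * pi / 2 ^+ n \/
    exists2 m, m \in iota 0 (2 ^ n.+3).+1 & node_ball n delta xi m x /\
      `|shock_profile T (x - (xi + p)) - netval N xi x| <= 2].
Proof.
move=> N3 /andP[x0 x1] /andP[xi0 xi1]; have p0 := pi_gt0 R.
have [p pp /andP[xp0 xp1]] : exists2 p, p \in periods & xi + p - pi <= x <= xi + p + pi.
  have [H1|H1] := ltP x (xi - pi).
    by exists (- (2 * pi)); [rewrite !inE eqxx !orbT|apply/andP; split; lra].
  have [H2|H2] := ltP (xi + pi) x.
    by exists (2 * pi); [rewrite !inE eqxx !orbT|apply/andP; split; lra].
  by exists 0; [rewrite !inE eqxx|apply/andP; split; lra].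
exists p; split => //; first by rewrite /= in_itv/= xp0.
set z := x - (xi + p).
have z1 : - pi <= z <= pi by apply/andP; split; rewrite /z; lra.
have [s [sE phi1 spE]] : exists s, [/\ s = 1 \/ s = -1, `|z - s * pi| <= pi &
    shock_profile T z = profile T (z - s * pi)].
  rewrite /shock_profile; case: ltP => z0.
    by exists 1; rewrite mul1r ler_norml; split; [left| |] => //; apply/andP; split; lra.
  exists (-1); rewrite mulN1r opprK ler_norml; split; [by right| |by []].
  by apply/andP; split; lra.
have zE : x - xi - p = z by rewrite /z opprD addrA.
have cE : cos (z - s * pi) = - cos (x - xi).
  rewrite -(cos_period (x - xi) pp) zE.
  by case: sE => ->; rewrite ?mul1r ?mulN1r ?opprK ?cosDpi// cosB cospi sinpi; ring.
have snE : sin (z - s * pi) = - sin (x - xi).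
  rewrite -(sin_period (x - xi) pp) zE.
  by case: sE => ->; rewrite ?mul1r ?mulN1r ?opprK ?sinDpi// sinB cospi sinpi; ring.
rewrite /netval (fno_eval_ubar _ _ N3 cE snE) distrC.
have [good|/existsNP[i /negP]] := pselect (off_grid n delta (z - s * pi)).
  by left; rewrite spE; exact: prog_profile.
rewrite -ltNge => bad; right.
have [j jE] : exists j : int, (p + s * pi) = - (j%:~R * pi).
  move: pp; rewrite !inE; case: sE => -> /or3P[] /eqP ->.
  - by exists (-1); rewrite intrN; ring.
  - by exists (-3); rewrite intrN; ring.
  - by exists 1; ring.
  - by exists 1; ring.
  - by exists (-1); rewrite intrN; ring.
  - by exists 3; ring.
have [||m mi mx] := @node_ball_cover n delta x xi (i + j * 2 ^+ n) d1.
- by rewrite ler_norml; apply/andP; split; lra.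
- move: bad; congr (`|_| < _).
  rewrite /z (_ : x - (xi + p) - s * pi = x - xi - (p + s * pi)); last by ring.
  by rewrite jE intrD intrM rmorphXn/=; field; rewrite expf_neq0.
exists m => //; split => //.
apply: (le_trans (ler_normB _ _)); rewrite -[leRHS]/(1 + 1) lerD//.
exact: shock_profile_le1.
Qed.

(** Each ball costs at most the bound 2 times the length [2 * delta]. The distance from [u] to the
    profile is split over the three shifts of the shock, and each part integrates to 0 by
    [entropy_profile]. *)
Lemma profile_fno_error N xi u : (3 <= N)%N -> 0 <= xi <= 2 * pi ->
  entropy_solution u (ubar xi) ->
  (\int[mu]_(x in @per_dom R) (`|u x T - netval N xi x|)%:E <=
   (2 * pi / 2 ^+ n * (2 * pi) + (2 ^ n.+3).+1%:R * (4 * delta))%:E)%E.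
Proof.
move=> N3 xi1 hu; have p0 := pi_gt0 R.
have mu_ := measurable_solution_section hu T.
pose W p : set R := `[xi + p - pi, xi + p + pi]%classic.
pose f p x : \bar R := (`|u x T - shock_profile T (x - (xi + p))|)%:E.
have f0 p x : (0 <= f p x)%E by rewrite lee_fin.
have mf p : measurable_fun setT (f p).
  apply/measurable_EFinP; apply: measurableT_comp => //; apply: measurable_funB => //.
  apply: (measurableT_comp (measurable_shock_profile hT)); exact: measurable_funB.
have mW p : measurable (W p) by exact: measurable_itv.
have mB m : measurable (node_ball n delta xi m) by exact: measurable_itv.
have mD : measurable (@per_dom R) by exact: measurable_itv.
pose e p x := (f p \_ (W p)) x; pose b m x := (cst 2%:E \_ (node_ball n delta xi m)) x : \bar R.
have e0 p x : (0 <= e p x)%E by rewrite /e /patch; case: ifP.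
have b0 m x : (0 <= b m x)%E by rewrite /b /patch; case: ifP => // _; rewrite lee_fin.
have me p : measurable_fun (@per_dom R) (e p).
  by apply: measurable_funTS; exact: measurable_patch.
have mb m : measurable_fun (@per_dom R) (b m).
  by apply: measurable_funTS; exact: measurable_patch.
pose c : R := 2 * pi / 2 ^+ n.
have c0 : 0 <= c by rewrite divr_ge0 ?exprn_ge0//; lra.
pose r := iota 0 (2 ^ n.+3).+1.
apply: (@le_trans _ _ (\int[mu]_(x in @per_dom R)
   (c%:E + (\sum_(p <- periods) e p x + \sum_(m <- r) b m x)))%E).
  apply: ge0_le_integral_nomeas => x; first by rewrite lee_fin.
  rewrite /per_dom /= in_itv/= => x1.
  have [p [pp xW H]] := profile_fno_pointwise N3 x1 xi1.
  have ep : e p x = f p x by rewrite /e /patch mem_set.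
  have tri : `|u x T - netval N xi x| <= `|u x T - shock_profile T (x - (xi + p))| +
      `|shock_profile T (x - (xi + p)) - netval N xi x|.
    by apply: (le_trans _ (ler_normD _ _)); rewrite addrA subrK.
  have E1 : (f p x <= \sum_(p <- periods) e p x)%E by rewrite -ep; exact: (le_sum_mem (fun p => e0 p x) pp).
  case: H => [H|[m mr [mx H]]].
    apply: (@le_trans _ _ (c%:E + (f p x + 0))%E).
      by rewrite adde0 -EFinD lee_fin; apply: (le_trans tri); rewrite addrC lerD2r.
    by apply: leeD => //; apply: leeD => //; exact: sume_ge0.
  apply: (@le_trans _ _ (0 + (f p x + 2%:E))%E).
    by rewrite add0e -EFinD lee_fin; apply: (le_trans tri); rewrite lerD2l.
  apply: leeD; rewrite ?lee_fin//; apply: leeD => //.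
  have -> : 2%:E = b m x by rewrite /b /patch mem_set.
  exact: (le_sum_mem (fun m => b0 m x) mr).
have me' : measurable_fun (@per_dom R) (fun x => \sum_(p <- periods) e p x)%E.
  exact: emeasurable_sum.
have mb' : measurable_fun (@per_dom R) (fun x => \sum_(m <- r) b m x)%E.
  exact: emeasurable_sum.
rewrite ge0_integralD//=; [|by move=> x _; rewrite adde_ge0// sume_ge0|exact: emeasurable_funD].
rewrite ge0_integralD//=; [|by move=> x _; rewrite sume_ge0|by move=> x _; rewrite sume_ge0].
rewrite !ge0_integral_sum//.
rewrite integral_itv_const; last lra.
rewrite subr0 EFinD; apply: leeD => //.
rewrite big1_seq ?add0e => [|p /andP[_ pp]]; last first.
  apply/eqP; rewrite eq_le integral_ge0 ?andbT => [|x _]; last exact: e0.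
  apply: (le_trans (integral_patch_le _ _ _ _)) => //.
  by rewrite [leLHS](entropy_profile (xi := xi + p) hT) ?ubar_period.
apply: (@le_trans _ _ (\sum_(m <- r) (4 * delta)%:E)%E).
  apply: lee_sum => m _; apply: (le_trans (integral_patch_le _ _ _ _)) => //.
    by move=> x; rewrite lee_fin.
  rewrite [leLHS]integral_itv_const ?lee_fin; have := d0; lra.
by rewrite sumEFin big_const_seq count_predT size_iota iter_addr_0 lee_fin -[leLHS]mulr_natl.
Qed.

End Estimate.

(** * Choice of the number of steps and of the margin *)

Section Choice.
Context {R : realType}.
Implicit Types (T eps : R) (n : nat).

(** For the least such [n > 0], minimality gives [n * ln 2 < 8 * ln 2 + ln eps^-1], as
    [128 = 2 ^+ 7]; the 9 follows from [ln 2 <= ln eps^-1]. *)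
Lemma dyadic_scale eps : 0 < eps -> eps <= 1 / 2 ->
  exists n, 128 / eps <= 2 ^+ n /\ n%:R * ln 2 <= 9 * ln eps^-1.
Proof.
move=> e0 e1; have ie : 2 <= eps^-1 by rewrite -[2]invrK lef_pV2 ?posrE ?invr_gt0//; lra.
have [n nP nmin] : exists2 n, 128 / eps <= 2 ^+ n & forall m, 128 / eps <= 2 ^+ m -> (n <= m)%N.
  have ex : exists n, 128 / eps <= 2 ^+ n.
    exists (Num.trunc (128 / eps)).+1; apply: le_trans (ltW (truncnS_gt _)) _.
    by rewrite -natrX ler_nat ltnW// ltn_expl.
  by case: (ex_minnP ex) => n nP nmin; exists n.
exists n; split => //.
have l2 : 0 < ln 2 :> R by rewrite ln_gt0// ltr1n.
have lie : ln 2 <= ln eps^-1 by rewrite ler_ln ?posrE//; lra.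
case: n nP nmin => [_ _|n nP nmin]; first by rewrite mul0r; lra.
have : 2 ^+ n < 128 / eps by rewrite ltNge; apply/negP => /nmin; rewrite ltnn.
have e2 m : 0 < (2 ^+ m : R) by rewrite exprn_gt0.
rewrite -ltr_ln ?posrE ?divr_gt0// lnM ?posrE ?invr_gt0// lnXn//.
have -> : 128 = 2 ^+ 7 :> R by rewrite -natrX.
rewrite lnXn// -[ln 2 *+ n]mulr_natl -[n.+1%:R]natr1 => H.
lra.
Qed.

Lemma pi_le4 : pi <= 4 :> R.
Proof. have := @pihalf_02 R; lra. Qed.

Lemma affine_growth (a b c k s : R) : 0 <= a -> 0 <= b -> 1 <= s -> k <= c * s ->
  a + b * k <= (a + b * c) * s.
Proof. by move=> a0 b0 s1 ks; rewrite mulrDl lerD ?ler_peMr// -mulrA ler_wpM2l. Qed.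

Lemma exists_profile_fno T : pi < T -> exists2 K : R, 0 <= K &
  forall eps, 0 < eps -> eps <= 1 / 2 -> exists2 net : FNO R,
  [/\ fno_kmax net = 1%N, fno_dv net = 12%N, (fno_depth net <= fno_size net)%N &
      (fno_size net)%:R <= K * (ln eps^-1 / ln 2) ^+ 2] &
  forall N xi u, (3 <= N)%N -> 0 <= xi <= 2 * pi -> entropy_solution u (ubar xi) ->
    (\int[@lebesgue_measure R]_(x in @per_dom R) (`|u x T - fno_eval net N (ubar xi) x|)%:E
     <= eps%:E)%E.
Proof.
(* With [t] the binary logarithm of [eps^-1], [n <= 9 * t], so the [6 * n + 3] layers number at most
   [57 * t ^+ 2]. *)
move=> hT; exists (54 + 1080 * 57); first exact: (addr_ge0 (ler0n _ 54) (mulr_ge0 (ler0n _ 1080) (ler0n _ 57))).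
move=> eps e0 e1; have p0 := pi_gt0 R; have p4 := pi_le4.
have [n [n1 n2]] := dyadic_scale e0 e1.
(* The [M] balls then cost [eps / 4] together. *)
pose M : R := (2 ^ n.+3).+1%:R; pose delta := eps / (16 * M).
have M0 : 1 <= M by rewrite ler1n.
have d0 : 0 < delta by apply: divr_gt0 => //; lra.
have d1 : delta <= pi / 2.
  have := pi_ge2 R; rewrite /delta ler_pdivrMr; last lra. nra.
have [prog [Q [sp prog1 progP]]] := profile_prog n hT d0 d1.
have l2 : 0 < ln 2 :> R by rewrite ln_gt0// ltr1n.
set t := ln eps^-1 / ln 2.
have t1 : 1 <= t.
  rewrite /t ler_pdivlMr// mul1r ler_ln ?posrE ?invr_gt0//.
  by rewrite -[2]invrK lef_pV2 ?posrE ?invr_gt0//; lra.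
have nt : n%:R <= 9 * t by rewrite /t mulrA ler_pdivlMr.
have tt : t <= t ^+ 2 by rewrite expr2 ler_peMl//; lra.
exists (profile_fno prog Q).
  have dl : (size prog).+1%:R <= 57 * t ^+ 2 by rewrite sp -addnS natrD natrM; lra.
  split=> //; rewrite size_profile_fno; last rewrite (natrD _ 54 (1080 * _)) (natrM _ 1080).
    by apply: leq_trans (leq_addl _ _); exact: leq_pmull.
  by apply: (affine_growth (ler0n _ 54) (ler0n _ 1080) (le_trans t1 tt) dl).
move=> N xi u N3 xi1 hu.
apply: (le_trans (profile_fno_error hT d0 d1 prog1 progP N3 xi1 hu)).
rewrite lee_fin -/M.
have -> : M * (4 * delta) = eps / 4 by rewrite /delta; field; lra.
suff : 2 * pi / 2 ^+ n * (2 * pi) <= eps / 2 by lra.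
have e2 : 0 < (2 ^+ n : R) by rewrite exprn_gt0.
rewrite mulrAC ler_pdivrMr//.
have : 64 <= eps / 2 * 2 ^+ n.
  by move: n1; rewrite ler_pdivrMr// => n1; lra.
apply: le_trans; nra.
Qed.

End Choice.

Theorem theorem3p6 (R : realType) (T : R) (hT : pi < T) :
  exists C : R, 0 < C /\
  forall eps : R, 0 < eps -> eps <= 1 / 2 ->
  forall N : nat, (3 <= N)%N ->
  exists net : FNO R,
    fno_kmax net = 1%N /\
    (fno_dv net)%:R <= C /\
    (fno_depth net)%:R <= C * ln (eps^-1) ^+ 2 /\
    (fno_size net)%:R <= C * ln (eps^-1) ^+ 2 /\
    forall G : R -> R -> R,
      (forall xi : R, exists u : R -> R -> R,
          entropy_solution u (ubar xi) /\ forall x, G xi x = u x T) ->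
      (((2 * pi)^-1)%:E *
        \int[@lebesgue_measure R]_(xi in @per_dom R)
           \int[@lebesgue_measure R]_(x in @per_dom R)
              (`|G xi x - fno_eval net N (ubar xi) x|)%:E
       <= eps%:E)%E.
Proof.
have p0 := pi_gt0 R.
have l2 : 0 < ln 2 :> R by rewrite ln_gt0// ltr1n.
have q0 : 0 < (ln 2 ^+ 2)^-1 :> R by rewrite invr_gt0 exprn_gt0.
have [K K0 HK] := exists_profile_fno hT.
(* 12 is the lifting dimension; the division by [ln 2 ^+ 2] passes from the binary to the natural
   logarithm. *)
exists (12 + K / ln 2 ^+ 2); split; first by rewrite ltr_pwDl// mulr_ge0// ltW.
move=> eps e0 e1 N N3; have [net [kmax1 dv12 depth_le size_le] netP] := HK eps e0 e1.
have s0 : 0 <= (ln eps^-1) ^+ 2 by exact: sqr_ge0.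
have CE : K * (ln eps^-1 / ln 2) ^+ 2 <= (12 + K / ln 2 ^+ 2) * ln eps^-1 ^+ 2.
  by rewrite expr_div_n [_ ^+ 2 / _]mulrC mulrA mulrDl lerDr mulr_ge0.
have size_le' := le_trans size_le CE.
exists net; split => //; split; first by rewrite dv12 lerDl mulr_ge0// ltW.
split; first by apply: le_trans size_le'; rewrite ler_nat.
split=> //.
move=> G hG; rewrite muleC -lee_pdivlMr ?invr_gt0; last lra.
apply: (@le_trans _ _ (\int[@lebesgue_measure R]_(xi in @per_dom R) eps%:E)%E).
  (* The inner bound is uniform in [xi], and nothing is known about the measurability of the error
     in [xi]. *)
  apply: ge0_le_integral_nomeas => xi; first by move=> _; exact: integral_ge0.
  rewrite /per_dom /= in_itv/= => xi1; have [u [hu GE]] := hG xi.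
  under eq_integral do rewrite GE.
  exact: netP hu.
rewrite integral_itv_const; last lra.
by rewrite subr0 invrK.
Qed.
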